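(* Let $n\ge2$, let $f\colon(\mathbb R^n)^k\to(\mathbb R^n)^m$ be a polynomial map and let $K\subset(\mathbb R^n)^k$ be compact. Then there is a classical linkage $\mathcal L$ in $\mathbb R^n$ which is functional for $f$ with restricted domain $K$, and there is a cabled linkage $\mathcal L'$ in $\mathbb R^n$ which is strongly functional for $f$ with restricted domain $K$. Moreover, one may require that all input and output vertices of $\mathcal L$ and of $\mathcal L'$ be distinct.
   Context: A cabled linkage in $\mathbb R^n$ is $\mathcal L=(L,\ell,V,\mu,F)$: $L$ a finite one-dimensional simplicial complex (vertex set $\mathcal V(L)$, edge set $\mathcal E(L)$), $\ell\colon\mathcal E(L)\to(0,\infty)$, $V\subset\mathcal V(L)$ fixed vertices, $\mu\colon V\to\mathbb R^n$, $F\subset\mathcal E(L)$ flexible edges; classical if $F=\emptyset$. $\mathcal C(\mathcal L)=\{\varphi\colon\mathcal V(L)\to\mathbb R^n\mid\varphi(v)=\mu(v)\ (v\in V),\ |\varphi(v)-\varphi(w)|\le\ell(vw)\ (vw\in F),\ |\varphi(v)-\varphi(w)|=\ell(vw)\ (vw\in\mathcal E(L)\setminus F)\}$. $\mathcal L$ is quasifunctional for $f\colon(\mathbb R^n)^k\to(\mathbb R^n)^m$ if there are vertices $w_1,\dots,w_k$ (input vertices) and $v_1,\dots,v_m$ (output vertices) such that, with $q(\varphi)=(\varphi(w_1),\dots,\varphi(w_k))$ (input map) and $p(\varphi)=(\varphi(v_1),\dots,\varphi(v_m))$ (output map) on $\mathcal C(\mathcal L)$, $p=f\circ q$; $q(\mathcal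 C(\mathcal L))$ is its domain. It is functional for $f$ with restricted domain $U\subset q(\mathcal C(\mathcal L))$ if moreover $q|\colon q^{-1}(U)\to U$ is an analytically trivial covering, i.e. there are a finite set $E$ and an analytic isomorphism $\sigma\colon U\times E\to q^{-1}(U)$ with $q(\sigma(u,c))=u$. It is strongly functional for $f$ if $q\colon\mathcal C(\mathcal L)\to q(\mathcal C(\mathcal L))$ is an analytic isomorphism, and strongly functional with restricted domain $U$ if in addition $U\subset q(\mathcal C(\mathcal L))$. An analytic isomorphism is a homeomorphism $g$ such that $g$ and $g^{-1}$ are restrictions of analytic maps. *)

(* Defs.v *)
From HB Require Import structures.
From mathcomp Require Import all_boot all_order all_algebra.
From mathcomp Require Import all_classical all_reals all_analysis.
Import Order.TTheory GRing.Theory Num.Theory.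
Import numFieldNormedType.Exports.
Local Open Scope classical_set_scope.
Local Open Scope ring_scope.

(* Euclidean coordinate spaces are modelled as R^I = (I -> R) for a finite
   index type I, with the (product = Euclidean) topology of MathComp-Analysis.
   A point of R^n is ('I_n -> R); a point of (R^n)^k is ('I_k * 'I_n -> R). *)

Section Defs.
Context {R : realType}.

Inductive is_poly {I : finType} : ((I -> R) -> R) -> Prop :=
| poly_const (c : R) : is_poly (fun _ => c)
| poly_coord (i : I) : is_poly (fun x => x i)
| poly_add p q : is_poly p -> is_poly q -> is_poly (fun x => p x + q x)
| poly_mul p q : is_poly p -> is_poly q -> is_poly (fun x => p x * q x).

Definition poly_map {I J : finType} (f : (I -> R) -> (J -> R)) : Prop :=
  forall j, is_poly (fun x => f x j).

Definition hom_part {I : finType} (c : (I -> nat) -> R) (x0 y : I -> R) (d : nat) : R :=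
  \sum_(a : {ffun I -> 'I_d.+1} | (\sum_i (a i : nat) == d)%N)
     c (fun i => (a i : nat)) * \prod_i (y i - x0 i) ^+ (a i : nat).

Definition hom_part_abs {I : finType} (c : (I -> nat) -> R) (x0 y : I -> R) (d : nat) : R :=
  \sum_(a : {ffun I -> 'I_d.+1} | (\sum_i (a i : nat) == d)%N)
     `|c (fun i => (a i : nat))| * \prod_i `|y i - x0 i| ^+ (a i : nat).

Definition analytic_at {I : finType} (g : (I -> R) -> R) (x0 : I -> R) : Prop :=
  exists2 r : R, 0 < r & exists c : (I -> nat) -> R,
    forall y : I -> R, (forall i, `|y i - x0 i| < r) ->
      cvg (series (hom_part_abs c x0 y) @ \oo) /\
      series (hom_part c x0 y) @ \oo --> g y.

Definition analytic_on {I J : finType} (U : set (I -> R)) (G : (I -> R) -> (J -> R)) : Prop :=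
  open (U : set {ptws I -> R}) /\ forall x, U x -> forall j, analytic_at (fun y => G y j) x.

Definition restr_analytic {I J : finType} (A : set (I -> R)) (g : (I -> R) -> (J -> R)) : Prop :=
  exists U : set (I -> R), exists G : (I -> R) -> (J -> R),
    [/\ A `<=` U, analytic_on U G & forall x, A x -> G x = g x].

Definition analytic_iso {I J : finType} (A : set (I -> R)) (B : set (J -> R))
    (g : (I -> R) -> (J -> R)) : Prop :=
  exists h : (J -> R) -> (I -> R),
    [/\ (forall x, A x -> B (g x)), (forall y, B y -> A (h y)),
        (forall x, A x -> h (g x) = x) & (forall y, B y -> g (h y) = y)] /\
    {within (A : set {ptws I -> R}), continuous (g : {ptws I -> R} -> {ptws J -> R})} /\
    {within (B : set {ptws J -> R}), continuous (h : {ptws J -> R} -> {ptws I -> R})} /\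
    restr_analytic A g /\ restr_analytic B h.

Definition edist {n : nat} (x y : 'I_n -> R) : R :=
  Num.sqrt (\sum_i (x i - y i) ^+ 2).

Record linkage (n : nat) := Linkage {
  vert : finType;
  edges : {set {set vert}};
  edges2 : forall e, e \in edges -> #|e| = 2%N;
  len : {set vert} -> R;                  (* ell (relevant on edges) *)
  len_pos : forall e, e \in edges -> 0 < len e;
  fixedv : {set vert};
  lpos : vert -> ('I_n -> R);               (* mu (relevant on fixedv) *)
  flex : {set {set vert}};
  flex_sub : flex \subset edges
}.

Arguments vert {n} l.
Arguments edges {n} l.
Arguments edges2 {n} l _ _.
Arguments len {n} l _.
Arguments len_pos {n} l _ _.
Arguments fixedv {n} l.
Arguments lpos {n} l _ _.
Arguments flex {n} l.
Arguments flex_sub {n} l.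

Definition classical {n} (L : linkage n) : Prop := flex L = finset.set0.

Definition vpos {n} {V : finType} (phi : V * 'I_n -> R) (v : V) : 'I_n -> R :=
  fun i => phi (v, i).

Definition config {n} (L : linkage n) : set (vert L * 'I_n -> R) :=
  [set phi |
    (forall v, v \in fixedv L -> vpos phi v = lpos L v) /\
    (forall e, e \in flex L -> forall v w, e = [set v; w]%SET ->
        edist (vpos phi v) (vpos phi w) <= len L e) /\
    (forall e, e \in edges L -> e \notin flex L -> forall v w, e = [set v; w]%SET ->
        edist (vpos phi v) (vpos phi w) = len L e)].

(* input map q (input vertices w) and output map p (output vertices v) *)
Definition vmap {n k} {V : finType} (w : 'I_k -> V) (phi : V * 'I_n -> R)
  : 'I_k * 'I_n -> R := fun ji => phi (w ji.1, ji.2).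

Definition quasifunctional {n k m} (L : linkage n)
    (f : ('I_k * 'I_n -> R) -> ('I_m * 'I_n -> R))
    (w : 'I_k -> vert L) (v : 'I_m -> vert L) : Prop :=
  forall phi, config L phi -> vmap v phi = f (vmap w phi).

(* U x E, with the finite set E = {0,...,N-1} embedded discretely in R:
   the extra coordinate None carries the element of E *)
Definition prodE {I : finType} (U : set (I -> R)) (N : nat) : set (option I -> R) :=
  [set z | U (fun j => z (Some j)) /\ exists c : 'I_N, z None = (c : nat)%:R].

Definition functional {n k m} (L : linkage n)
    (f : ('I_k * 'I_n -> R) -> ('I_m * 'I_n -> R))
    (w : 'I_k -> vert L) (v : 'I_m -> vert L) (U : set ('I_k * 'I_n -> R)) : Prop :=
  [/\ quasifunctional L f w v,
      U `<=` vmap w @` config L &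
      exists N : nat, exists sigma : (option ('I_k * 'I_n) -> R) -> (vert L * 'I_n -> R),
        analytic_iso (prodE U N) (config L `&` vmap w @^-1` U) sigma /\
        forall z, prodE U N z -> vmap w (sigma z) = (fun j => z (Some j))].

Definition strongly_functional {n k m} (L : linkage n)
    (f : ('I_k * 'I_n -> R) -> ('I_m * 'I_n -> R))
    (w : 'I_k -> vert L) (v : 'I_m -> vert L) (U : set ('I_k * 'I_n -> R)) : Prop :=
  [/\ quasifunctional L f w v,
      analytic_iso (config L) (vmap w @` config L) (vmap w) &
      U `<=` vmap w @` config L].

Definition io_distinct {k m} {V : finType} (w : 'I_k -> V) (v : 'I_m -> V) : Prop :=
  [/\ injective w, injective v & forall j j', w j <> v j'].

End Defs.
Arguments vert {R n} l.
Arguments edges {R n} l.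
Arguments edges2 {R n} l _ _.
Arguments len {R n} l _.
Arguments len_pos {R n} l _ _.
Arguments fixedv {R n} l.
Arguments lpos {R n} l _ _.
Arguments flex {R n} l.
Arguments flex_sub {R n} l.

(* Main.v *)
(* All positions are kept in a small perturbation of a rigid base configuration, at a scale
   chosen large compared with the size of the variable data; each moving vertex is tied by a
   cable to a fixed anchor, so that it stays near its base point.  A vertex joined to n earlier
   ones in independent directions is then a unique analytic function of them (trilateration,
   an analytic implicit function theorem for a quadratic system).  A spider, n feet at constant
   distances from two vertices X and Y, produces affine combinations of X and Y, and inversions
   when X is fixed.  Three inversions give a reflection, hence linear projections; inverting,
   projecting and inverting again squares a scalar, and polarization gives products, hence all
   polynomial maps.  This is the cabled linkage.  The classical one replaces each cable by an
   elbow running on a small circle about the anchor: it imposes the cable inequality, and over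
   K it has exactly two positions, which are distinct and analytic. *)
Require Import Defs.
From HB Require Import structures.
From mathcomp Require Import all_boot all_order all_algebra.
From mathcomp Require Import all_classical all_reals all_analysis.
From mathcomp Require Import ring lra.
Import Order.TTheory GRing.Theory Num.Theory.
Import numFieldNormedType.Exports.
Set Implicit Arguments.
Unset Strict Implicit.
Unset Printing Implicit Defensive.
Local Open Scope classical_set_scope.
Local Open Scope ring_scope.

(** Quasifunctionality concerns every configuration, including those whose inputs lie outside K,
    where nothing bounds the moving vertices in advance. Existence of positions is therefore proved
    only over a box containing K, whereas closeness to the base points, and with it uniqueness and
    analyticity, is secured for all configurations; a cable converts closeness over the box into
    closeness everywhere. For the same reason a system carries an open set of inputs on which its
    solution is analytic and which contains the inputs of all its configurations. Tolerances are
    relative to the scale P and fixed before the map to be computed is known: they depend on the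
    base figure of a gadget alone. A map bounded by M on the box then fits into the gadget as soon
    as M <= P del, so gadgets can be composed freely. The inversor is an n-dimensional Peaucellier
    cell and the affine gadget a pantograph. The implicit functions come from quadratic fixed-point
    equations, whose coefficients are determined degree by degree and majorized by B sigma^d / d^2;
    the factor 1/d^2 is stable under convolution. *)

(** * Homogeneous forms and coefficient bounds *)

Section WordSums.
Context {R : realType} {I : finType}.
Implicit Types (F G : seq I -> R) (z : I -> R) (H : (I -> R) -> R).

(* Summing over words instead of multi-indices turns products of forms into concatenation. *)
Fixpoint wsum (d : nat) F : R :=
  if d is d'.+1 then \sum_(a : I) wsum d' (fun w => F (a :: w)) else F [::].

Lemma eq_wsum d F G : (forall w, size w = d -> F w = G w) -> wsum d F = wsum d G.
Proof.
elim: d F G => [|d IH] F G eqFG /=; first exact: eqFG.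
by apply: eq_bigr => a _; apply: IH => w sw; apply: eqFG; rewrite /= sw.
Qed.

Lemma wsumD d F G : wsum d (fun w => F w + G w) = wsum d F + wsum d G.
Proof.
elim: d F G => [|d IH] F G //=.
by rewrite -big_split; apply: eq_bigr => a _; rewrite IH.
Qed.

Lemma wsumZ d c F : wsum d (fun w => c * F w) = c * wsum d F.
Proof.
elim: d F => [|d IH] F //=.
by rewrite big_distrr; apply: eq_bigr => a _; rewrite IH.
Qed.

Lemma wsum0 d : wsum d (fun=> 0) = 0.
Proof. by elim: d => //= d IH; rewrite big1. Qed.

Lemma wsum_sum d (J : finType) (P : pred J) (F : J -> seq I -> R) :
  wsum d (fun w => \sum_(j | P j) F j w) = \sum_(j | P j) wsum d (F j).
Proof.
elim: d F => [|d IH] F //=.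
by rewrite exchange_big; apply: eq_bigr => a _; rewrite IH.
Qed.

Lemma ler_wsum d F G : (forall w, size w = d -> F w <= G w) -> wsum d F <= wsum d G.
Proof.
elim: d F G => [|d IH] F G leFG /=; first exact: leFG.
by apply: ler_sum => a _; apply: IH => w sw; apply: leFG; rewrite /= sw.
Qed.

Lemma ler_norm_wsum d F : `|wsum d F| <= wsum d (fun w => `|F w|).
Proof.
elim: d F => [|d IH] F //=.
by apply: (le_trans (ler_norm_sum _ _ _)); apply: ler_sum => a _; apply: IH.
Qed.

Lemma wsum_cat i j F :
  wsum (i + j) F = wsum i (fun u => wsum j (fun v => F (u ++ v))).
Proof. by elim: i F => [|i IH] F //=; apply: eq_bigr => a _; rewrite IH. Qed.

Lemma wsumM i j F G :
  wsum (i + j) (fun w => F (take i w) * G (drop i w)) = wsum i F * wsum j G.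
Proof.
rewrite wsum_cat mulrC -wsumZ; apply: eq_wsum => u su.
rewrite mulrC -wsumZ; apply: eq_wsum => v _.
by rewrite take_size_cat // drop_size_cat.
Qed.

Definition wmon z (w : seq I) : R := \prod_(i <- w) z i.

Lemma wmon_le z t w : (forall i, `|z i| <= t) -> `|wmon z w| <= t ^+ size w.
Proof.
move=> zt; elim: w => [|a w IH]; first by rewrite /wmon big_nil normr1.
by rewrite /wmon big_cons normrM exprS ler_pM.
Qed.

(** [nu] bounds the l1 norm of the word coefficients. This norm is submultiplicative, which the
    estimates for products rely on. The coefficients are existential because several functions on
    words represent the same form. *)
Definition hform d H nu := exists2 gamma : seq I -> R,
  forall z, H z = wsum d (fun w => gamma w * wmon z w) &
  wsum d (fun w => `|gamma w|) <= nu.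

Lemma hform_le d H nu nu' : nu <= nu' -> hform d H nu -> hform d H nu'.
Proof. by move=> le [g Hg bg]; exists g => //; apply: le_trans le. Qed.

Lemma eq_hform d H H' nu : (forall z, H z = H' z) -> hform d H nu -> hform d H' nu.
Proof. by move=> e [g Hg bg]; exists g => // z; rewrite -e. Qed.

Lemma hform0 d nu : 0 <= nu -> hform d (fun=> 0) nu.
Proof.
move=> nu0; exists (fun=> 0) => [z|].
  by under eq_wsum do rewrite mul0r; rewrite wsum0.
by under eq_wsum do rewrite normr0; rewrite wsum0.
Qed.

Lemma hform_const c : hform 0 (fun=> c) `|c|.
Proof. by exists (fun=> c) => [z|] //=; rewrite /wmon big_nil mulr1. Qed.

Lemma hform_coord i : hform 1 (fun z => z i) 1.
Proof.
exists (fun w => if w is a :: _ then (a == i)%:R else 0) => [z|] /=.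
  rewrite (bigD1 i) //= big1 ?addr0 => [|a /negbTE ->]; last by rewrite mul0r.
  by rewrite eqxx mul1r /wmon big_cons big_nil mulr1.
rewrite (bigD1 i) //= big1 ?addr0 => [|a /negbTE ->]; last by rewrite normr0.
by rewrite eqxx normr1.
Qed.

Lemma hformD d H H' a b :
  hform d H a -> hform d H' b -> hform d (fun z => H z + H' z) (a + b).
Proof.
move=> [g Hg bg] [g' Hg' bg']; exists (fun w => g w + g' w) => [z|].
  by under eq_wsum do rewrite mulrDl; rewrite wsumD -Hg -Hg'.
apply: le_trans (lerD bg bg'); rewrite -wsumD; apply: ler_wsum => w _.
exact: ler_normD.
Qed.

Lemma hformZ d H c a : hform d H a -> hform d (fun z => c * H z) (`|c| * a).
Proof.
move=> [g Hg bg]; exists (fun w => c * g w) => [z|].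
  by under eq_wsum do rewrite -mulrA; rewrite wsumZ -Hg.
by under eq_wsum do rewrite normrM; rewrite wsumZ ler_wpM2l.
Qed.

Lemma hform_sum d (J : Type) (r : seq J) (P : pred J) (H : J -> (I -> R) -> R) (a : J -> R) :
  (forall j, P j -> hform d (H j) (a j)) ->
  hform d (fun z => \sum_(j <- r | P j) H j z) (\sum_(j <- r | P j) a j).
Proof.
move=> Hj; elim: r => [|j r IH].
  by rewrite big_nil; apply: (eq_hform (H := fun=> 0)) (hform0 _ _) => // z; rewrite big_nil.
rewrite big_cons; case: (boolP (P j)) => Pj; last first.
  by apply: eq_hform IH => z; rewrite big_cons (negbTE Pj).
by apply: eq_hform (hformD (Hj j Pj) IH) => z; rewrite big_cons Pj.
Qed.

(** Cutting words at position i makes the coefficients of the product a tensor product, so the l1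
    norms multiply. *)
Lemma hformM i j H H' a b :
  hform i H a -> hform j H' b -> hform (i + j) (fun z => H z * H' z) (a * b).
Proof.
move=> [g Hg bg] [g' Hg' bg']; exists (fun w => g (take i w) * g' (drop i w)) => [z|].
  rewrite Hg Hg' -wsumM; apply: eq_wsum => w _.
  have -> : wmon z w = wmon z (take i w) * wmon z (drop i w).
    by rewrite /wmon -big_cat cat_take_drop.
  by rewrite mulrACA.
under eq_wsum do rewrite normrM.
have sqnorm k F : 0 <= wsum k (fun w => `|F w|) by rewrite -(wsum0 k); apply: ler_wsum.
rewrite (wsumM i j (fun w => `|g w|) (fun w => `|g' w|)); exact: ler_pM.
Qed.

Lemma hform_bound d H nu z t :
  hform d H nu -> (forall i, `|z i| <= t) -> 0 <= t -> `|H z| <= nu * t ^+ d.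
Proof.
move=> [g -> bg] zt t0; apply: (le_trans (ler_norm_wsum _ _)).
apply: le_trans (ler_wpM2r (exprn_ge0 d t0) bg).
rewrite mulrC -wsumZ; apply: ler_wsum => w sw.
by rewrite normrM mulrC ler_wpM2r // -sw wmon_le.
Qed.

End WordSums.

(** * Power series expansions with remainder estimates *)

Section Expansions.
Context {R : realType} {I : finType}.
Implicit Types (g h : (I -> R) -> R) (x z : I -> R) (H : nat -> (I -> R) -> R).

Definition shift x z : I -> R := fun i => x i + z i.

(* The expansion is expressed by a remainder estimate, which passes to products algebraically. *)
Definition expsb g x H A rho :=
  [/\ 0 < A, 0 < rho, (forall d, hform d (H d) (A * rho ^+ d)) &
    forall N z t, 0 <= t -> t * rho <= 2^-1 -> (forall i, `|z i| <= t) ->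
      `|g (shift x z) - \sum_(d < N) H d z| <= A * (rho * t) ^+ N].

Definition exps g x H := exists A rho, expsb g x H A rho.

Definition ana g x := exists H, exps g x H.

Lemma expsb_le g x H A rho A' rho' :
  A <= A' -> rho <= rho' -> expsb g x H A rho -> expsb g x H A' rho'.
Proof.
move=> leA lerho [A0 r0 Hd Hr]; have A'0 := lt_le_trans A0 leA.
have r'0 := lt_le_trans r0 lerho; split=> // [d|N z t t0 tr zt].
  apply: hform_le (Hd d); rewrite ler_pM ?exprn_ge0 ?(ltW A0) ?(ltW r0) //.
  by rewrite lerXn2r // nnegrE ltW.
have le1 : rho * t <= rho' * t by rewrite ler_wpM2r.
apply: (le_trans (Hr N z t t0 _ zt)).
  by rewrite mulrC (le_trans le1) // mulrC.
rewrite ler_pM ?exprn_ge0 ?(ltW A0) ?mulr_ge0 ?(ltW r0) //.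
by rewrite lerXn2r // nnegrE mulr_ge0 // ltW.
Qed.

Lemma exps_const c x : exps (fun=> c) x (fun d _ => if d == 0%N then c else 0).
Proof.
exists (`|c| + 1), 1; have c0 : 0 < `|c| + 1 by rewrite ltr_wpDl.
split=> // [[|d]|N z t t0 _ _]; rewrite ?expr1n ?mulr1.
- by apply: hform_le (hform_const c); rewrite lerDl.
- by apply: hform0; rewrite ltW.
case: N => [|N]; first by rewrite big_ord0 subr0 expr0 mulr1 lerDl.
rewrite big_ord_recl big1 //= addr0 subrr normr0.
by rewrite mulr_ge0 ?exprn_ge0 ?mul1r // ltW.
Qed.

Lemma exps_coord i x :
  exps (fun y => y i) x
    (fun d z => if d == 0%N then x i else if d == 1%N then z i else 0).
Proof.
exists (`|x i| + 1), 1; have c0 : 0 < `|x i| + 1 by rewrite ltr_wpDl.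
split=> // [[|[|d]]|N z t t0 t1 zt]; rewrite ?expr1n ?mulr1 /=.
- by apply: hform_le (hform_const _); rewrite lerDl.
- by apply: hform_le (hform_coord _); rewrite lerDr.
- by apply: hform0; rewrite ltW.
case: N => [|[|N]].
- rewrite big_ord0 subr0 expr0 mulr1 /shift (le_trans (ler_normD _ _)) // lerD2l.
  by apply: (le_trans (zt i)); lra.
- rewrite big_ord1 /= /shift addrC addKr mul1r expr1 (le_trans (zt i)) //.
  by rewrite ler_peMl // lerDr.
rewrite !big_ord_recl big1 //= addr0 /shift subrr normr0.
by rewrite mulr_ge0 ?exprn_ge0 ?mul1r // ltW.
Qed.

Lemma exps_common g h x H H' : exps g x H -> exps h x H' ->
  exists A rho, expsb g x H A rho /\ expsb h x H' A rho.
Proof.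
move=> [A [r HA]] [A' [r' HA']]; exists (Num.max A A'), (Num.max r r').
by split; [move: HA|move: HA']; apply: expsb_le; rewrite le_max lexx ?orbT.
Qed.

Lemma expsD g h x H H' : exps g x H -> exps h x H' ->
  exps (fun y => g y + h y) x (fun d z => H d z + H' d z).
Proof.
move=> e e'; have [A [r [[A0 r0 Hd Hr] [_ _ Hd' Hr']]]] := exps_common e e'.
exists (A + A), r; split=> // [|d|N z t t0 tr zt]; first by rewrite addr_gt0.
  by rewrite mulrDl; apply: hformD.
rewrite big_split /= opprD addrACA mulrDl (le_trans (ler_normD _ _)) //.
by rewrite lerD ?Hr ?Hr'.
Qed.

Lemma hform_at_center g x H z : exps g x H -> H 0%N z = g x.
Proof.
move=> [A [r [A0 r0 Hd Hr]]].
have H0 : H 0%N z = H 0%N (fun=> 0).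
  by case: (Hd 0%N) => ga e _; rewrite !e /= /wmon !big_nil.
have h0 : 0 * r <= 2^-1 by rewrite mul0r invr_ge0.
have h1 (i : I) : `|0 : R| <= 0 by rewrite normr0.
have := Hr 1%N (fun=> 0) 0 (lexx _) h0 h1.
rewrite big_ord1 mulr0 expr1 mulr0 H0 normr_le0 subr_eq0 => /eqP <-; congr g.
by apply/funext => i; rewrite /shift addr0.
Qed.

Definition cauchy H H' d z := \sum_(i < d.+1) H i z * H' (d - i)%N z.

Lemma sum_cauchy (a b : nat -> R) N :
  \sum_(d < N) \sum_(i < d.+1) a i * b (d - i)%N =
  \sum_(i < N) a i * \sum_(j < N - i) b j.
Proof.
elim: N => [|N IH]; first by rewrite !big_ord0.
rewrite big_ord_recr IH /= [in RHS]big_ord_recr /= subSnn big_ord1.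
rewrite [X in _ + X = _]big_ord_recr /= subnn addrA; congr (_ + _).
rewrite -big_split; apply: eq_bigr => i _ /=.
by rewrite -mulrDr subSn ?(ltnW (ltn_ord i)) // big_ord_recr.
Qed.

Lemma expsM g h x H H' : exps g x H -> exps h x H' ->
  exps (fun y => g y * h y) x (cauchy H H').
Proof.
move=> e e'; have [A [r [[A0 r0 Hd Hr] [_ _ Hd' Hr']]]] := exps_common e e'.
(* The N + 1 products that appear in degree N are absorbed by doubling the rate, since N + 1 <=
   2^N. *)
have cnt N (q : R) : 0 <= q -> N.+1%:R * (A * A * q ^+ N) <= A * A * (2 * q) ^+ N.
  move=> q0; rewrite exprMn mulrCA ler_wpM2l ?mulr_ge0 ?(ltW A0) //.
  by rewrite ler_wpM2r ?exprn_ge0 // -natrX ler_nat ltn_expl.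
exists (A * A), (2 * r); split=> [|||N z t t0 tr zt]; rewrite ?mulr_gt0 //.
  move=> d; apply: hform_le (cnt d r (ltW r0)) _.
  have -> : d.+1%:R * (A * A * r ^+ d) = \sum_(i < d.+1) A * A * r ^+ d.
    by rewrite sumr_const card_ord mulr_natl.
  apply: hform_sum => i _; have le_id : (i <= d)%N by rewrite -ltnS.
  have -> : A * A * r ^+ d = (A * r ^+ i) * (A * r ^+ (d - i)).
    by rewrite mulrACA -exprD subnKC.
  by rewrite -[X in hform X](subnKC le_id); apply: hformM.
have tr' : t * r <= 2^-1.
  by apply: le_trans tr; rewrite ler_wpM2l // ler_peMl ?(ltW r0) // ler1n.
set y := shift x z; rewrite /cauchy (sum_cauchy (H^~ z) (H'^~ z)).
(* The error is split into N + 1 terms of order N: the tail of [g] times [h], and each form of [g]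
   times the matching tail of [h]. *)
have -> : g y * h y - \sum_(i < N) H i z * \sum_(j < N - i) H' j z =
  (g y - \sum_(i < N) H i z) * h y +
  \sum_(i < N) H i z * (h y - \sum_(j < N - i) H' j z).
  have -> : \sum_(i < N) H i z * (h y - \sum_(j < N - i) H' j z) =
      (\sum_(i < N) H i z) * h y - \sum_(i < N) H i z * \sum_(j < N - i) H' j z.
    by rewrite mulr_suml -sumrB; apply: eq_bigr => i _; rewrite mulrBr.
  by rewrite mulrBl addrA subrK.
have rt0 : 0 <= r * t by rewrite mulr_ge0 // ltW.
rewrite -[2 * r * t]mulrA; apply: le_trans (cnt N (r * t) rt0).
rewrite -[N.+1%:R]natr1 [leRHS]mulrDl mul1r [leRHS]addrC (le_trans (ler_normD _ _)) // lerD //.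
  rewrite normrM [leRHS]mulrAC ler_pM //; first exact: Hr.
  by have := Hr' 0%N z t t0 tr' zt; rewrite big_ord0 subr0 mulr1.
apply: (le_trans (ler_norm_sum _ _ _)).
have -> : N%:R * (A * A * (r * t) ^+ N) = \sum_(i < N) A * A * (r * t) ^+ N.
  by rewrite sumr_const card_ord mulr_natl.
apply: ler_sum => i _.
have -> : A * A * (r * t) ^+ N = (A * r ^+ i * t ^+ i) * (A * (r * t) ^+ (N - i)).
  by rewrite -[A * r ^+ i * _]mulrA -exprMn mulrACA -exprD subnKC // ltnW.
rewrite normrM ler_pM //; last exact: Hr'.
exact: hform_bound.
Qed.

Lemma exps_sum (J : finType) (g : J -> (I -> R) -> R) x (H : J -> nat -> (I -> R) -> R) :
  (forall j, exps (g j) x (H j)) ->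
  exps (fun y => \sum_j g j y) x (fun d z => \sum_j H j d z).
Proof.
move=> e.
elim: (index_enum J) => [|j s IH].
  have -> : (fun y => \sum_(j <- [::]) g j y) = fun=> 0.
    by apply/funext => y; rewrite big_nil.
  have -> : (fun d z => \sum_(j <- [::]) H j d z) =
    fun d _ => if d == 0%N then 0 else 0.
    by apply/funext => d; apply/funext => z; rewrite big_nil if_same.
  exact: exps_const.
have := expsD (e j) IH; congr exps.
  by apply/funext => y; rewrite big_cons.
by apply/funext => d; apply/funext => z; rewrite big_cons.
Qed.

Definition near_box x (P : (I -> R) -> Prop) :=
  exists2 r : R, 0 < r & forall y, (forall i, `|y i - x i| < r) -> P y.

Lemma near_boxW x (P Q : (I -> R) -> Prop) :
  (forall y, P y -> Q y) -> near_box x P -> near_box x Q.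
Proof. by move=> PQ [r r0 h]; exists r => // y /h /PQ. Qed.

Lemma near_boxI x (P Q : (I -> R) -> Prop) :
  near_box x P -> near_box x Q -> near_box x (fun y => P y /\ Q y).
Proof.
move=> [r r0 h] [r' r'0 h']; exists (Num.min r r'); first by rewrite lt_min r0.
move=> y yr; split; [apply: h|apply: h'] => i;
  by have := yr i; rewrite lt_min => /andP[].
Qed.

Lemma near_box_all (J : finType) x (P : J -> (I -> R) -> Prop) :
  (forall j, near_box x (P j)) -> near_box x (fun y => forall j, P j y).
Proof.
move=> h; suff [r r0 hr] : near_box x (fun y => forall j, j \in enum J -> P j y).
  by exists r => // y /hr hy j; apply: hy; rewrite mem_enum.
elim: (enum J) => [|j s IH]; first by exists 1.
have := near_boxI (h j) IH; apply: near_boxW => y [Pj Ps] i.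
by rewrite inE => /orP[/eqP -> //|/Ps].
Qed.

Lemma exps_eq_near g h x H : near_box x (fun y => g y = h y) -> exps g x H -> exps h x H.
Proof.
move=> [r r0 e] [A [rho /(expsb_le (lexx A))]] hA.
(* A rate of at least 1/r confines the admissible t to r/2, inside the box where [g] and [h]
   agree. *)
have le1 : rho <= Num.max rho r^-1 by rewrite le_max lexx.
have [A0 r'0 Hd Hr] := hA _ le1; exists A, (Num.max rho r^-1); split=> //.
move=> N z t t0 tr zt; rewrite -e ?Hr // => i.
rewrite /shift addrC addKr (le_lt_trans (zt i)) //.
suff : t * r^-1 <= 2^-1.
  by rewrite ler_pdivrMr // => /le_lt_trans; apply; rewrite gtr_pMl //; lra.
by apply: le_trans tr; rewrite ler_wpM2l // le_max lexx orbT.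
Qed.

(** With all forms zero the remainder bound gives |g| <= A / 2^N for every N. This turns an identity
    between expansions into an identity between functions near x. *)
Lemma exps_zero g x : exps g x (fun _ _ => 0) -> near_box x (fun y => g y = 0).
Proof.
move=> [A [rho [A0 r0 _ Hr]]]; exists (2 * rho)^-1; first by rewrite invr_gt0 mulr_gt0.
move=> y yx; apply/eqP; rewrite -normr_le0; apply/ler_addgt0Pl => e e0; rewrite addr0.
have t0 : 0 <= (2 * rho)^-1 by rewrite invr_ge0 mulr_ge0 // ltW.
have tr : (2 * rho)^-1 * rho <= 2^-1 by rewrite invfM -mulrA mulVf ?mulr1 // gt_eqF.
have /(_ _ (fun i => y i - x i) _ t0 tr (fun i => ltW (yx i))) := Hr.
have -> : shift x (fun i => y i - x i) = y by apply/funext => i; rewrite /shift subrKC.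
move=> bnd; have [N AN] : exists N, A / e < N%:R.
  by exists (Num.bound (A / e)); rewrite archi_boundP // divr_ge0 // ltW.
have := bnd N; rewrite big1_eq subr0 => /le_trans; apply.
have -> : rho * (2 * rho)^-1 = 2^-1 by rewrite invfM mulrCA divff ?mulr1 // gt_eqF.
rewrite exprVn ler_pdivrMr ?exprn_gt0 //.
move: AN; rewrite ltr_pdivrMr // mulrC => /ltW /le_trans; apply.
by rewrite ler_pM2l // -natrX ler_nat ltnW // ltn_expl.
Qed.

Lemma ana_cont g x e : ana g x -> 0 < e -> near_box x (fun y => `|g y - g x| < e).
Proof.
move=> [H eH] e0; have H0 := hform_at_center _ eH; case: eH => A [rho [A0 r0 _ Hr]].
pose t := Num.min (2 * rho)^-1 (e / (2 * A * rho)).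
have t0 : 0 < t by rewrite lt_min invr_gt0 divr_gt0 ?mulr_gt0.
exists t => // y yx; have tr : t * rho <= 2^-1.
  by rewrite -ler_pdivlMr // -invfM ge_min lexx.
have := Hr 1%N (fun i => y i - x i) t (ltW t0) tr (fun i => ltW (yx i)).
have -> : shift x (fun i => y i - x i) = y by apply/funext => i; rewrite /shift subrKC.
rewrite big_ord1 H0 expr1 => /le_lt_trans; apply.
have : t <= e / (2 * A * rho) by rewrite ge_min lexx orbT.
rewrite ler_pdivlMr ?mulr_gt0 //; nra.
Qed.
End Expansions.

(** * Series bounds and the weight 1/d^2 *)

Section QuadraticFixpoint.
Context {R : realType} {I J : finType}.
Implicit Types (x z : I -> R).

Lemma geometric_limit (u : nat -> R) a q : 0 <= a -> 0 <= q -> q <= 2^-1 ->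
  (forall d, `|u d| <= a * q ^+ d) ->
  forall N, `|limn (series u) - \sum_(d < N) u d| <= a * 2 * q ^+ N.
Proof.
move=> a0 q0 q2 hu N.
have su M : series u M = \sum_(d < M) u d by rewrite /series /= big_mkord.
have cu : cvgn (series u).
  apply: normed_cvg; apply: (@series_le_cvg _ _ (geometric a q)) => //.
  - by move=> i; exact: normr_ge0.
  - by move=> i; rewrite /geometric /= mulr_ge0 ?exprn_ge0.
  - by apply: is_cvg_geometric_series; rewrite ger0_norm // (le_lt_trans q2) //; lra.
(* Since q <= 1/2, the term a q^i is at most 2 a q^i - 2 a q^(i+1), so the bounds telescope. *)
have part M : `|series u (N + M)%N - series u N| <= a * 2 * q ^+ N - a * 2 * q ^+ (N + M).
  elim: M => [|M IH]; first by rewrite addn0 !subrr normr0.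
  rewrite addnS !su big_ord_recr /= -!su [X in `|X|]addrAC.
  apply: (le_trans (ler_normD _ _)); apply: le_trans (lerD IH (hu _)) _.
  have e0 : 0 <= a * q ^+ (N + M) by rewrite mulr_ge0 ?exprn_ge0.
  rewrite exprS; nra.
rewrite -su; have h : (fun M => `|series u M - series u N|) @ \oo --> `|limn (series u) - series u N|.
  by apply: cvg_norm; apply: cvgB => //; apply: cvg_cst.
apply: (cvgr_to_le h); near=> M.
have NM : (N <= M)%N by near: M; exact: nbhs_infty_ge.
rewrite -(subnKC NM); apply: (le_trans (part _)).
by rewrite lerBlDr lerDl !mulr_ge0 ?exprn_ge0.
Unshelve. all: by end_near.
Qed.

Lemma exps_of_hform (H : nat -> (I -> R) -> R) A rho x : 0 < A -> 0 < rho ->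
  (forall d, hform d (H d) (A * rho ^+ d)) ->
  exps (fun y => limn (series (fun d => H d (fun i => y i - x i)))) x H.
Proof.
move=> A0 r0 Hd; exists (A * 2), rho; split=> // [|d|N z t t0 tr zt].
- by rewrite mulr_gt0.
- apply: hform_le (Hd d); rewrite ler_wpM2r ?exprn_ge0 ?(ltW r0) //.
  by rewrite ler_peMr ?(ltW A0) // ler1n.
have -> : (fun i => shift x z i - x i) = z.
  by apply/funext => i; rewrite /shift addrC addKr.
apply: geometric_limit => [|||d]; rewrite ?(ltW A0) //.
- by rewrite mulr_ge0 // ltW.
- by rewrite mulrC.
by rewrite exprMn mulrA; apply: hform_bound.
Qed.

Lemma exps_family (g : J -> (I -> R) -> R) x (H : J -> nat -> (I -> R) -> R) :
  (forall j, exps (g j) x (H j)) -> exists A rho, forall j, expsb (g j) x (H j) A rho.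
Proof.
move=> e; suff [A [rho h]] : exists A rho, forall j, j \in enum J -> expsb (g j) x (H j) A rho.
  by exists A, rho => j; apply: h; rewrite mem_enum.
elim: (enum J) => [|j s [A [rho IH]]]; first by exists 1, 1.
have [A' [rho' h]] := e j; exists (Num.max A A'), (Num.max rho rho') => i.
rewrite inE => /orP[/eqP -> | /IH]; last by apply: expsb_le; rewrite le_max lexx.
by apply: expsb_le h; rewrite le_max lexx orbT.
Qed.

(** The weight 1/d^2 reproduces itself under convolution up to the factor 8, so a bound by B sigma^d
    / d^2 survives a product of two series, where a plain geometric bound would pick up a factor
    growing with d. Its value at 0 is 0, as suits series without constant term. *)
Definition invsq (d : nat) : R := (d%:R ^+ 2)^-1.

Lemma invsq0 : invsq 0 = 0.
Proof. by rewrite /invsq expr0n invr0. Qed.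

Lemma invsq_ge0 d : 0 <= invsq d.
Proof. by rewrite invr_ge0 exprn_ge0. Qed.

Lemma invsq_le1 d : invsq d <= 1.
Proof.
case: d => [|d]; first by rewrite invsq0.
by rewrite invf_le1 ?exprn_gt0 ?ltr0n // exprn_ege1 // ler1n.
Qed.

Lemma sum_invsq m : \sum_(i < m) invsq i <= 2.
Proof.
case: m => [|m]; first by rewrite big_ord0.
case: m => [|m]; first by rewrite big_ord1 invsq0.
suff : \sum_(i < m.+2) invsq i <= 2 - m.+1%:R^-1.
  by move/le_trans; apply; rewrite lerBlDr lerDl invr_ge0.
elim: m => [|m IH]; first by rewrite !big_ord_recr big_ord0 /= invsq0 /invsq; lra.
rewrite big_ord_recr /=; apply: le_trans (lerD IH (lexx _)) _.
rewrite /invsq -[m.+2%:R]natr1; set a : R := m.+1%:R.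
have a0 : 0 < a by rewrite ltr0n.
suff : ((a + 1) ^+ 2)^-1 <= a^-1 - (a + 1)^-1.
  by move=> h; apply: (le_trans (lerD (lexx _) h)); rewrite addrA subrK.
have -> : a^-1 - (a + 1)^-1 = (a * (a + 1))^-1 by field; lra.
by rewrite lef_pV2 ?posrE ?exprn_gt0 ?mulr_gt0 ?addr_gt0 //; nra.
Qed.

(* From 1/(i j) = (1/i + 1/j)/(i + j). *)
Lemma invsq_conv d : \sum_(i < d.+1) invsq i * invsq (d - i) <= 8 * invsq d.
Proof.
have term (i : 'I_d.+1) : invsq i * invsq (d - i) <= 2 * invsq d * (invsq i + invsq (d - i)).
  have [i0|i0] := eqVneq (i : nat) 0%N.
    by rewrite i0 invsq0 mul0r mulr_ge0 ?addr_ge0 ?mulr_ge0 ?invsq_ge0.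
  have [di|di] := eqVneq (d - i)%N 0%N.
    by rewrite di invsq0 mulr0 mulr_ge0 ?addr_ge0 ?mulr_ge0 ?invsq_ge0.
  have -> : invsq d = ((i%:R + (d - i)%:R) ^+ 2)^-1.
    by rewrite -natrD subnKC // -ltnS.
  rewrite /invsq; move: i0 di; rewrite -!lt0n -!(ltr0n R).
  move: (i%:R : R) ((d - i)%:R : R) => a b a0 b0.
  have -> : 2 * ((a + b) ^+ 2)^-1 * ((a ^+ 2)^-1 + (b ^+ 2)^-1) =
     ((a ^+ 2)^-1 * (b ^+ 2)^-1) * ((2 * (a ^+ 2 + b ^+ 2)) / (a + b) ^+ 2).
    by field; rewrite !lt0r_neq0 // addr_gt0.
  rewrite ler_peMr ?mulr_ge0 ?invr_ge0 ?sqr_ge0 // ler_pdivlMr ?exprn_gt0 ?addr_gt0 //.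
  rewrite -subr_ge0 (_ : _ - _ = (a - b) ^+ 2) ?sqr_ge0 //; ring.
apply: le_trans (ler_sum _ (fun i _ => term i)) _.
rewrite -big_distrr big_split /= [8 * _](_ : _ = 2 * invsq d * (2 + 2)); last by ring.
rewrite ler_wpM2l ?mulr_ge0 ?invsq_ge0 // lerD ?sum_invsq //.
rewrite (reindex_inj rev_ord_inj) /=.
under eq_bigr => i _ do rewrite subSS subKn -1?ltnS //.
exact: sum_invsq.
Qed.

Lemma geometric_invsq (A rho e : R) : 0 < A -> 0 < rho -> 0 < e ->
  exists2 sigma, 0 < sigma &
    forall d, (0 < d)%N -> A * rho ^+ d <= e * (sigma ^+ d * invsq d).
Proof.
move=> A0 r0 e0; pose mu := 1 + A / e.
have mu1 : 1 <= mu by rewrite lerDl divr_ge0 // ltW.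
exists (4 * rho * mu); first by rewrite !mulr_gt0 // (lt_le_trans ltr01).
move=> d d0; rewrite mulrA ler_pdivlMr ?exprn_gt0 ?ltr0n //.
have d4 : (d%:R : R) ^+ 2 <= 4 ^+ d.
  by rewrite -!natrX ler_nat -[4%N]/(2 ^ 2)%N -expnM mulnC expnM leq_exp2r // ltnW // ltn_expl.
have Amu : A <= e * mu ^+ d.
  have : A <= e * mu.
    have -> : e * mu = e + A by rewrite /mu; field; rewrite lt0r_neq0.
    by rewrite lerDr ltW.
  move/le_trans; apply; rewrite ler_pM2l // -{1}[mu]expr1.
  exact: ler_weXn2l.
have -> : (4 * rho * mu) ^+ d = mu ^+ d * (4 * rho) ^+ d by rewrite -exprMn mulrC.
rewrite -[leLHS]mulrA [leRHS]mulrA ler_pM ?(ltW A0) //.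
  by rewrite mulr_ge0 ?exprn_ge0 // ltW.
by rewrite exprMn [leRHS]mulrC ler_wpM2l // exprn_ge0 // ltW.
Qed.

End QuadraticFixpoint.

(** The closing inequality of the majorant induction: the three terms come from p, from the products
    q c and from the squares c^2, and B is small enough for their sum to stay below B times the
    weight. *)
Lemma majorant_step (R : realFieldType) (B n S a w : R) :
  B * (24 * n * S + 24 * n + 1) = 1 -> 0 <= B -> 0 <= n -> 0 <= S -> 0 <= w -> a <= S ->
  B / 3 * w + n * (B / 3 * B * 8 * w) + a * (n * (B * B * 8 * w)) <= B * w.
Proof.
move=> BD B0 n0 S0 w0 aS.
have -> : B / 3 * w + n * (B / 3 * B * 8 * w) + a * (n * (B * B * 8 * w)) =
  B * w * (3^-1 + n * B * (8 / 3) + a * (n * B) * 8) by ring.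
have nB0 : 0 <= n * B by rewrite mulr_ge0.
rewrite ler_piMr ?mulr_ge0 //.
have : a * (n * B) <= S * (n * B) by rewrite ler_wpM2r.
have : 0 <= S * (n * B) by rewrite mulr_ge0.
have : 24 * (S * (n * B)) + 24 * (n * B) + B = 1 by rewrite -[RHS]BD; ring.
move: (a * (n * B)) (S * (n * B)) (n * B) nB0 => u v t; lra.
Qed.

(** * Analytic solution of quadratic fixed-point systems by majorants *)

Section QuadraticSolution.
Context {R : realType} {I J : finType}.
Variables (x : I -> R) (p : J -> (I -> R) -> R) (q : J -> J -> (I -> R) -> R) (s : J -> R).
Hypothesis (p_ana : forall j, ana (p j) x) (q_ana : forall j k, ana (q j k) x).
Hypothesis (p0 : forall j, p j x = 0) (q0 : forall j k, q j k x = 0).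

(** The degree d part of the right-hand side of c_j = p_j + sum_k q_jk c_k + s_j sum_k c_k^2. When
    p, q and c have no constant term, it involves c only in degrees below d. *)
Let qform (P : J -> nat -> (I -> R) -> R) (Q : J -> J -> nat -> (I -> R) -> R)
    (c : J -> nat -> (I -> R) -> R) (j : J) (d : nat) (z : I -> R) :=
  P j d z + \sum_k cauchy (Q j k) (c k) d z + s j * \sum_k cauchy (c k) (c k) d z.

Section Coefficients.
Variables (P : J -> nat -> (I -> R) -> R) (Q : J -> J -> nat -> (I -> R) -> R).
Hypothesis (P0 : forall j z, P j 0%N z = 0) (Q0 : forall j k z, Q j k 0%N z = 0).

(* Iterating from 0 determines the coefficients of degree d after d steps. *)
Let approx m := iter m (qform P Q) (fun _ _ _ => 0).
Let coef j d := approx d j d.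

Let approx0 m j z : approx m j 0%N z = 0.
Proof.
elim: m j => //= m IH j; rewrite /qform /cauchy P0 !big1 ?mulr0 ?addr0 // => k _.
  by rewrite big_ord1 IH mul0r.
by rewrite big_ord1 Q0 mul0r.
Qed.

Let coef0 j z : coef j 0%N z = 0. Proof. by []. Qed.

Let qform_eq c c' d j z :
  (forall k, c k 0%N z = 0) -> (forall k, c' k 0%N z = 0) ->
  (forall k i, (i < d)%N -> c k i z = c' k i z) -> qform P Q c j d z = qform P Q c' j d z.
Proof.
move=> c0 c'0 e; have e' k (i : 'I_d.+1) : c k i z = c' k i z \/ (d - i = 0)%N.
  have := ltn_ord i; rewrite ltnS leq_eqVlt => /orP[/eqP ->|/e ->]; last by left.
  by right; rewrite subnn.
have e'' k (i : 'I_d.+1) : c k (d - i)%N z = c' k (d - i)%N z \/ (i = 0 :> nat)%N.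
  have [->|i0] := posnP i; first by right.
  by left; apply: e; rewrite ltn_subrL i0 (leq_trans i0) // -ltnS.
rewrite /qform; congr (_ + _ + _ * _); apply: eq_bigr => k _; apply: eq_bigr => i _.
  by case: (e'' k i) => [->|->] //; rewrite Q0 !mul0r.
case: (e'' k i) => [->|->]; last by rewrite c0 c'0 !mul0r.
by case: (e' k i) => [->|->] //; rewrite c'0 !mulr0.
Qed.

Let approx_stable m j d z : (d <= m)%N -> approx m.+1 j d z = approx m j d z.
Proof.
elim: m j d => [|m IH] j d dm.
  by move: dm; rewrite leqn0 => /eqP ->; rewrite !approx0.
apply: (@qform_eq (approx m.+1) (approx m)) => [k|k|k i id].
- exact: (approx0 m.+1).
- exact: approx0.
by apply: IH; rewrite -ltnS (leq_trans id).
Qed.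

Let approx_coef m j d z : (d <= m)%N -> approx m j d z = coef j d z.
Proof.
elim: m => [|m IH]; first by rewrite leqn0 => /eqP ->.
rewrite leq_eqVlt => /orP[/eqP -> //|]; rewrite ltnS => dm.
by rewrite approx_stable // IH.
Qed.

Let coefE j d z : coef j d z = qform P Q coef j d z.
Proof.
rewrite -(@approx_coef d.+1 j d z) //; apply: (@qform_eq (approx d) coef) => [k|k|k i id].
- exact: approx0.
- exact: approx0.
by rewrite approx_coef // ltnW.
Qed.

Lemma quadratic_coefficients A rho : 0 < A -> 0 < rho ->
  (forall j d, hform d (P j d) (A * rho ^+ d)) ->
  (forall j k d, hform d (Q j k d) (A * rho ^+ d)) ->
  exists c : J -> nat -> (I -> R) -> R, exists B sigma,
  [/\ 0 < B, 0 < sigma, (forall j d, hform d (c j d) (B * sigma ^+ d)),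
    (forall j z, c j 0%N z = 0) & (forall j d z, c j d z = qform P Q c j d z)].
Proof.
move=> A0 r0 hP hQ; pose n : R := #|J|%:R; pose S := \sum_j `|s j|.
have n0 : 0 <= n by rewrite ler0n.
have S0 : 0 <= S by rewrite sumr_ge0.
pose B := (24 * n * S + 24 * n + 1)^-1.
have D0 : 0 < 24 * n * S + 24 * n + 1 by have := mulr_ge0 n0 S0; lra.
have B0 : 0 < B by rewrite invr_gt0.
have BD : B * (24 * n * S + 24 * n + 1) = 1 by rewrite mulVf // gt_eqF.
have e0 : 0 < B / 3 by rewrite divr_gt0.
have [sg sg0 hsg] := geometric_invsq A0 r0 e0.
have small (H : nat -> (I -> R) -> R) d : (forall z, H 0%N z = 0) ->
    (forall d, hform d (H d) (A * rho ^+ d)) ->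
    hform d (H d) (B / 3 * (sg ^+ d * invsq d)).
  move=> H0 hH; case: d => [|d]; last by apply: hform_le (hH _); apply: hsg.
  by apply: (eq_hform (H := fun=> 0)) => //; rewrite invsq0 !mulr0; apply: hform0.
have hB d j : hform d (coef j d) (B * (sg ^+ d * invsq d)).
  elim/ltn_ind: d j => d IH j.
  have conv a b (f g : nat -> (I -> R) -> R) : 0 <= a -> 0 <= b ->
      (forall z, f 0%N z = 0) ->
      (forall i : 'I_d.+1, (0 < i)%N -> hform i (f i) (a * (sg ^+ i * invsq i))) ->
      (forall i : 'I_d.+1, (0 < i)%N -> (forall z, f i z * g (d - i)%N z = 0) \/
         hform (d - i) (g (d - i)%N) (b * (sg ^+ (d - i) * invsq (d - i)))) ->
      hform d (cauchy f g d) (a * b * 8 * (sg ^+ d * invsq d)).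
    move=> a0 b0 f0 hf hg.
    pose T i := a * (sg ^+ i * invsq i) * (b * (sg ^+ (d - i) * invsq (d - i))).
    apply: (@hform_le _ _ _ _ (\sum_(i < d.+1) T i)).
      have -> : a * b * 8 * (sg ^+ d * invsq d) = a * b * sg ^+ d * (8 * invsq d) by ring.
      have ab0 : 0 <= a * b * sg ^+ d by rewrite !mulr_ge0 ?exprn_ge0 ?(ltW sg0).
      apply: le_trans (ler_wpM2l ab0 (@invsq_conv R d)).
      rewrite big_distrr; apply: ler_sum => i _ /=; rewrite /T.
      rewrite [X in X <= _](_ : _ =
          a * b * (sg ^+ i * sg ^+ (d - i)) * (invsq i * invsq (d - i))); last by ring.
      by rewrite -exprD subnKC // -ltnS.
    apply: hform_sum => i _; rewrite /T.
    have T0 : 0 <= a * (sg ^+ i * invsq i) * (b * (sg ^+ (d - i) * invsq (d - i))).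
      by rewrite !mulr_ge0 ?exprn_ge0 ?invsq_ge0 // ltW.
    have [i0|i0] := posnP i.
      by apply: (eq_hform (H := fun=> 0)) (hform0 _ T0) => z; rewrite i0 f0 mul0r.
    case: (hg i i0) => [fg0|hgi].
      by apply: (eq_hform (H := fun=> 0)) (hform0 _ T0) => z; rewrite fg0.
    by have := hformM (hf i i0) hgi; rewrite subnKC // -ltnS.
  have e30 : 0 <= B / 3 by rewrite ltW.
  have part1 k : hform d (cauchy (Q j k) (coef k) d) (B / 3 * B * 8 * (sg ^+ d * invsq d)).
    apply: conv => // [|i i0|i i0]; first exact: ltW.
      exact: small.
    right; apply: IH; rewrite ltn_subrL i0 (leq_trans i0) // -ltnS //.
  have part2 k : hform d (cauchy (coef k) (coef k) d) (B * B * 8 * (sg ^+ d * invsq d)).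
    have [d0|d0] := posnP d.
      rewrite d0 invsq0 !mulr0; apply: (eq_hform (H := fun=> 0)) (hform0 _ _) => // z.
      by rewrite /cauchy big_ord1 coef0 mul0r.
    have cc (i : 'I_d.+1) : (0 < i)%N ->
       hform (d - i) (coef k (d - i)%N) (B * (sg ^+ (d - i) * invsq (d - i))).
      by move=> i0; apply: IH; rewrite ltn_subrL i0 d0.
    (* The top coefficient only occurs multiplied by the vanishing constant term; truncating it lets
       the induction hypothesis, available below degree d, bound the whole Cauchy product. *)
    pose f i z := if (i < d)%N then coef k i z else 0.
    apply: (eq_hform (H := cauchy f (coef k) d)) => [z|].
      apply: eq_bigr => i _; rewrite /f; case: ltnP => // di.
      have di0 : (d - i = 0)%N by apply/eqP; rewrite subn_eq0.
      by rewrite di0 coef0 !mulr0.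
    have B0' := ltW B0; apply: conv => // [z|i i0|i i0].
    - by rewrite /f d0 coef0.
    - have [id|di] := ltnP i d.
        by apply: eq_hform (IH _ id k) => z; rewrite /f id.
      apply: (eq_hform (H := fun=> 0)) => [z|]; first by rewrite /f ltnNge di.
      by apply: hform0; rewrite !mulr_ge0 ?exprn_ge0 ?invsq_ge0 // ltW.
    - by right; apply: cc.
  apply: (eq_hform (H := qform P Q coef j d)) => [z|]; first by rewrite -coefE.
  have w0 : 0 <= sg ^+ d * invsq d by rewrite mulr_ge0 ?exprn_ge0 ?invsq_ge0 // ltW.
  have hsum (f : J -> (I -> R) -> R) a : (forall k, hform d (f k) a) ->
      hform d (fun z => \sum_k f k z) (n * a).
    move=> hf; have -> : n * a = \sum_(k : J) a by rewrite sumr_const mulr_natl.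
    by apply: hform_sum => k _; apply: hf.
  have hs := hformD (hformD (small (P j) d (P0 j) (hP j)) (hsum _ _ part1))
     (hformZ (s j) (hsum _ _ part2)).
  apply: hform_le hs.
  have sS : `|s j| <= S by rewrite /S (bigD1 j) //= lerDl sumr_ge0.
  by apply: (@majorant_step _ B n S) => //; rewrite ltW.
exists coef, B, sg; split=> // j d.
  apply: hform_le (hB d j); rewrite ler_wpM2l ?(ltW B0) // ler_piMr ?invsq_le1 //.
  by rewrite exprn_ge0 // ltW.
Qed.

End Coefficients.

Lemma quadratic_solution : exists c : J -> (I -> R) -> R,
  [/\ (forall j, ana (c j) x), (forall j, c j x = 0) &
    near_box x (fun y => forall j,
      c j y = p j y + \sum_k q j k y * c k y + s j * \sum_k c k y * c k y)].
Proof.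
have [P hP] := choice p_ana.
have [Q hQ] : exists Q : J -> J -> nat -> (I -> R) -> R, forall j k, exps (q j k) x (Q j k).
  have [Q hQ] := choice (fun jk : J * J => q_ana jk.1 jk.2).
  by exists (fun j k => Q (j, k)) => j k; apply: hQ (j, k).
have P0 j z : P j 0%N z = 0 by rewrite (hform_at_center z (hP j)).
have Q0 j k z : Q j k 0%N z = 0 by rewrite (hform_at_center z (hQ j k)).
have [A [r hA]] : exists A r, [/\ 0 < A, 0 < r, (forall j d, hform d (P j d) (A * r ^+ d)) &
    (forall j k d, hform d (Q j k d) (A * r ^+ d))].
  have [A [r h]] := exps_family hP.
  have [A' [r' h']] := exps_family (fun jk : J * J => hQ jk.1 jk.2).
  pose A1 := Num.max 1 (Num.max A A'); pose r1 := Num.max 1 (Num.max r r').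
  have lA : A <= A1 by rewrite ?/A1 ?/r1 !le_max lexx ?orTb orbT.
  have lr : r <= r1 by rewrite ?/A1 ?/r1 !le_max lexx ?orTb orbT.
  have lA' : A' <= A1 by rewrite ?/A1 ?/r1 !le_max lexx !orbT.
  have lr' : r' <= r1 by rewrite ?/A1 ?/r1 !le_max lexx !orbT.
  exists A1, r1; split=> [||j d|j k d]; rewrite ?lt_max ?ltr01 //.
    by have [_ _ hd _] := expsb_le lA lr (h j); apply: hd.
  by have [_ _ hd _] := expsb_le lA' lr' (h' (j, k)); apply: hd.
case: hA => A0 r0 bP bQ.
have [c [B [sg [B0 sg0 hc c0 ec]]]] := quadratic_coefficients P0 Q0 A0 r0 bP bQ.
pose C j y := limn (series (fun d => c j d (fun i => y i - x i))).
have hC j : exps (C j) x (c j) by apply: exps_of_hform B0 sg0 (hc j).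
exists C; split=> [j|j|]; first by exists (c j).
  by rewrite -(hform_at_center (fun=> 0) (hC j)).
apply: near_box_all => j.
have h1 := exps_sum (fun k => expsM (hQ j k) (hC k)).
have h2 := exps_sum (fun k => expsM (hC k) (hC k)).
have h3 := expsM (exps_const (s j) x) h2.
have h4 := expsD (expsD (hP j) h1) h3.
have h5 := expsM (exps_const (-1) x) h4.
have h6 := expsD (hC j) h5.
(* By the recursion for the coefficients the difference of the two sides has expansion zero, so
   [exps_zero] applies. *)
have zero : exps (fun y => C j y + -1 * (p j y + \sum_k q j k y * C k y +
    s j * \sum_k C k y * C k y)) x (fun _ _ => 0).
  move: h6; congr exps; apply/funext => d; apply/funext => z.
  have cst (a : R) (H : nat -> (I -> R) -> R) :
     cauchy (fun d _ => if d == 0%N then a else 0) H d z = a * H d z.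
    rewrite /cauchy big_ord_recl /= subn0 big1 ?addr0 // => i _; by rewrite mul0r.
  by rewrite !cst ec /qform mulN1r subrr.
apply: near_boxW (exps_zero zero) => y /eqP.
by rewrite mulN1r subr_eq0 => /eqP.
Qed.

End QuadraticSolution.

(** * Expansions and analyticity in terms of multi-indices *)

Section AnalyticAt.
Context {R : realType} {I : finType}.

Lemma ana_analytic_at (g : (I -> R) -> R) x : ana g x -> analytic_at g x.
Proof.
move=> [H [A [rho [A0 r0 Hd Hr]]]].
have ex d : exists ga : seq I -> R,
    (forall z, H d z = wsum d (fun w => ga w * wmon z w)) /\
    wsum d (fun w => `|ga w|) <= A * rho ^+ d.
  by case: (Hd d) => ga ? ?; exists ga.
have [ga hga] := choice ex.
(* A monomial collects all words with its letter counts; [key] holds because every word of length d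
   is counted for exactly one multi-index of degree d. *)
pose c (al : I -> nat) := wsum (\sum_i al i)%N
  (fun w => if [forall i, count_mem i w == al i] then ga (\sum_i al i)%N w else 0).
have key d (f : seq I -> R) (z : I -> R) :
    \sum_(a : {ffun I -> 'I_d.+1} | (\sum_i (a i : nat) == d)%N)
       wsum d (fun w => if [forall i, count_mem i w == a i] then f w else 0) *
         \prod_i z i ^+ (a i : nat) =
    wsum d (fun w => f w * wmon z w).
  under eq_bigr do rewrite mulrC -wsumZ.
  rewrite -wsum_sum; apply: eq_wsum => w sw.
  have cw i : (count_mem i w < d.+1)%N by rewrite ltnS -sw count_size.
  pose a0 := [ffun i => Ordinal (cw i)].
  have sa0 : (\sum_i (a0 i : nat) == d)%N.
    under eq_bigr do rewrite ffunE /=.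
    rewrite -sw; apply/eqP; elim: (w) => [|b v IH]; first by rewrite big1.
    by rewrite /= big_split /= IH (bigD1 b) //= eqxx big1 // => i /negbTE; rewrite eq_sym => ->.
  rewrite (bigD1 a0) //= [X in _ + X]big1 ?addr0 => [|a /andP[_ ne]].
    rewrite ifT; last by apply/forallP => i; rewrite ffunE.
    rewrite mulrC; congr (_ * _); under eq_bigr do rewrite ffunE /=.
    elim: (w) => [|b v IH]; first by rewrite /wmon big_nil big1.
    rewrite /wmon big_cons -/(wmon z v) -IH (bigD1 b) //= eqxx exprS -mulrA; congr (_ * _).
    rewrite [in RHS](bigD1 b) //=; congr (_ * _); apply: eq_bigr => i /negbTE.
    by rewrite eq_sym => ->.
  rewrite ifF ?mulr0 //; apply: contraNF ne => /forallP e; apply/eqP/ffunP => i.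
  by apply/val_inj; rewrite ffunE /= (eqP (e i)).
exists (2 * rho)^-1; first by rewrite invr_gt0 mulr_gt0.
exists c => y yx; pose z i := y i - x i; pose t := (2 * rho)^-1.
have t0 : 0 <= t by rewrite invr_ge0 mulr_ge0 // ltW.
have rt : rho * t = 2^-1 by rewrite /t invfM mulrCA divff ?mulr1 // gt_eqF.
have zt i : `|z i| <= t by exact: ltW (yx i).
have hom d : hom_part c x y d = H d z.
  rewrite (proj1 (hga d)) -key; apply: eq_bigr => a /eqP sa.
  by rewrite /c sa.
have homabs d : hom_part_abs c x y d <= A * 2^-1 ^+ d.
  apply: (@le_trans _ _ (wsum d (fun w => `|ga d w| * wmon (fun i => `|z i|) w))).
    rewrite -key; apply: ler_sum => a /eqP sa; rewrite ler_wpM2r ?prodr_ge0 //.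
    rewrite /c sa; apply: le_trans (ler_norm_wsum _ _) _.
    by apply: ler_wsum => w _; case: ifP => // _; rewrite normr0.
  rewrite -rt exprMn mulrA; apply: le_trans (ler_wpM2r (exprn_ge0 d t0) (proj2 (hga d))).
  rewrite mulrC -wsumZ; apply: ler_wsum => w sw; rewrite mulrC ler_wpM2r // -sw.
  apply: le_trans (ler_norm _) (wmon_le _ _) => i; by rewrite normr_id.
split.
  apply: (@series_le_cvg _ _ (geometric A 2^-1)) => // [d|d|].
  - by apply: sumr_ge0 => a _; rewrite mulr_ge0 ?prodr_ge0 // => i _; rewrite exprn_ge0.
  - by rewrite /geometric /= mulr_ge0 ?exprn_ge0 ?ltW.
  by apply: is_cvg_geometric_series; rewrite ger0_norm //; lra.
have bnd N : `|g y - series (hom_part c x y) N| <= A * 2^-1 ^+ N.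
  rewrite /series /= big_mkord; under eq_bigr do rewrite hom.
  have {1}-> : y = shift x z by apply/funext => i; rewrite /shift /z subrKC.
  by rewrite -rt; apply: Hr => //; rewrite mulrC rt.
have /cvgr0_norm_le geo : geometric A 2^-1 @ \oo --> 0.
  by apply: cvg_geometric; rewrite ger0_norm //; lra.
apply/cvgrPdist_le => e e0; near=> N.
apply: le_trans (bnd N) _; apply: le_trans (ler_norm _) _.
by near: N; apply: geo.
Unshelve. all: by end_near.
Qed.

End AnalyticAt.

Section AnaAlgebra.
Context {R : realType} {I : finType}.
Implicit Types (g h : (I -> R) -> R) (x : I -> R).

Lemma ana_const c x : ana (fun=> c) x.
Proof. by eexists; apply: exps_const. Qed.

Lemma ana_coord i x : ana (fun y => y i) x.
Proof. by eexists; apply: exps_coord. Qed.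

Lemma anaD g h x : ana g x -> ana h x -> ana (fun y => g y + h y) x.
Proof. by move=> [H e] [H' e']; eexists; apply: expsD e e'. Qed.

Lemma anaM g h x : ana g x -> ana h x -> ana (fun y => g y * h y) x.
Proof. by move=> [H e] [H' e']; eexists; apply: expsM e e'. Qed.

Lemma anaB g h x : ana g x -> ana h x -> ana (fun y => g y - h y) x.
Proof.
move=> ag ah; have := anaD ag (anaM (ana_const (-1) x) ah); congr ana.
by apply/funext => y; rewrite mulN1r.
Qed.

Lemma ana_sum (J : finType) (g : J -> (I -> R) -> R) x :
  (forall j, ana (g j) x) -> ana (fun y => \sum_j g j y) x.
Proof. by move=> /choice[H e]; eexists; apply: exps_sum e. Qed.

Lemma ana_eq_near g h x : near_box x (fun y => g y = h y) -> ana g x -> ana h x.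
Proof. by move=> e [H eg]; exists H; apply: exps_eq_near eg. Qed.

End AnaAlgebra.

(** * Trilateration *)

Section Trilateration.
Context {R : realType} {n : nat}.
Implicit Types (v w : 'I_n -> R) (M N : 'I_n -> 'I_n -> R).

Definition d2 (x y : 'I_n -> R) : R := \sum_i (x i - y i) ^+ 2.

Lemma d2_ge0 x y : 0 <= d2 x y.
Proof. by apply: sumr_ge0 => i _; apply: sqr_ge0. Qed.

Lemma d2C x y : d2 x y = d2 y x.
Proof. by apply: eq_bigr => i _; rewrite -sqrrN opprB. Qed.

Lemma d2_eq0 x y : d2 x y = 0 -> x = y.
Proof.
move=> /eqP; rewrite psumr_eq0 => [/allP h|i _]; last exact: sqr_ge0.
apply/funext => i; have := h i (mem_index_enum i).
by rewrite /= sqrf_eq0 subr_eq0 => /eqP.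
Qed.

Lemma d2xx x : d2 x x = 0.
Proof. by rewrite /d2 big1 // => i _; rewrite subrr expr0n. Qed.

Definition nondeg M := forall w, (forall i, \sum_k M i k * w k = 0) -> forall k, w k = 0.

Lemma nondeg_inv M : nondeg M -> exists N,
  (forall i j, \sum_k N i k * M k j = (i == j)%:R) /\
  (forall i j, \sum_k M i k * N k j = (i == j)%:R).
Proof.
move=> nM; pose A := \matrix_(i, j) M i j.
have uA : A \in unitmx.
  rewrite -unitmx_tr -row_free_unit -kermx_eq0; apply/eqP/row_matrixP => i.
  rewrite row0; set r := row i _.
  have rA : r *m A^T = 0 by apply/sub_kermxP; rewrite row_sub.
  apply/rowP => k; rewrite [RHS]mxE; apply: (nM (fun k => r 0 k)) => j.
  have := congr1 (fun B : matrix R 1 n => B 0 j) rA; rewrite [RHS]mxE mxE => e0; rewrite -[RHS]e0.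
  by apply: eq_bigr => l _; rewrite !mxE mulrC.
exists (fun i j => invmx A i j); split=> i j.
  have := congr1 (fun B : matrix R n n => B i j) (mulVmx uA); rewrite !mxE => <-.
  by apply: eq_bigr => k _; rewrite mxE.
have := congr1 (fun B : matrix R n n => B i j) (mulmxV uA); rewrite !mxE => <-.
by apply: eq_bigr => k _; rewrite mxE.
Qed.

Lemma sum_delta (f : 'I_n -> R) i : \sum_k (i == k)%:R * f k = f i.
Proof.
rewrite (bigD1 i) //= eqxx mul1r big1 ?addr0 // => k /negbTE.
by rewrite eq_sym => ->; rewrite mul0r.
Qed.

Lemma nondeg_open M : nondeg M -> exists2 r, 0 < r &
  forall M', (forall i k, `|M' i k - M i k| < r) -> nondeg M'.
Proof.
move=> /nondeg_inv[N [NM _]]; pose b := \sum_i \sum_k `|N i k|.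
have b0 : 0 <= b by apply: sumr_ge0 => i _; apply: sumr_ge0.
have b1 : 0 < b + 1 by rewrite ltr_wpDl.
exists (b + 1)^-1; first by rewrite invr_gt0.
move=> M' MM' w Mw; pose s := \sum_k `|w k|.
have s0 : 0 <= s by apply: sumr_ge0.
have wE i : w i = \sum_k N i k * \sum_j (M k j - M' k j) * w j.
  rewrite -[LHS]sum_delta; under eq_bigr do rewrite -NM mulr_suml.
  rewrite exchange_big /=; apply: eq_bigr => k _.
  under [in RHS]eq_bigr do rewrite mulrBl.
  rewrite sumrB Mw subr0 big_distrr /=; apply: eq_bigr => j _; by rewrite mulrA.
have wle i : `|w i| <= (\sum_k `|N i k|) * ((b + 1)^-1 * s).
  rewrite {1}wE; apply: (le_trans (ler_norm_sum _ _ _)).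
  rewrite mulr_suml; apply: ler_sum => k _; rewrite normrM ler_wpM2l //.
  apply: (le_trans (ler_norm_sum _ _ _)); rewrite mulr_sumr; apply: ler_sum => j _.
  by rewrite normrM ler_wpM2r // distrC ltW.
(* The l1 norm s of a kernel vector of [M'] is at most b/(b + 1) times itself, hence zero. *)
have : s <= b * ((b + 1)^-1 * s).
  by rewrite {1}/s mulr_suml; apply: ler_sum => i _; apply: wle.
have -> : b * ((b + 1)^-1 * s) = s - (b + 1)^-1 * s by field; rewrite gt_eqF.
rewrite lerBrDr gerDl pmulr_rle0 ?invr_gt0 // => sle0 k; apply/eqP.
rewrite -normr_le0; apply: le_trans sle0.
by rewrite /s (bigD1 k) //= lerDl sumr_ge0.
Qed.

(** Subtracting the two distance equations shows that v - w is orthogonal to every vector from u_i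
    to the midpoint of v and w; hence nondegeneracy is asked at the midpoint. *)
Lemma trilateration_unique v w (u : 'I_n -> 'I_n -> R) :
  nondeg (fun i k => (v k + w k) / 2 - u i k) ->
  (forall i, d2 v (u i) = d2 w (u i)) -> v = w.
Proof.
move=> nd e; apply/funext => k; apply/eqP; rewrite -subr_eq0; apply/eqP.
apply: (nd (fun k => v k - w k)) => i; have /eqP := e i.
rewrite -subr_eq0 -sumrB => /eqP h.
have : 2^-1 * \sum_i0 ((v i0 - u i i0) ^+ 2 - (w i0 - u i i0) ^+ 2) = 0 by rewrite h mulr0.
rewrite mulr_sumr => h0; rewrite -[RHS]h0; apply: eq_bigr => j _; by field.
Qed.

Lemma trilateration_local (I : finType) (x1 : I -> R) (u : 'I_n -> (I -> R) -> 'I_n -> R) v1 :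
  (forall i k, ana (fun y => u i y k) x1) ->
  nondeg (fun i k => v1 k - u i x1 k) ->
  exists v : (I -> R) -> 'I_n -> R,
  [/\ (forall k, ana (fun y => v y k) x1), v x1 = v1 &
    near_box x1 (fun y => forall i, d2 (v y) (u i y) = d2 v1 (u i x1))].
Proof.
move=> au /nondeg_inv[N [_ MN]].
pose mu i k y := u i y k - u i x1 k; pose d i k := v1 k - u i x1 k.
have amu i k : ana (mu i k) x1 by apply: anaB => //; apply: ana_const.
have mu0 i k : mu i k x1 = 0 by rewrite /mu subrr.
(* With v = v1 + c and u_i moved by mu_i, equality of distances reads d_i . c = d_i . mu_i -
   |mu_i|^2 / 2 + mu_i . c - |c|^2 / 2. Applying the inverse [N] of the matrix [d] gives the
   fixed-point form with these p, q and s. *)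
pose p j y := \sum_i N j i * (\sum_k (d i k * mu i k y - 2^-1 * (mu i k y * mu i k y))).
pose q j k y := \sum_i N j i * mu i k y.
pose s j := - 2^-1 * \sum_i N j i.
have ap j : ana (p j) x1.
  apply: ana_sum => i; apply: anaM; first exact: ana_const.
  apply: ana_sum => k; apply: anaB; apply: anaM => //; try exact: ana_const.
  exact: anaM.
have aq j k : ana (q j k) x1.
  by apply: ana_sum => i; apply: anaM => //; apply: ana_const.
have p0 j : p j x1 = 0.
  rewrite /p big1 // => i _; rewrite big1 ?mulr0 // => k _.
  by rewrite mu0 !mulr0 subr0.
have q0 j k : q j k x1 = 0 by rewrite /q big1 // => i _; rewrite mu0 mulr0.
have [c [ac c0 ec]] := quadratic_solution s ap aq p0 q0.
exists (fun y k => v1 k + c k y); split.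
- by move=> k; apply: anaD => //; apply: ana_const.
- by apply/funext => k; rewrite c0 addr0.
apply: near_boxW ec => y ec i.
pose T i := \sum_k (d i k * mu i k y - 2^-1 * (mu i k y * mu i k y) + mu i k y * c k y
   - 2^-1 * (c k y * c k y)).
have cT j : c j y = \sum_i N j i * T i.
  rewrite ec /p /q /s; under [X in _ + X + _]eq_bigr do rewrite mulr_suml.
  rewrite exchange_big /= -mulrA [X in - _ * X]mulr_suml mulr_sumr -!big_split /=.
  apply: eq_bigr => l _.
  have -> : T l = \sum_k (d l k * mu l k y - 2^-1 * (mu l k y * mu l k y)) +
      \sum_k mu l k y * c k y - 2^-1 * \sum_k c k y * c k y.
    by rewrite mulr_sumr -big_split -sumrB.
  have -> : \sum_k N j l * mu l k y * c k y = N j l * \sum_k mu l k y * c k y.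
    by rewrite mulr_sumr; apply: eq_bigr => k _; rewrite mulrA.
  by ring.
have dc : \sum_j d i j * c j y = T i.
  under eq_bigr do rewrite cT mulr_sumr.
  rewrite exchange_big /= -[RHS](sum_delta T); apply: eq_bigr => l _.
  by rewrite -MN mulr_suml; apply: eq_bigr => k _; rewrite mulrA.
apply/eqP; rewrite -subr_eq0 -sumrB; apply/eqP.
move/eqP: dc; rewrite -subr_eq0 /T -sumrB => /eqP h.
transitivity (2 * \sum_j (d i j * c j y - (d i j * mu i j y - 2^-1 * (mu i j y * mu i j y) +
   mu i j y * c j y - 2^-1 * (c j y * c j y)))); last by rewrite h mulr0.
rewrite mulr_sumr; apply: eq_bigr => k _; rewrite /d /mu; by field.
Qed.

(* The points and the solution are given up to the similarity z |-> c + P z. *)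
Lemma trilateration_exists (u0 : 'I_n -> 'I_n -> R) v0 e :
  nondeg (fun i k => v0 k - u0 i k) -> 0 < e ->
  exists2 del, 0 < del & forall (c : 'I_n -> R) P (u : 'I_n -> 'I_n -> R), 0 < P ->
    (forall i k, `|u i k - (c k + P * u0 i k)| < P * del) ->
    exists2 v, (forall k, `|v k - (c k + P * v0 k)| < P * e) &
      forall i, d2 v (u i) = P ^+ 2 * d2 v0 (u0 i).
Proof.
move=> nd e0; pose x1 (ik : 'I_n * 'I_n) := u0 ik.1 ik.2.
pose U i (y : 'I_n * 'I_n -> R) k := y (i, k).
have aU i k : ana (fun y => U i y k) x1 by apply: ana_coord.
have [v [av v1 ev]] := trilateration_local aU (v1 := v0) nd.
have cv : near_box x1 (fun y => forall k, `|v y k - v0 k| < e).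
  by apply: near_box_all => k; rewrite -v1; apply: ana_cont.
have [r r0 hr] := near_boxI ev cv; exists r => // c P u P0 cu.
pose y (ik : 'I_n * 'I_n) := (u ik.1 ik.2 - c ik.2) / P.
have [|ey cy] := hr y.
  move=> ik; rewrite -(ltr_pM2l P0) -{1}(gtr0_norm P0) -normrM; apply: le_lt_trans (cu ik.1 ik.2).
  by rewrite /y /x1 mulrBr mulrC divfK ?gt_eqF // opprD addrA.
exists (fun k => c k + P * v y k) => [k|i].
  by rewrite opprD addrACA subrr add0r -mulrBr normrM gtr0_norm // ltr_pM2l.
rewrite -(ey i) /d2 mulr_sumr; apply: eq_bigr => k _.
by rewrite /U /y -exprMn; congr (_ ^+ 2); field; rewrite gt_eqF.
Qed.

(** Nondegeneracy is unaffected by similarities, so one relative tolerance r serves every place c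
    and scale P. *)
Lemma nondeg_near (u0 : 'I_n -> 'I_n -> R) v0 :
  nondeg (fun i k => v0 k - u0 i k) ->
  exists2 r, 0 < r & forall (c : 'I_n -> R) P (u : 'I_n -> 'I_n -> R) v w, 0 < P ->
    (forall i k, `|u i k - (c k + P * u0 i k)| < P * r) ->
    (forall k, `|v k - (c k + P * v0 k)| < P * r) ->
    (forall k, `|w k - (c k + P * v0 k)| < P * r) ->
    nondeg (fun i k => (v k + w k) / 2 - u i k).
Proof.
move=> /nondeg_open[r r0 h]; exists (r / 2); first by rewrite divr_gt0.
move=> c P u v w P0 hu hv hw z hz; apply: (h (fun i k => P^-1 * ((v k + w k) / 2 - u i k))).
  move=> i k; rewrite -(ltr_pM2l P0) -{1}(gtr0_norm P0) -normrM.
  have -> : P * (P^-1 * ((v k + w k) / 2 - u i k) - (v0 k - u0 i k)) =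
     ((v k - (c k + P * v0 k)) + (w k - (c k + P * v0 k))) / 2 - (u i k - (c k + P * u0 i k)).
    by field; rewrite gt_eqF.
  move: (hu i k) (hv k) (hw k); rewrite !ltr_norml => /andP[? ?] /andP[? ?] /andP[? ?].
  by apply/andP; split; lra.
by move=> i; under eq_bigr do rewrite -mulrA; rewrite -mulr_sumr hz mulr0.
Qed.

End Trilateration.

(** * Systems of vertices added step by step *)

Section Systems.
Context {R : realType} {n : nat}.
Notation vec := ('I_n -> R).

(* The i-th step of a system describes vertex i and its edges to earlier vertices.
   [Cable p x l] is a vertex fixed at p with a flexible edge of length l to vertex x. *)
Inductive step :=
| Free
| Fixed of vec
| Cable of vec & nat & R
| Bars of seq (nat * R).

Definition sat (phi : nat -> vec) (i : nat) (s : step) : Prop :=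
  match s with
  | Free => True
  | Fixed p => phi i = p
  | Cable p x l => phi i = p /\ d2 p (phi x) <= l ^+ 2
  | Bars nb => forall y, y \in nb -> d2 (phi i) (phi y.1) = y.2 ^+ 2
  end.

Definition cfg (S : seq step) (phi : nat -> vec) :=
  forall i, (i < size S)%N -> sat phi i (nth Free S i).

Definition wf_step (i : nat) (s : step) : Prop :=
  match s with
  | Cable _ x l => (x < i)%N /\ 0 < l
  | Bars nb => uniq (map fst nb) /\ forall y, y \in nb -> (y.1 < i)%N /\ 0 < y.2
  | _ => True
  end.

Definition wf (S : seq step) := forall i, (i < size S)%N -> wf_step i (nth Free S i).

Lemma sat_eq phi psi i s : wf_step i s -> (forall j, (j <= i)%N -> phi j = psi j) ->
  sat phi i s -> sat psi i s.
Proof.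
move=> ws e; case: s ws => [|p|p x l [xi _]|nb [_ hnb]] //=; first by rewrite e.
  by rewrite !e // ltnW.
by move=> h y ynb; have [yi _] := hnb y ynb; rewrite -!e ?h // ltnW.
Qed.

Lemma cfg_cat S T phi : cfg (S ++ T) phi <->
  cfg S phi /\ forall j, (j < size T)%N -> sat phi (size S + j) (nth Free T j).
Proof.
split=> [h|[hS hT] i].
  split=> [i iS|j jT].
    by have := h i; rewrite size_cat nth_cat iS; apply; rewrite ltn_addr.
  have := h (size S + j)%N; rewrite size_cat nth_cat [(_ < size S)%N]ltnNge leq_addr /= addKn.
  by apply; rewrite ltn_add2l.
rewrite size_cat nth_cat => iST; case: ltnP => [iS|Si]; first exact: hS.
have {1}-> : i = (size S + (i - size S))%N by rewrite subnKC.
by apply: hT; rewrite ltn_subLR.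
Qed.

Lemma wf_cat S T : wf (S ++ T) <->
  wf S /\ forall j, (j < size T)%N -> wf_step (size S + j) (nth Free T j).
Proof.
split=> [h|[hS hT] i].
  split=> [i iS|j jT].
    by have := h i; rewrite size_cat nth_cat iS; apply; rewrite ltn_addr.
  have := h (size S + j)%N; rewrite size_cat nth_cat [(_ < size S)%N]ltnNge leq_addr /= addKn.
  by apply; rewrite ltn_add2l.
rewrite size_cat nth_cat => iST; case: ltnP => [iS|Si]; first exact: hS.
have {1}-> : i = (size S + (i - size S))%N by rewrite subnKC.
by apply: hT; rewrite ltn_subLR.
Qed.

Lemma cfg_eq S phi psi : wf S -> (forall i, (i < size S)%N -> phi i = psi i) ->
  cfg S phi -> cfg S psi.
Proof.
move=> wS e h i iS; apply: sat_eq (h i iS); first exact: wS.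
by move=> j ji; apply: e; apply: leq_ltn_trans iS.
Qed.

Lemma nondeg_rows_inj (M : 'I_n -> 'I_n -> R) i j :
  nondeg M -> (forall k, M i k = M j k) -> i = j.
Proof.
move=> /nondeg_inv[N [_ MN]] e; apply/eqP/negP => /negP ij.
have := MN i i; under eq_bigr do rewrite e.
by rewrite MN eq_sym (negbTE ij) eqxx => /eqP; rewrite eq_sym oner_eq0.
Qed.

Lemma d2_coord_le (x y : vec) r k : 0 <= r -> d2 x y <= r ^+ 2 -> `|x k - y k| <= r.
Proof.
move=> r0 h; rewrite -(ler_pXn2r (n := 2)) ?nnegrE // real_normK ?num_real //.
by apply: le_trans h; rewrite /d2 (bigD1 k) //= lerDl sumr_ge0 // => i _; apply: sqr_ge0.
Qed.

Lemma ana_near_lt (I : finType) (f : (I -> R) -> R) x a r :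
  ana f x -> `|f x - a| < r -> near_box x (fun y => `|f y - a| < r).
Proof.
move=> af; rewrite -subr_gt0 => h; apply: near_boxW (ana_cont af h) => y.
by rewrite ltrBrDr; apply: le_lt_trans; rewrite ler_distD.
Qed.

Variables (k : nat) (rho : R) (a0 : 'I_n).
Hypothesis rho_ge0 : 0 <= rho.
Notation ins := ('I_k * 'I_n -> R).

Definition inp (phi : nat -> vec) : ins := fun ji => phi ji.1 ji.2.
Definition inbox (x : ins) := forall ji, `|x ji| <= rho.
Definition ax (j : 'I_n) : vec := fun i => (i == j)%:R.
(* The end of a slack cable stays near this point, at distance 3 l / 4 from the anchor p;
   the margin lets an elbow replace the cable in the classical linkage. *)
Definition slack_center (p : vec) (l : R) : vec := fun i => p i - 3 / 4 * l * ax a0 i.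

(** The invariant of all constructions. The open set U contains the inputs of every configuration,
    so [g] gives an analytic inverse of the input map. Over the box every input is attained, the
    ends of cables stay well inside their range, which leaves room for elbows, and the coordinates
    are bounded, which decides the scale of later gadgets. *)
Definition solves S (U : ins -> Prop) (g : ins -> nat -> vec) M :=
  [/\ (forall x, U x -> near_box x U) /\
      (forall x, U x -> forall i, (i < size S)%N -> forall c, ana (fun y => g y i c) x),
      (forall phi, cfg S phi -> U (inp phi) /\
         forall i, (i < size S)%N -> phi i = g (inp phi) i),
      (forall x, inbox x -> cfg S (g x) /\ inp (g x) = x),
      (forall i p y l, (i < size S)%N -> nth Free S i = Cable p y l ->
         forall x, inbox x -> d2 (g x y) (slack_center p l) <= (l / 32) ^+ 2) &
      (forall x, inbox x -> forall i, (i < size S)%N -> forall c, `|g x i c| <= M)].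

Definition good S := [/\ (k <= size S)%N, wf S & exists U g M, solves S U g M].

Definition ext (S S' : seq step) := exists T, S' = S ++ T.

Lemma ext_refl S : ext S S.
Proof. by exists [::]; rewrite cats0. Qed.

Lemma ext_trans S1 S2 S3 : ext S1 S2 -> ext S2 S3 -> ext S1 S3.
Proof. by move=> [T ->] [T' ->]; exists (T ++ T'); rewrite catA. Qed.

Lemma ext_cfg S S' phi : ext S S' -> cfg S' phi -> cfg S phi.
Proof. by move=> [T ->] /cfg_cat[]. Qed.

Lemma ext_size S S' : ext S S' -> (size S <= size S')%N.
Proof. by move=> [T ->]; rewrite size_cat leq_addr. Qed.

Lemma good_config S x : good S -> inbox x -> exists2 phi, cfg S phi & inp phi = x.
Proof. by move=> [_ _ [U [g [M [_ _ h _ _]]]]] /h[? ?]; exists (g x). Qed.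

(** Supplies one configuration, from which incidence facts, such as distinctness of vertices, are
    read off statements about all configurations. *)
Lemma good_config0 S : good S -> exists2 phi, cfg S phi & inbox (inp phi).
Proof.
move=> gS; have b0 : inbox (fun=> 0) by move=> ji; rewrite normr0.
by have [phi c e] := good_config gS b0; exists phi; rewrite ?e.
Qed.

Lemma good_bounded S : good S -> exists M, forall phi, cfg S phi -> inbox (inp phi) ->
  forall i, (i < size S)%N -> forall c, `|phi i c| <= M.
Proof.
move=> [_ _ [U [g [M [_ h _ _ hM]]]]]; exists M => phi cphi Kphi i iS c.
by have [_ ->] := h _ cphi; [apply: hM|].
Qed.

Lemma good_free : good (nseq k Free).
Proof.
split; rewrite ?size_nseq //; first by move=> i; rewrite size_nseq nth_nseq => ->.
pose g (x : ins) (i : nat) : vec := fun c =>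
  if insub i is Some j then x (j : 'I_k, c) else 0.
exists (fun=> True), g, rho; have e x i (ik : (i < k)%N) c : g x i c = x (Ordinal ik, c).
  by rewrite /g insubT.
split=> [|phi _|x _|i p y l|x bx i] /=.
- split=> [x _|x _ i]; first by exists 1.
  rewrite size_nseq => ik c; have -> : (fun y => g y i c) = fun y => y (Ordinal ik, c).
    by apply/funext => y; rewrite e.
  exact: ana_coord.
- split=> // i; rewrite size_nseq => ik; apply/funext => c; rewrite e /inp /=.
  by [].
- split=> [i|]; first by rewrite size_nseq nth_nseq => ->.
  by apply/funext => -[j c]; rewrite /inp (e _ _ (ltn_ord j)) /=; congr (x (_, _)); apply/val_inj.
- by rewrite size_nseq nth_nseq => ->.
by rewrite size_nseq => ik c; rewrite e.
Qed.

(** The domain may shrink to [U'], since the new vertices need not have positions for all inputs in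
    U; over the box they must have them. *)
Lemma extend S T U g M U' (h : ins -> nat -> vec) M' :
  (k <= size S)%N -> wf (S ++ T) -> solves S U g M ->
  let g' x i := if (i < size S)%N then g x i else h x (i - size S)%N in
  (forall x, U' x -> U x) -> (forall x, U' x -> near_box x U') ->
  (forall x, U' x -> forall j, (j < size T)%N -> forall c, ana (fun y => h y j c) x) ->
  (forall phi, cfg (S ++ T) phi -> U' (inp phi) /\
     forall j, (j < size T)%N -> phi (size S + j)%N = h (inp phi) j) ->
  (forall x, inbox x -> forall j, (j < size T)%N -> sat (g' x) (size S + j)%N (nth Free T j)) ->
  (forall j p y l, (j < size T)%N -> nth Free T j = Cable p y l ->
     forall x, inbox x -> d2 (g' x y) (slack_center p l) <= (l / 32) ^+ 2) ->
  (forall x, inbox x -> forall j, (j < size T)%N -> forall c, `|h x j c| <= M') ->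
  solves (S ++ T) U' g' (Num.max M M').
Proof.
move=> kS /wf_cat[wS wT] [[oU aU] hU KU slU bU] g' UU' oU' ah hphi hK hsl hb.
have g'S x i : (i < size S)%N -> g' x i = g x i by move=> iS; rewrite /g' iS.
have g'T x j : g' x (size S + j)%N = h x j.
  by rewrite /g' ltnNge leq_addr /= addKn.
have idx i : (i < size (S ++ T))%N -> (i < size S)%N \/
    exists2 j, (j < size T)%N & i = (size S + j)%N.
  rewrite size_cat => iST; case: (ltnP i (size S)) => [|Si]; first by left.
  by right; exists (i - size S)%N; rewrite ?subnKC // ltn_subLR.
split.
- split=> // x Ux i /idx[iS|[j jT ->]] c.
    by under eq_fun do rewrite g'S //; apply: aU => //; apply: UU'.
  by under eq_fun do rewrite g'T; apply: ah.
- move=> phi cphi; have [U'phi ephi] := hphi _ cphi; split=> // i /idx[iS|[j jT ->]].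
    by rewrite g'S //; case/cfg_cat: cphi => /hU[_ +] _; apply.
  by rewrite g'T; apply: ephi.
- move=> x Kx; have [cx ix] := KU x Kx; split.
    apply/cfg_cat; split; last exact: hK.
    by apply: (cfg_eq wS) cx => i iS; rewrite g'S.
  rewrite -{2}ix; apply/funext => -[j c]; rewrite /inp g'S //=.
  exact: leq_trans kS.
- move=> i p y l /idx[iS|[j jT ->]].
    rewrite nth_cat iS => e x Kx; rewrite g'S; first exact: slU e x Kx.
    by have := wS i iS; rewrite e => -[yi _]; apply: ltn_trans iS.
  by rewrite nth_cat ltnNge leq_addr /= addKn => e; apply: hsl e.
move=> x Kx i /idx[iS|[j jT ->]] c.
  by rewrite g'S // le_max bU.
by rewrite g'T le_max hb ?orbT.
Qed.

End Systems.

(** * Adding fixed points, cables, collinear and trilaterated vertices *)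

Section AddSteps.
Context {R : realType} {n : nat}.
Notation vec := ('I_n -> R).
Variables (k : nat) (rho : R) (a0 : 'I_n).
Hypothesis rho_ge0 : 0 <= rho.
Notation ins := ('I_k * 'I_n -> R).
Notation good := (good k rho a0).
Notation inp := (@inp R n k).
Notation inK phi := (inbox rho (inp phi)).
Implicit Types (S : seq (@step R n)) (phi : nat -> vec).

Lemma add_fixed S (p : vec) : good S ->
  exists S', [/\ good S', ext S S', (size S < size S')%N &
    forall phi, cfg S' phi -> phi (size S) = p].
Proof.
move=> [kS wS [U [g [M sol]]]]; exists (S ++ [:: Fixed p]); split.
- split; first by rewrite size_cat (leq_trans kS) ?leq_addr.
    by apply/wf_cat; split=> // -[|].
  do 3 eexists; apply: (extend (U' := U) (h := fun _ _ => p) (M' := \sum_c `|p c|)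
      kS _ sol); case: sol => [[oU aU] hU KU slU bU] //.
  + by apply/wf_cat; split=> // -[|].
  + by move=> x _ j _ c; apply: ana_const.
  + move=> phi /cfg_cat[/hU[? _] h]; split=> // -[|] // _; exact: h 0%N _.
  + by move=> x _ [|] //= _; rewrite addn0 ltnn.
  + by case.
  by move=> x _ j _ c; rewrite (bigD1 c) //= lerDl sumr_ge0.
- by exists [:: Fixed p].
- by rewrite size_cat addn1.
by move=> phi /cfg_cat[_ /(_ 0%N isT)]; rewrite /= addn0.
Qed.

(** The anchor is placed off b because an elbow with arms eta and 3 eta reaches, in its plane, the
    distances from 2 eta to 4 eta: b lies at the middle distance 3 eta, where the elbow is far from
    being straight or folded. *)
Definition cable_anchor (b : vec) (eta : R) : vec := fun c => b c + 3 * eta * ax a0 c.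

Lemma slack_anchor b eta : slack_center a0 (cable_anchor b eta) (4 * eta) = b.
Proof. by apply/funext => c; rewrite /slack_center /cable_anchor; field. Qed.

Lemma anchor_near b eta v c : 0 < eta ->
  d2 (cable_anchor b eta) v <= (4 * eta) ^+ 2 -> `|v c - b c| <= 7 * eta.
Proof.
move=> eta0 /(d2_coord_le c) => /(_ (mulr_ge0 (ler0n _ _) (ltW eta0))).
rewrite /cable_anchor /ax !ler_norml => /andP[h1 h2].
by apply/andP; split; case: (c == a0) h1 h2 => /= h1 h2; lra.
Qed.

Lemma anchor_reach b eta v : 0 < eta -> d2 v b <= (eta / 8) ^+ 2 ->
  d2 (cable_anchor b eta) v <= (4 * eta) ^+ 2.
Proof.
move=> eta0 h; have := d2_coord_le a0 (divr_ge0 (ltW eta0) (ler0n _ _)) h.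
rewrite ler_norml => /andP[h1 _].
have -> : d2 (cable_anchor b eta) v = (3 * eta) ^+ 2 - 6 * eta * (v a0 - b a0) + d2 v b.
  rewrite /d2 (bigD1 a0) //= [in RHS](bigD1 a0) //= addrA; congr (_ + _).
    by rewrite /cable_anchor /ax eqxx /=; ring.
  apply: eq_bigr => c /negbTE ne; rewrite /cable_anchor /ax ne /=; ring.
apply: le_trans (lerD (lexx _) h) _; nra.
Qed.

(** Closeness known only over the box becomes closeness for all configurations, at the price of
    constants: the cable is slack within eta / 8 of b and never lets a coordinate deviate by more
    than 7 eta. *)
Lemma add_cable S i (b : vec) (eta : R) : good S -> (i < size S)%N -> 0 < eta ->
  (forall phi, cfg S phi -> inK phi -> d2 (phi i) b <= (eta / 8) ^+ 2) ->
  exists S', [/\ good S', ext S S' &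
    forall phi, cfg S' phi -> forall c, `|phi i c - b c| <= 7 * eta].
Proof.
move=> [kS wS [U [g [M sol]]]] iS eta0 hb.
pose p := cable_anchor b eta; pose s := Cable p i (4 * eta).
have wf' : wf (S ++ [:: s]).
  by apply/wf_cat; split=> // -[|] //= _; rewrite addn0 mulr_gt0.
exists (S ++ [:: s]); split.
- split=> //; first by rewrite size_cat (leq_trans kS) ?leq_addr.
  do 3 eexists; apply: (extend (U' := U) (h := fun _ _ => p) (M' := \sum_c `|p c|)
      kS _ sol); case: sol => [[oU aU] hU KU slU bU] //.
  + by move=> x _ j _ c; apply: ana_const.
  + move=> phi /cfg_cat[/hU[? _] h]; split=> // -[|] // _.
    by case: (h 0%N isT).
  + move=> x Kx [|] //= _; rewrite addn0 ltnn iS; split=> //.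
    have [cx ix] := KU x Kx; apply: anchor_reach => //; apply: hb => //; by rewrite ix.
  + case=> [|j] // p' y l _ [<- <- <-] x Kx; rewrite iS slack_anchor.
    have -> : 4 * eta / 32 = eta / 8 by field.
    by have [cx ix] := KU x Kx; apply: hb => //; rewrite ix.
  by move=> x _ j _ c; rewrite (bigD1 c) //= lerDl sumr_ge0.
- by exists [:: s].
move=> phi /cfg_cat[_ /(_ 0%N isT)]; rewrite /= addn0 => -[_ h] c.
exact: anchor_near h.
Qed.

(** By Stewart's identity the prescribed distances to x and a put the new vertex at distance zero
    from (1 - t) x + t a. Hence this vertex gets no cable. *)
Lemma add_collinear S x a (t l : R) : good S -> (x < size S)%N -> (a < size S)%N ->
  0 < l -> t != 0 -> t != 1 ->
  (forall phi, cfg S phi -> d2 (phi x) (phi a) = l ^+ 2) ->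
  exists S', [/\ good S', ext S S', (size S < size S')%N &
    forall phi, cfg S' phi -> forall c, phi (size S) c = (1 - t) * phi x c + t * phi a c].
Proof.
move=> gS xS aS l0 t0 t1 hd; have [phi0 c0 K0] := good_config0 rho_ge0 gS.
have xa : x != a.
  apply/eqP => e; have := hd _ c0; rewrite e d2xx => /eqP.
  by rewrite eq_sym sqrf_eq0 gt_eqF.
case: gS => [kS wS [U [g [M sol]]]].
pose s := Bars [:: (x, `|t| * l); (a, `|1 - t| * l)] : @step R n.
have wf' : wf (S ++ [:: s]).
  apply/wf_cat; split=> // -[|] //= _; rewrite addn0; split.
    by rewrite inE xa.
  move=> y; rewrite !inE => /orP[]/eqP -> /=; split=> //; rewrite mulr_gt0 // normr_gt0 //.
  by rewrite subr_eq0 eq_sym.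
pose pos (phi : nat -> vec) : vec := fun c => (1 - t) * phi x c + t * phi a c.
have stewart (v X A : vec) : d2 v (fun c => (1 - t) * X c + t * A c) =
    (1 - t) * d2 v X + t * d2 v A - t * (1 - t) * d2 X A.
  rewrite /d2 !mulr_sumr -big_split -sumrB; apply: eq_bigr => c _ /=; ring.
have posE phi : cfg (S ++ [:: s]) phi -> phi (size S) = pos phi.
  move=> /cfg_cat[cphi /(_ 0%N isT)] /= h; rewrite addn0 in h.
  apply: d2_eq0; rewrite stewart (h (x, `|t| * l)) ?inE ?eqxx //.
  rewrite (h (a, `|1 - t| * l)) ?inE ?eqxx ?orbT //= hd // !exprMn !real_normK ?num_real //.
  ring.
have posd phi : cfg S phi ->
    d2 (pos phi) (phi x) = (`|t| * l) ^+ 2 /\ d2 (pos phi) (phi a) = (`|1 - t| * l) ^+ 2.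
  move=> cphi; rewrite [d2 (pos phi) (phi x)]d2C [d2 (pos phi) (phi a)]d2C !stewart.
  rewrite !d2xx (d2C (phi a)) hd // !exprMn !real_normK ?num_real //; split; ring.
exists (S ++ [:: s]); split.
- split=> //; first by rewrite size_cat (leq_trans kS) ?leq_addr.
  do 3 eexists; apply: (extend (U' := U) (h := fun y _ => pos (g y))
      (M' := `|1 - t| * M + `|t| * M) kS _ sol); case: sol => [[oU aU] hU KU slU bU] //.
  + move=> y Uy j _ c; apply: anaD; apply: anaM; try exact: ana_const; exact: aU.
  + move=> phi cphi; have [cS _] := (cfg_cat _ _ _).1 cphi.
    have [Uphi ephi] := hU _ cS; split=> // -[|] // _.
    by rewrite addn0 posE // /pos !ephi.
  + move=> y Ky [|] // _; have [cy iy] := KU y Ky; have [p1 p2] := posd _ cy.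
    by move=> z; rewrite /= addn0 ltnn !inE => /orP[]/eqP -> /=; rewrite ?xS ?aS.
  + by case=> [|[|]].
  move=> y Ky j _ c; rewrite /pos (le_trans (ler_normD _ _)) //.
  by rewrite lerD // normrM ler_wpM2l // bU.
- by exists [:: s].
- by rewrite size_cat addn1.
by move=> phi cphi c; rewrite posE.
Qed.

(** The bars alone may leave a second, mirror position, so the cable is added together with them.
    Inputs for which no position near b exists are dropped from the domain. *)
Lemma add_trilateration S (nu : 'I_n -> nat) (l : 'I_n -> R) (u0 : 'I_n -> vec) (b : vec) (r eta : R) :
  good S -> (forall i, (nu i < size S)%N) -> (forall i, 0 < l i) ->
  0 < eta -> 7 * eta < r ->
  (forall (u : 'I_n -> vec) v w, (forall i c, `|u i c - u0 i c| < r) ->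
     (forall c, `|v c - b c| < r) -> (forall c, `|w c - b c| < r) ->
     nondeg (fun i c => (v c + w c) / 2 - u i c)) ->
  (forall phi, cfg S phi -> forall i c, `|phi (nu i) c - u0 i c| < r) ->
  (forall phi, cfg S phi -> inK phi -> exists2 v, d2 v b <= (eta / 8) ^+ 2 &
     forall i, d2 v (phi (nu i)) = l i ^+ 2) ->
  exists S', [/\ good S', ext S S', (size S < size S')%N &
    forall phi, cfg S' phi -> [/\ forall c, `|phi (size S) c - b c| <= 7 * eta,
      forall i, d2 (phi (size S)) (phi (nu i)) = l i ^+ 2 &
      inK phi -> d2 (phi (size S)) b <= (eta / 8) ^+ 2]].
Proof.
move=> gS nuS l0 eta0 er nd near0 ex; have [phi0 c0 K0] := good_config0 rho_ge0 gS.
have eta8 : 0 <= eta / 8 by rewrite divr_ge0 // ltW.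
have close_near v : d2 v b <= (eta / 8) ^+ 2 -> forall c, `|v c - b c| < r.
  move=> h c; apply: le_lt_trans (d2_coord_le c eta8 h) _; lra.
have bb c : `|b c - b c| < r by rewrite subrr normr0; lra.
have nu_inj : injective nu.
  move=> i j e; have nd0 := nd _ _ _ (near0 _ c0) bb bb.
  by apply: (nondeg_rows_inj nd0) => c; rewrite /= e.
have uniq_sol phi v w : cfg S phi -> (forall c, `|v c - b c| < r) -> (forall c, `|w c - b c| < r) ->
    (forall i, d2 v (phi (nu i)) = l i ^+ 2) -> (forall i, d2 w (phi (nu i)) = l i ^+ 2) -> v = w.
  move=> cphi hv hw dv dw; apply: (trilateration_unique (u := fun i => phi (nu i))).
    exact: nd (near0 _ cphi) hv hw.
  by move=> i; rewrite dv dw.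
have := gS; move=> [kS wS [U [g [M sol]]]].
pose p := cable_anchor b eta; pose N := size S.
pose T := [:: Bars [seq (nu i, l i) | i <- enum 'I_n]; Cable p N (4 * eta)] : seq (@step R n).
have wf' : wf (S ++ T).
  apply/wf_cat; split=> // -[|[|]] //= _.
    rewrite -map_comp; split; first by rewrite map_inj_uniq ?enum_uniq.
    by move=> y /mapP[i _ ->] /=; rewrite addn0.
  by rewrite addn1 mulr_gt0.
pose tri x v := (forall c, `|v c - b c| < r) /\ forall i, d2 v (g x (nu i)) = l i ^+ 2.
pose U' x := [/\ U x, (forall i c, `|g x (nu i) c - u0 i c| < r) & exists v, tri x v].
pose hh x := xget (fun=> 0) (tri x).
have hhP x : (exists v, tri x v) -> tri x (hh x) by apply: xgetPex.
have tri_uniq x v w : U' x -> tri x v -> tri x w -> v = w.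
  move=> [_ hu _] [hv dv] [hw dw]; apply: (trilateration_unique (u := fun i => g x (nu i))).
    exact: nd hu hv hw.
  by move=> i; rewrite dv dw.
have Tcfg phi : cfg (S ++ T) phi -> [/\ cfg S phi, phi N.+1 = p,
    (forall c, `|phi N c - b c| <= 7 * eta) & forall i, d2 (phi N) (phi (nu i)) = l i ^+ 2].
  move=> /cfg_cat[cS h]; have h0 := h 0%N isT; have [h1 h2] := h 1%N isT.
  rewrite /= addn0 in h0; rewrite addn1 in h1; split=> // [c|i].
    exact: anchor_near h2.
  by apply: h0 (nu i, l i) _; apply: map_f; rewrite mem_enum.
have lt7 v : (forall c, `|v c - b c| <= 7 * eta) -> forall c, `|v c - b c| < r.
  by move=> h c; apply: le_lt_trans er.
have Tclose phi : cfg (S ++ T) phi -> inK phi -> d2 (phi N) b <= (eta / 8) ^+ 2.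
  move=> /Tcfg[cS _ /lt7 h1 h2] Kphi; have [v vb vd] := ex _ cS Kphi.
  by rewrite (uniq_sol _ _ _ cS h1 (close_near _ vb) h2 vd).
exists (S ++ T); split; last 1 first.
- by move=> phi cphi; have [? ? ? ?] := Tcfg _ cphi; split=> //; apply: Tclose.
- split=> //; first by rewrite size_cat (leq_trans kS) ?leq_addr.
  (* The position selected by [hh] is an arbitrary choice a priori; by uniqueness it coincides near
     x with the analytic local solution, which also shows that [U'] is open. *)
  have U'_local x : U' x -> exists v : ins -> vec, (forall c, ana (fun y => v y c) x) /\
      near_box x (fun y => U' y /\ v y = hh y).
    move=> U'x; have [Ux hu /hhP hhx] := U'x; case: sol => [[oU aU] hU KU slU bU].
    have au i c : ana (fun y => g y (nu i) c) x by apply: aU.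
    have ndx : nondeg (fun i c => hh x c - g x (nu i) c).
      have := nd _ _ _ hu hhx.1 hhx.1; congr nondeg.
      by apply/funext => i; apply/funext => c; field.
    have [v [av vx ev]] := trilateration_local au ndx.
    exists v; split=> //.
    have nv : near_box x (fun y => forall c, `|v y c - b c| < r).
      apply: near_box_all => c; apply: ana_near_lt => //; rewrite vx; exact: hhx.1.
    have nu' : near_box x (fun y => forall i, forall c, `|g y (nu i) c - u0 i c| < r).
      by apply: near_box_all => i; apply: near_box_all => c; apply: ana_near_lt.
    apply: near_boxW (near_boxI (near_boxI (oU _ Ux) ev) (near_boxI nv nu')).
    move=> y [[Uy ey] [vy uy]]; have ty : tri y (v y).
      by split=> // i; rewrite ey hhx.2.
    have U'y : U' y by split=> //; exists (v y).
    split; first exact: U'y.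
    have th : tri y (hh y) by apply: hhP; exists (v y).
    exact: tri_uniq U'y ty th.
  pose h x j := if j == 0%N then hh x else p.
  have solve_K x : inbox rho x -> d2 (hh x) b <= (eta / 8) ^+ 2 /\ tri x (hh x).
    move=> Kx; have [_ hU KU _ _] := sol; have [cx ix] := KU x Kx.
    have := ex _ cx; rewrite ix => /(_ Kx)[v vb vd].
    have tv : tri x v by split=> //; apply: close_near.
    have th : tri x (hh x) by apply: hhP; exists v.
    have e : hh x = v by exact: uniq_sol cx th.1 tv.1 th.2 tv.2.
    by split=> //; rewrite e.
  exists U'; do 2 eexists; apply: (extend (U' := U') (h := h)
      (M' := \sum_c `|b c| + eta + \sum_c `|p c|) kS wf' sol).
  + by move=> x [].
  + by move=> x /U'_local[v [_]]; apply: near_boxW => y [].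
  + move=> x U'x [|j] _ c; last exact: ana_const.
    have [v [av ev]] := U'_local x U'x; apply: ana_eq_near (av c).
    by apply: near_boxW ev => y [_ ->].
  + move=> phi cphi; have [cS hp h1 h2] := Tcfg _ cphi; case: sol => [_ hU _ _ _].
    have [Uphi ephi] := hU _ cS.
    have t1 : tri (inp phi) (phi N).
      by split=> [|i]; [exact: lt7|rewrite -ephi].
    have U'phi : U' (inp phi).
      by split=> // [i c|]; [rewrite -ephi //; apply: near0|exists (phi N)].
    split=> // -[|[|]] // _; last by rewrite addn1.
    rewrite addn0; have th : tri (inp phi) (hh (inp phi)) by apply: hhP; exists (phi N).
    exact: tri_uniq U'phi t1 th.
  + move=> x Kx [|[|]] // _; have [hb [_ hd]] := solve_K x Kx.
      move=> y /mapP[i _ ->] /=; rewrite addn0 ltnn subnn nuS; exact: hd.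
    split=> /=; first by rewrite addn1 ltnNge leqnSn /= subSnn.
    by rewrite ltnn subnn; apply: anchor_reach.
  + case=> [|[|]] // p' y l' _ [<- <- <-] x Kx; rewrite ltnn subnn slack_anchor.
    have -> : 4 * eta / 32 = eta / 8 by field.
    by have [] := solve_K x Kx.
  move=> x Kx j _ c; have B0 : `|b c| <= \sum_c `|b c| by rewrite (bigD1 c) //= lerDl sumr_ge0.
  have P0 : `|p c| <= \sum_c `|p c| by rewrite (bigD1 c) //= lerDl sumr_ge0.
  have P00 : 0 <= \sum_c `|p c| by rewrite sumr_ge0.
  have B00 : 0 <= \sum_c `|b c| by rewrite sumr_ge0.
  rewrite /h; case: eqP => _; last by lra.
  have [hb _] := solve_K x Kx; have := d2_coord_le c eta8 hb.
  have := ler_normD (hh x c - b c) (b c); rewrite subrK; lra.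
- by exists T.
by rewrite size_cat -[X in (X < _)%N]addn0 ltn_add2l.
Qed.

End AddSteps.

(** * Spiders *)

Section Spider.
Context {R : realType} {n : nat}.
Notation vec := ('I_n -> R).
Variables (k : nat) (rho : R) (a0 : 'I_n).
Hypothesis rho_ge0 : 0 <= rho.
Notation good := (good k rho a0).
Notation inp := (@inp R n k).
Notation inK phi := (inbox rho (inp phi)).
Implicit Types (S : seq (@step R n)) (phi : nat -> vec).

Definition close (x y : vec) (r : R) := forall c, `|x c - y c| < r.
Definition place (c : vec) (P : R) (x : vec) : vec := fun i => c i + P * x i.

Lemma close_le x y r r' : r <= r' -> close x y r -> close x y r'.
Proof. by move=> le h c; apply: lt_le_trans le. Qed.

Lemma finite_min (J : finType) (p : J -> R -> Prop) :
  (forall j r r', p j r -> 0 < r' -> r' <= r -> p j r') ->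
  (forall j, exists2 r, 0 < r & p j r) -> exists2 r, 0 < r & forall j, p j r.
Proof.
move=> mono ex; suff [r r0 h] : exists2 r, 0 < r & forall j, j \in enum J -> p j r.
  by exists r => // j; apply: h; rewrite mem_enum.
elim: (enum J) => [|j s [r r0 IH]]; first by exists 1.
have [r' r'0 h] := ex j; have m0 : 0 < Num.min r r' by rewrite lt_min r0.
exists (Num.min r r') => // i; rewrite inE => /orP[/eqP ->|/IH pi].
  by apply: mono h _ _; rewrite // ge_min lexx orbT.
by apply: mono pi _ _; rewrite // ge_min lexx.
Qed.

Lemma good_family (J : finType) S (Q : J -> (nat -> vec) -> vec -> Prop) : good S ->
  (forall S', good S' -> ext S S' -> forall l, exists S'', [/\ good S'', ext S' S'' &
     exists2 i, (i < size S'')%N & forall phi, cfg S'' phi -> Q l phi (phi i)]) ->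
  exists S', [/\ good S', ext S S' & exists iota : J -> nat, forall l,
    (iota l < size S')%N /\ forall phi, cfg S' phi -> Q l phi (phi (iota l))].
Proof.
move=> gS step; suff [S' [gS' eS' [io h]]] : exists S', [/\ good S', ext S S' &
    exists iota : J -> nat, forall l, l \in enum J ->
    (iota l < size S')%N /\ forall phi, cfg S' phi -> Q l phi (phi (iota l))].
  by exists S'; split=> //; exists io => l; apply: h; rewrite mem_enum.
elim: (enum J) => [|j s [S' [gS' eS' [io h]]]].
  by exists S; split=> //; [exact: ext_refl|exists (fun=> 0%N)].
have [S'' [gS'' eS'' [i iS hi]]] := step S' gS' eS' j.
exists S''; split=> //; first exact: ext_trans eS''.
exists (fun l => if l == j then i else io l) => l; rewrite inE.
case: eqP => [-> _|_ /= /h[ioS hio]]; first by split.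
split; first by apply: leq_trans (ext_size eS'').
by move=> phi /(ext_cfg eS''); apply: hio.
Qed.

Lemma close_d2 (x y : vec) r : 0 < r -> close x y (r / n%:R) -> d2 x y <= r ^+ 2.
Proof.
move=> r0 h; have n0 : 0 < n%:R :> R by rewrite ltr0n (leq_ltn_trans _ (ltn_ord a0)).
have n1 : 1 <= n%:R :> R by rewrite ler1n -(ltr0n R).
apply: (@le_trans _ _ (\sum_(i < n) (r / n%:R) ^+ 2)).
  apply: ler_sum => i _; rewrite -[leLHS]real_normK ?num_real //.
  by rewrite lerXn2r ?nnegrE ?divr_ge0 // ?(ltW r0) // ltW.
have -> : \sum_(i < n) (r / n%:R) ^+ 2 = n%:R * (r / n%:R) ^+ 2.
  by rewrite sumr_const card_ord mulr_natl.
have -> : n%:R * (r / n%:R) ^+ 2 = r ^+ 2 / n%:R by field; rewrite gt_eqF.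
by rewrite ler_pdivrMr // ler_peMr ?sqr_ge0.
Qed.

Lemma add_cable_scaled del : 0 < del -> exists2 del', 0 < del' &
  forall S i b P, good S -> (i < size S)%N -> 0 < P ->
    (forall phi, cfg S phi -> inK phi -> close (phi i) b (P * del')) ->
    exists S', [/\ good S', ext S S' & forall phi, cfg S' phi -> close (phi i) b (P * del)].
Proof.
move=> d0; have n0 : 0 < n%:R :> R by rewrite ltr0n (leq_ltn_trans _ (ltn_ord a0)).
(* With eta = P del / 8 the cable asks for Euclidean distance eta / 8, ensured by a coordinatewise
   bound n times smaller, and grants 7 eta < P del. *)
exists (del / 64 / n%:R); first by rewrite !divr_gt0.
move=> S i b P gS iS P0 h.
have [||S' [gS' eS' h']] := @add_cable _ _ k rho a0 S i b (P * (del / 8)) gS iS.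
- by rewrite mulr_gt0 // divr_gt0.
- move=> phi cphi Kphi; apply: close_d2; first by rewrite !(divr_gt0, mulr_gt0).
  apply: close_le (h _ cphi Kphi); rewrite le_eqVlt; apply/orP; left; apply/eqP.
  by field; rewrite gt_eqF.
exists S'; split=> // phi cphi c; apply: le_lt_trans (h' phi cphi c) _.
have := mulr_gt0 P0 d0; lra.
Qed.

(** The tolerance depends on the base figure and [eps] alone and is valid for every system, place
    and scale; so tolerances can be chosen backwards along a construction before the scale is
    known. *)
Lemma add_vertex (u0 : 'I_n -> vec) (v0 : vec) eps :
  nondeg (fun i c => v0 c - u0 i c) -> (forall i, 0 < d2 v0 (u0 i)) -> 0 < eps ->
  exists2 del, 0 < del & forall S nu c P, good S -> (forall i, (nu i < size S)%N) -> 0 < P ->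
    (forall phi, cfg S phi -> forall i, close (phi (nu i)) (place c P (u0 i)) (P * del)) ->
    exists S', [/\ good S', ext S S', (size S < size S')%N & forall phi, cfg S' phi ->
      close (phi (size S)) (place c P v0) (P * eps) /\
      forall i, d2 (phi (size S)) (phi (nu i)) = P ^+ 2 * d2 v0 (u0 i)].
Proof.
move=> nd dpos e0; have n0 : 0 < n%:R :> R by rewrite ltr0n (leq_ltn_trans _ (ltn_ord a0)).
have [r r0 hr] := nondeg_near nd.
pose h := Num.min r eps / 8; have m0 : 0 < Num.min r eps by rewrite lt_min r0.
have h0 : 0 < h by rewrite divr_gt0.
have e'0 : 0 < h / 8 / n%:R by rewrite !divr_gt0.
have [del d0 hdel] := trilateration_exists nd e'0.
exists (Num.min r del); first by rewrite lt_min r0.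
move=> S nu c P gS nuS P0 hu.
have hur phi : cfg S phi -> forall i, close (phi (nu i)) (place c P (u0 i)) (P * r).
  move=> /hu cu i; apply: close_le (cu i); by rewrite ler_pM2l // ge_min lexx.
have hud phi : cfg S phi -> forall i, close (phi (nu i)) (place c P (u0 i)) (P * del).
  move=> /hu cu i; apply: close_le (cu i); by rewrite ler_pM2l // ge_min lexx orbT.
pose l i := P * Num.sqrt (d2 v0 (u0 i)).
have l2 i : l i ^+ 2 = P ^+ 2 * d2 v0 (u0 i) by rewrite exprMn sqr_sqrtr ?d2_ge0.
have h7 : 7 * h < Num.min r eps by rewrite /h; lra.
have [||||||S' [gS' eS' sS' hS']] := @add_trilateration _ _ k rho a0 rho_ge0 S nu l
    (fun i => place c P (u0 i)) (place c P v0) (P * r) (P * h) gS nuS.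
- by move=> i; rewrite mulr_gt0 // sqrtr_gt0.
- by rewrite mulr_gt0.
- rewrite mulrCA ltr_pM2l //; apply: lt_le_trans h7 _; by rewrite ge_min lexx.
- by move=> u v w hu' hv hw; apply: (hr c P) => //.
- exact: hur.
- move=> phi cphi _; have [v cv dv] := hdel c P (fun i => phi (nu i)) P0 (hud _ cphi).
  exists v; last by move=> i; rewrite l2.
  apply: close_d2; first by rewrite divr_gt0 // mulr_gt0.
  apply: close_le cv; rewrite le_eqVlt; apply/orP; left; apply/eqP.
  by field; rewrite gt_eqF.
exists S'; split=> // phi /hS'[h1 h2 _]; split; last by move=> i; rewrite h2 l2.
move=> e; apply: le_lt_trans (h1 e) _; rewrite mulrCA ltr_pM2l //.
by apply: lt_le_trans h7 _; rewrite ge_min lexx orbT.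
Qed.

Variables (j j' : 'I_n).
Hypothesis jj' : j' != j.

(* The legs of the spider are indexed by the axes: leg l points along e_l, except that
   leg j points along -e_j'; so the feet 2 e_j + leg l are affinely independent. *)
Definition leg_axis (l : 'I_n) := if l == j then j' else l.
Definition leg_sign (l : 'I_n) : R := if l == j then -1 else 1.
Definition foot (l : 'I_n) : vec := fun c => 2 * ax j c + leg_sign l * ax (leg_axis l) c.
(** Neighbours of a foot in the base figure: X at the origin, Y at e_j, and for the remaining n - 2
    directions fixed points at unit distance from the foot. *)
Definition foot_nbr (l i : 'I_n) : vec := fun c =>
  if i == j then 0 else if i == leg_axis l then ax j c else foot l c - ax i c.

Lemma sum_ax (w : vec) i : \sum_c ax i c * w c = w i.
Proof.
rewrite (bigD1 i) //= /ax eqxx mul1r big1 ?addr0 // => c /negbTE ->.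
by rewrite mul0r.
Qed.

Lemma sum_ax2 (a b : R) i i' (w : vec) :
  \sum_c (a * ax i c + b * ax i' c) * w c = a * w i + b * w i'.
Proof.
rewrite -(sum_ax w i) -(sum_ax w i') !mulr_sumr -big_split; apply: eq_bigr => c _ /=.
by rewrite mulrDl !mulrA.
Qed.

Lemma sum_ax2_sqr (a b : R) (i i' : 'I_n) : i != i' ->
  \sum_c (a * ax i c + b * ax i' c) ^+ 2 = a ^+ 2 + b ^+ 2.
Proof.
move=> ii'; under eq_bigr do rewrite expr2.
by rewrite sum_ax2 /ax !eqxx (negbTE ii') [i' == i]eq_sym (negbTE ii') /=; ring.
Qed.

Lemma leg_axis_neq l : leg_axis l != j.
Proof. by rewrite /leg_axis; case: ifP => // ->. Qed.

Lemma leg_sign2 l : leg_sign l ^+ 2 = 1.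
Proof. by rewrite /leg_sign; case: ifP => _; rewrite ?sqrrN expr1n. Qed.

Lemma foot_nondeg l : nondeg (fun i c => foot l c - foot_nbr l i c).
Proof.
move=> w hw; have ml := leg_axis_neq l.
have hj : 2 * w j + leg_sign l * w (leg_axis l) = 0.
  rewrite -[RHS](hw j) -sum_ax2; apply: eq_bigr => c _.
  by rewrite /foot_nbr eqxx subr0.
have hm : 1 * w j + leg_sign l * w (leg_axis l) = 0.
  rewrite -[RHS](hw (leg_axis l)) -sum_ax2; apply: eq_bigr => c _.
  by rewrite /foot_nbr (negbTE ml) eqxx /foot; congr (_ * _); ring.
have wj : w j = 0 by lra.
have wm : w (leg_axis l) = 0.
  move: hm; rewrite wj mulr0 add0r => /eqP; rewrite mulf_eq0 => /orP[|/eqP //].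
  by rewrite -sqrf_eq0 leg_sign2 oner_eq0.
move=> i; have [->//|ij] := eqVneq i j; have [->//|im] := eqVneq i (leg_axis l).
rewrite -(sum_ax w) -[RHS](hw i); apply: eq_bigr => c _.
by rewrite /foot_nbr (negbTE ij) (negbTE im) opprB addrCA subrr addr0.
Qed.

Lemma foot_dist l i : d2 (foot l) (foot_nbr l i) =
  if i == j then 5 else if i == leg_axis l then 2 else 1.
Proof.
have ml := leg_axis_neq l; rewrite /d2 /foot_nbr; case: eqP => _.
  under eq_bigr do rewrite subr0.
  by rewrite sum_ax2_sqr 1?eq_sym // leg_sign2; ring.
case: eqP => _.
  have e c : foot l c - ax j c = 1 * ax j c + leg_sign l * ax (leg_axis l) c.
    by rewrite /foot; ring.
  under eq_bigr do rewrite e.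
  by rewrite sum_ax2_sqr 1?eq_sym // leg_sign2; ring.
have e c : foot l c - (foot l c - ax i c) = 1 * ax i c + 0 * ax (if i == j then j' else j) c.
  by ring.
under eq_bigr do rewrite e.
rewrite sum_ax2_sqr; first by ring.
by have [->|//] := eqVneq i j; rewrite eq_sym.
Qed.

Lemma apex_nondeg (a : R) : a != 0 -> nondeg (fun l c => a * ax j c - leg_sign l * ax (leg_axis l) c).
Proof.
move=> a0' w hw.
have h l : a * w j = leg_sign l * w (leg_axis l).
  apply/eqP; rewrite -subr_eq0; apply/eqP; rewrite -[RHS](hw l) -mulNr -sum_ax2.
  by apply: eq_bigr => c _; rewrite mulNr.
(* Legs j and j' are opposite, so the two equations give w_j' = 0 and then w_j = 0. *)
have h1 := h j; have h2 := h j'; rewrite /leg_sign /leg_axis eqxx (negbTE jj') in h1 h2.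
have wj' : w j' = 0 by lra.
have wj : w j = 0.
  by move/eqP: h2; rewrite wj' mulr0 mulf_eq0 (negbTE a0') => /eqP.
move=> i; have [->//|ij] := eqVneq i j; have := h i.
by rewrite wj mulr0 /leg_sign /leg_axis (negbTE ij) mul1r.
Qed.

(** 5 and 2 are the squared lengths of 2 e_j + leg and e_j + leg. The bars keep these two distances
    in every configuration while X and Y move. *)
Lemma spider eps : 0 < eps -> exists2 del, 0 < del &
  forall S X Y c P, good S -> (X < size S)%N -> (Y < size S)%N -> 0 < P ->
    (forall phi, cfg S phi -> close (phi X) c (P * del)) ->
    (forall phi, cfg S phi -> close (phi Y) (place c P (ax j)) (P * del)) ->
    exists S', [/\ good S', ext S S' & exists beta : 'I_n -> nat, forall l,
      (beta l < size S')%N /\ forall phi, cfg S' phi ->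
        [/\ close (phi (beta l)) (place c P (foot l)) (P * eps),
            d2 (phi (beta l)) (phi X) = 5 * P ^+ 2 &
            d2 (phi (beta l)) (phi Y) = 2 * P ^+ 2]].
Proof.
move=> e0.
have dpos l i : 0 < d2 (foot l) (foot_nbr l i).
  by rewrite foot_dist; case: ifP => // _; case: ifP.
pose p l del := forall S nu c P, good S -> (forall i, (nu i < size S)%N) -> 0 < P ->
    (forall phi, cfg S phi ->
      forall i, close (phi (nu i)) (place c P (foot_nbr l i)) (P * del)) ->
    exists S', [/\ good S', ext S S', (size S < size S')%N & forall phi, cfg S' phi ->
      close (phi (size S)) (place c P (foot l)) (P * eps) /\
      forall i, d2 (phi (size S)) (phi (nu i)) = P ^+ 2 * d2 (foot l) (foot_nbr l i)].
have [del d0 hdel] : exists2 del, 0 < del & forall l, p l del.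
  apply: finite_min => [l r r' pr r'0 rr' S nu c P gS nuS P0 h|l].
    apply: pr => // phi cphi i; apply: close_le (h phi cphi i).
    by rewrite ler_pM2l.
  exact: add_vertex (@foot_nondeg l) (dpos l) e0.
exists del => // S X Y c P gS XS YS P0 hX hY.
have [S1 [gS1 eS1 [q hq]]] := @good_family ('I_n * 'I_n)%type S
  (fun li _ v => v = place c P (foot_nbr li.1 li.2)) gS
  (fun S' gS' _ li => let: ex_intro S'' (And4 g e s h) :=
      add_fixed (place c P (foot_nbr li.1 li.2)) gS' in
    ex_intro _ S'' (And3 g e (ex_intro2 _ _ (size S') s h))).
have [|S2 [gS2 eS2 [be hbe]]] := @good_family 'I_n S1 (fun l phi v =>
    [/\ close v (place c P (foot l)) (P * eps),
            d2 v (phi X) = 5 * P ^+ 2 & d2 v (phi Y) = 2 * P ^+ 2]) gS1.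
  move=> S' gS' eS' l.
  pose nu i := if i == j then X else if i == leg_axis l then Y else q (l, i).
  have sS' := ext_size (ext_trans eS1 eS').
  have nuS' i : (nu i < size S')%N.
    rewrite /nu; case: ifP => _; first exact: leq_trans sS'.
    case: ifP => _; first exact: leq_trans sS'.
    exact: leq_trans (hq (l, i)).1 (ext_size eS').
  have [|S'' [gS'' eS'' sS'' h]] := hdel l S' nu c P gS' nuS' P0.
    move=> phi cphi i; have c1 := ext_cfg eS' cphi; have cS := ext_cfg eS1 c1.
    rewrite /nu; case: (eqVneq i j) => [->|ij].
      have -> : place c P (foot_nbr l j) = c; last exact: hX.
      by apply/funext => e; rewrite /place /foot_nbr eqxx mulr0 addr0.
    case: (eqVneq i (leg_axis l)) => [->|im].
      have -> : place c P (foot_nbr l (leg_axis l)) = place c P (ax j); last exact: hY.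
      by apply/funext => e; rewrite /place /foot_nbr (negbTE (leg_axis_neq l)) eqxx.
    by rewrite ((hq (l, i)).2 _ c1) => e; rewrite subrr normr0 mulr_gt0.
  exists S''; split=> //; exists (size S') => // phi /h[h1 h2]; split=> //.
    by have := h2 j; rewrite /nu foot_dist eqxx mulrC.
  by have := h2 (leg_axis l); rewrite /nu foot_dist (negbTE (leg_axis_neq l)) eqxx mulrC.
by exists S2; split=> //; [exact: ext_trans eS2|exists be].
Qed.

End Spider.

(** * Realizable maps: inversion and affine combination *)

Section Realizable.
Context {R : realType} {n : nat}.
Notation vec := ('I_n -> R).
Variables (k : nat) (rho : R) (a0 : 'I_n).
Hypothesis rho_ge0 : 0 <= rho.
Notation ins := ('I_k * 'I_n -> R).
Notation good := (good k rho a0).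
Notation inp := (@inp R n k).
Notation inK phi := (inbox rho (inp phi)).
Implicit Types (S : seq (@step R n)) (phi : nat -> vec) (F G : ins -> vec).

Definition sqnorm (w : vec) : R := \sum_c w c ^+ 2.
(* The power 3 P^2 is |b - X|^2 - |b - Y|^2 for the feet b of a spider. *)
Definition inversion (P : R) (w : vec) : vec := fun c => 3 * P ^+ 2 * w c / sqnorm w.
Notation pl := (place (fun=> 0)).

Lemma sqnorm_scale a w : sqnorm (fun c => a * w c) = a ^+ 2 * sqnorm w.
Proof. by rewrite /sqnorm mulr_sumr; apply: eq_bigr => c _; rewrite exprMn. Qed.

Lemma sqnorm_ax (j : 'I_n) : sqnorm (ax j) = 1.
Proof.
rewrite /sqnorm (bigD1 j) //= /ax eqxx big1 ?addr0 ?expr1n // => c /negbTE ->.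
by rewrite expr0n.
Qed.

Lemma inversion_continuous j eps : 0 < eps -> exists2 del, 0 < del &
  forall P w, 0 < P -> close w (pl P (ax j)) (P * del) ->
    0 < sqnorm w /\ close (inversion P w) (pl P (fun c => 3 * ax j c)) (P * eps).
Proof.
(* With e <= 1/2 the normalized squared norm stays above 1/2, and the error is then below 3 (e + e)
   / (1/2) = 12 e <= eps. *)
move=> e0; pose e := Num.min 2^-1 (eps / 12).
have ep : 0 < e by rewrite lt_min invr_gt0 ltr0n divr_gt0.
have ann : ana sqnorm (ax j).
  have -> : sqnorm = fun w => \sum_c w c * w c by apply/funext => w; apply: eq_bigr.
  by apply: ana_sum => c; apply: anaM; apply: ana_coord.
have [r r0 hr] := ana_cont ann ep.
exists (Num.min r e); first by rewrite lt_min r0.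
move=> P w P0 cw; pose v c := P^-1 * w c.
have wE : w = fun c => P * v c.
  by apply/funext => c; rewrite /v mulrA divff ?mul1r ?gt_eqF.
have cv c : `|v c - ax j c| < Num.min r e.
  rewrite -(ltr_pM2l P0) -{1}(gtr0_norm P0) -normrM; apply: le_lt_trans (cw c).
  by rewrite wE /place add0r mulrBr.
have nv : `|sqnorm v - 1| < e.
  by rewrite -(sqnorm_ax j); apply: hr => c; apply: lt_le_trans (cv c) _; rewrite ge_min lexx.
have ve c : `|v c - ax j c| < e.
  by apply: lt_le_trans (cv c) _; rewrite ge_min lexx orbT.
have e2 : e <= 2^-1 by rewrite ge_min lexx.
have e12 : e <= eps / 12 by rewrite ge_min lexx orbT.
have nv2 : 2^-1 < sqnorm v by move: nv; rewrite ltr_norml => /andP[h _]; lra.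
have nv0 : 0 < sqnorm v by lra.
have nw : sqnorm w = P ^+ 2 * sqnorm v by rewrite wE sqnorm_scale.
split; first by rewrite nw mulr_gt0 ?exprn_gt0.
move=> c; have -> : inversion P w c - pl P (fun c => 3 * ax j c) c =
   P * (3 * ((v c - ax j c) + ax j c * (1 - sqnorm v)) / sqnorm v).
  rewrite /inversion /place nw [in w c]wE; field; rewrite !gt_eqF //.
rewrite normrM gtr0_norm // ltr_pM2l // normrM normfV (gtr0_norm nv0) ltr_pdivrMr //.
rewrite normrM ger0_norm //; have ax1 : `|ax j c| <= 1 :> R.
  by rewrite /ax; case: (c == j); rewrite ?normr1 ?normr0.
have h1 : `|ax j c * (1 - sqnorm v)| <= 1 * `|sqnorm v - 1| by rewrite normrM distrC ler_wpM2r.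
have h2 := ler_normD (v c - ax j c) (ax j c * (1 - sqnorm v)).
have h3 := ve c; have h4 : eps * 2^-1 < eps * sqnorm v by rewrite ltr_pM2l.
lra.
Qed.

Lemma nondeg_scale (t : R) (M : 'I_n -> 'I_n -> R) : t != 0 ->
  nondeg M -> nondeg (fun i c => t * M i c).
Proof.
move=> t0 nd w hw; apply: nd => i; apply: (mulfI t0); rewrite mulr0 -[RHS](hw i) mulr_sumr.
by apply: eq_bigr => c _; rewrite mulrA.
Qed.

(** Stated for extensions of an arbitrary good system, so that constructions can be stacked, and for
    all configurations rather than those over the box. The variant with a new vertex keeps outputs
    apart. *)
Definition realizable F := forall S, good S -> exists S', [/\ good S', ext S S' &
  exists2 i, (i < size S')%N & forall phi, cfg S' phi -> phi i = F (inp phi)].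
Definition realizable_new F := forall S, good S -> exists S', [/\ good S', ext S S' &
  exists2 i, (size S <= i < size S')%N & forall phi, cfg S' phi -> phi i = F (inp phi)].
(** A condition that additional cables can impose on the inputs; it makes identities with
    denominators usable although they may fail at other inputs. *)
Definition enforceable (D : ins -> Prop) := forall S, good S -> exists S', [/\ good S', ext S S' &
  forall phi, cfg S' phi -> D (inp phi)].
Definition nearK F b r := forall x, inbox rho x -> close (F x) b r.

Lemma realizable_const (p : vec) : realizable (fun=> p).
Proof.
by move=> S /(add_fixed p)[S' [gS' eS' sS' h]]; exists S'; split=> //; exists (size S).
Qed.

Lemma realizable_congr D F G : enforceable D -> realizable F -> (forall x, D x -> F x = G x) -> realizable G.
Proof.
move=> hD hF e S /hD[S1 [g1 e1 h1]]; have [S2 [g2 e2 [i i2 h2]]] := hF S1 g1.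
exists S2; split=> //; first exact: ext_trans e2.
by exists i => // phi cphi; rewrite h2 // e //; apply: h1; apply: ext_cfg cphi.
Qed.

Lemma realizable_new_realizable F : realizable_new F -> realizable F.
Proof.
by move=> hF S /hF[S' [g e [i /andP[_ iS] h]]]; exists S'; split=> //; exists i.
Qed.

Lemma realizable_eq F G : (forall x, F x = G x) -> realizable F -> realizable G.
Proof. by move=> e; have -> : G = F by apply/funext => x; rewrite e. Qed.

Lemma realizable_input (l : 'I_k) : realizable (fun x c => x (l, c)).
Proof.
move=> S gS; exists S; split=> //; first exact: ext_refl.
by case: gS => kS _ _; exists l => //; apply: leq_trans kS.
Qed.

Lemma realizable_bounded F : realizable F -> exists2 M, 0 < M & forall x, inbox rho x -> forall c, `|F x c| < M.
Proof.
move=> /(_ _ (@good_free R n k rho a0))[S [gS _ [i iS h]]].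
have [M hM] := good_bounded gS; exists (`|M| + 1); first by rewrite ltr_wpDl.
move=> x Kx c; have [phi cphi e] := good_config gS Kx.
rewrite -e -h //; apply: (@le_lt_trans _ _ `|M|); last by rewrite ltrDl.
by apply: le_trans (ler_norm M); apply: hM => //; rewrite e.
Qed.

Lemma enforceable_near del : 0 < del -> exists2 del', 0 < del' & forall F b P, 0 < P -> realizable F ->
  nearK F b (P * del') -> enforceable (fun x => close (F x) b (P * del)).
Proof.
move=> /(@add_cable_scaled R n k rho a0)[del' d0 h]; exists del' => // F b P P0 hF nF S gS.
have [S1 [g1 e1 [i i1 h1]]] := hF S gS.
have [|S2 [g2 e2 h2]] := h S1 i b P g1 i1 P0.
  by move=> phi cphi Kphi; rewrite h1 //; apply: nF.
exists S2; split=> //; first exact: ext_trans e2.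
by move=> phi cphi; rewrite -h1; [exact: h2|exact: ext_cfg cphi].
Qed.

Lemma realizable_pair F G S : realizable F -> realizable G -> good S -> exists S', [/\ good S', ext S S' &
  exists i i', [/\ (i < size S')%N, (i' < size S')%N &
    forall phi, cfg S' phi -> phi i = F (inp phi) /\ phi i' = G (inp phi)]].
Proof.
move=> hF hG gS; have [S1 [g1 e1 [i i1 h1]]] := hF S gS.
have [S2 [g2 e2 [i' i2 h2]]] := hG S1 g1.
exists S2; split=> //; first exact: ext_trans e2.
exists i, i'; split=> //; first exact: leq_trans (ext_size e2).
by move=> phi cphi; rewrite h2 // h1 //; apply: ext_cfg cphi.
Qed.

Section Axis.
Variables (j j' : 'I_n).
Hypothesis jj' : j' != j.

(** An n-dimensional Peaucellier cell with base positions X = 0, Y = P e_j, Z = 3 P e_j: the feet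
    have squared distance 5 P^2 from X and 2 P^2 from both Y and Z. The inverse of Y satisfies the
    distance conditions imposed on Z and lies near the same base point, so uniqueness of
    trilateration identifies the two. *)
Lemma realizable_inv : exists2 del, 0 < del & forall F P, 0 < P -> realizable F ->
  nearK F (pl P (ax j)) (P * del) -> realizable (fun x => inversion P (F x)).
Proof.
pose v0 : vec := fun c => 3 * ax j c; pose u0 := @foot R n j j'.
have nd : nondeg (fun l c => v0 c - u0 l c).
  have := apex_nondeg jj' (oner_neq0 R); congr nondeg.
  by apply/funext => l; apply/funext => c; rewrite /v0 /u0 /foot; ring.
have dv l : d2 v0 (u0 l) = 2.
  have e c : v0 c - u0 l c = 1 * ax j c + - leg_sign j l * ax (leg_axis j j' l) c.
    by rewrite /v0 /u0 /foot; ring.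
  rewrite /d2; under eq_bigr do rewrite e.
  by rewrite sum_ax2_sqr ?sqrrN ?leg_sign2; [ring|rewrite eq_sym leg_axis_neq].
have [r r0 hr] := nondeg_near nd.
have [|delz dz hz] := @add_vertex _ _ k rho a0 rho_ge0 u0 v0 r nd _ r0.
  by move=> l; rewrite dv.
have [delc dc hc] := inversion_continuous j r0.
have ms : 0 < Num.min r delz by rewrite lt_min r0.
have [dels ds hs] := @spider _ _ k rho a0 rho_ge0 j j' jj' _ ms.
have mD : 0 < Num.min dels delc by rewrite lt_min ds.
have [del d0 hD] := enforceable_near mD.
exists del => // F P P0 hF nF S gS.
have [S1 [g1 e1 [X [Y [X1 Y1 h1]]]]] := realizable_pair (realizable_const (fun=> 0)) hF gS.
have [S2 [g2 e2 h2]] := hD F _ P P0 hF nF S1 g1.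
have X2 := leq_trans X1 (ext_size e2); have Y2 := leq_trans Y1 (ext_size e2).
have cl d phi : cfg S2 phi -> Num.min dels delc <= d -> close (phi Y) (pl P (ax j)) (P * d).
  move=> cphi le; have [_ ->] := h1 _ (ext_cfg e2 cphi).
  by apply: close_le (h2 _ cphi); rewrite ler_pM2l.
have [||S3 [g3 e3 [be hbe]]] := hs S2 X Y (fun=> 0) P g2 X2 Y2 P0.
- move=> phi cphi c; have [-> _] := h1 _ (ext_cfg e2 cphi).
  by rewrite subrr normr0 mulr_gt0.
- by move=> phi cphi; apply: cl => //; rewrite ge_min lexx.
have [||S4 [g4 e4 s4 h4]] := hz S3 be (fun=> 0) P g3 _ P0.
- by move=> l; case: (hbe l).
- move=> phi cphi l; have [_ /(_ _ cphi)[c1 _ _]] := hbe l; apply: close_le c1.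
  by rewrite ler_pM2l // ge_min lexx orbT.
exists S4; split=> //; first exact: ext_trans (ext_trans e1 (ext_trans e2 e3)) e4.
exists (size S3) => // phi c4; have [cz dz4] := h4 _ c4.
have c3 := ext_cfg e4 c4; have c2 := ext_cfg e3 c3; have c1 := ext_cfg e2 c2.
have [pX pY] := h1 _ c1; rewrite -pY.
have [|nY0 cI] := hc P (phi Y) P0; first by apply: cl => //; rewrite ge_min lexx orbT.
apply: (trilateration_unique (u := fun l => phi (be l))).
  apply: (hr (fun=> 0) P) => // l c.
  have [_ /(_ _ c3)[cb _ _]] := hbe l; apply: lt_le_trans (cb c) _.
  by rewrite ler_pM2l // ge_min lexx.
move=> l; rewrite dz4 dv; have [_ /(_ _ c3)[_ dX dY]] := hbe l.
set y := phi Y in nY0 dY *; set b := phi (be l) in dX dY *.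
(* Since |b|^2 = 5 P^2 and |b - y|^2 = 2 P^2, the product b . y is known; this is what puts the
   inverse point at squared distance 2 P^2 from b. *)
have : 2 * \sum_c b c * y c = 3 * P ^+ 2 + sqnorm y.
  have -> : 3 * P ^+ 2 + sqnorm y = d2 b (fun=> 0) - d2 b y + sqnorm y.
    by rewrite -pX dX dY; ring.
  rewrite /d2 /sqnorm -sumrB -big_split mulr_sumr; apply: eq_bigr => c _ /=; ring.
move=> by2; have bb : \sum_c b c ^+ 2 = 5 * P ^+ 2.
  by rewrite -dX pX /d2; apply: eq_bigr => c _; rewrite subr0.
transitivity ((3 * P ^+ 2 / sqnorm y) ^+ 2 * (\sum_c y c ^+ 2) - (3 * P ^+ 2 / sqnorm y) * (2 * \sum_c b c * y c)
    + \sum_c b c ^+ 2).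
  by rewrite by2 bb -/(sqnorm y); field; rewrite gt_eqF.
rewrite /d2 !mulr_sumr -sumrB -big_split; apply: eq_bigr => c _ /=.
by rewrite /inversion; field; rewrite gt_eqF.
Qed.

(** A pantograph: the feet are moved by the homothety with centre X and ratio t, and the new vertex
    keeps to the moved feet |t| times the distance that Y keeps to the feet. The image of Y under
    the homothety meets these conditions, and trilateration makes it the only solution. *)
Lemma realizable_affine (t : R) : t != 0 -> t != 1 -> exists2 del, 0 < del &
  forall F G c P, 0 < P -> realizable F -> realizable G -> nearK F c (P * del) ->
    nearK G (place c P (ax j)) (P * del) ->
    realizable_new (fun x i => (1 - t) * F x i + t * G x i).
Proof.
move=> t0 t1; pose v0 : vec := fun c => t * ax j c.
pose u0 l : vec := fun c => t * @foot R n j j' l c.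
have m1 : (-1 : R) != 0 by rewrite oppr_eq0 oner_neq0.
have nd : nondeg (fun l c => v0 c - u0 l c).
  have := nondeg_scale t0 (apex_nondeg jj' m1); congr nondeg.
  by apply/funext => l; apply/funext => c; rewrite /v0 /u0 /foot; ring.
have dv l : d2 v0 (u0 l) = 2 * t ^+ 2.
  have e c : v0 c - u0 l c = - t * ax j c + - (t * leg_sign j l) * ax (leg_axis j j' l) c.
    by rewrite /v0 /u0 /foot; ring.
  rewrite /d2; under eq_bigr do rewrite e.
  by rewrite sum_ax2_sqr ?sqrrN ?exprMn ?leg_sign2; [ring|rewrite eq_sym leg_axis_neq].
have [r r0 hr] := nondeg_near nd.
have [|delz dz hz] := @add_vertex _ _ k rho a0 rho_ge0 u0 v0 r nd _ r0.
  by move=> l; rewrite dv mulr_gt0 ?exprn_even_gt0.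
(* An affine combination of two points enlarges tolerances by at most |1 - t| + |t|; the extra 1
   makes the inequality strict. *)
pose Cst := `|1 - t| + `|t| + 1; have C0 : 0 < Cst by rewrite ltr_wpDl ?addr_ge0.
have mz : 0 < Num.min r delz / Cst by rewrite divr_gt0 // lt_min r0.
have [dels ds hs] := @spider _ _ k rho a0 rho_ge0 j j' jj' _ mz.
have mD : 0 < Num.min dels (Num.min r delz / Cst) by rewrite lt_min ds.
have [del d0 hD] := enforceable_near mD.
have comb P (x y x0 y0 : vec) : 0 < P -> close x x0 (P * (Num.min r delz / Cst)) ->
    close y y0 (P * (Num.min r delz / Cst)) ->
    close (fun c => (1 - t) * x c + t * y c) (fun c => (1 - t) * x0 c + t * y0 c)
      (P * Num.min r delz).
  move=> P0 hx hy c; set m := P * _ in hx hy.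
  have -> : P * Num.min r delz = Cst * m by rewrite /m; field; rewrite gt_eqF.
  have m0 : 0 < m by rewrite mulr_gt0.
  have -> : (1 - t) * x c + t * y c - ((1 - t) * x0 c + t * y0 c) =
     (1 - t) * (x c - x0 c) + t * (y c - y0 c) by ring.
  apply: (le_lt_trans (ler_normD _ _)); rewrite !normrM.
  have h1 : `|1 - t| * `|x c - x0 c| <= `|1 - t| * m by rewrite ler_wpM2l // ltW.
  have h2 : `|t| * `|y c - y0 c| <= `|t| * m by rewrite ler_wpM2l // ltW.
  by rewrite /Cst !mulrDl mul1r; lra.
have lez P : 0 < P -> P * Num.min r delz <= P * delz.
  by move=> P0; rewrite ler_pM2l // ge_min lexx orbT.
have ler P : 0 < P -> P * Num.min r delz <= P * r.
  by move=> P0; rewrite ler_pM2l // ge_min lexx.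
exists del => // F G c P P0 hF hG nF nG S gS.
have [S1 [g1 e1 [X [Y [X1 Y1 h1]]]]] := realizable_pair hF hG gS.
have [S1' [g1' e1' h1']] := hD F _ P P0 hF nF S1 g1.
have [S2 [g2 e2' h2]] := hD G _ P P0 hG nG S1' g1'.
have e2 := ext_trans e1' e2'.
have X2 := leq_trans X1 (ext_size e2); have Y2 := leq_trans Y1 (ext_size e2).
have clX d phi : cfg S2 phi -> Num.min dels (Num.min r delz / Cst) <= d ->
    close (phi X) c (P * d).
  move=> cphi le; have [-> _] := h1 _ (ext_cfg e2 cphi).
  by apply: close_le (h1' _ (ext_cfg e2' cphi)); rewrite ler_pM2l.
have clY d phi : cfg S2 phi -> Num.min dels (Num.min r delz / Cst) <= d ->
    close (phi Y) (place c P (ax j)) (P * d).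
  move=> cphi le; have [_ ->] := h1 _ (ext_cfg e2 cphi).
  by apply: close_le (h2 _ cphi); rewrite ler_pM2l.
have [||S3 [g3 e3 [be hbe]]] := hs S2 X Y c P g2 X2 Y2 P0.
- by move=> phi cphi; apply: clX => //; rewrite ge_min lexx.
- by move=> phi cphi; apply: clY => //; rewrite ge_min lexx.
have X3 := leq_trans X2 (ext_size e3).
pose Q l phi v := v = (fun e => (1 - t) * phi X e + t * phi (be l) e) :> vec.
have [|S4 [g4 e4 [al hal]]] := @good_family _ _ k rho a0 'I_n S3 Q g3.
  move=> S' gS' eS' l; have [bl3 hb] := hbe l; have sS' := ext_size eS'.
  have l0 : 0 < Num.sqrt 5 * P by rewrite mulr_gt0 // sqrtr_gt0.
  have [|S'' [gS'' eS'' sS'' h]] := add_collinear rho_ge0 gS' (leq_trans X3 sS')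
      (leq_trans bl3 sS') l0 t0 t1.
    move=> phi cphi; have [_ d5 _] := hb _ (ext_cfg eS' cphi).
    by rewrite d2C d5 exprMn sqr_sqrtr.
  exists S''; split=> //; exists (size S') => // phi cphi.
  by apply/funext => e; rewrite h.
have alc phi : cfg S4 phi -> forall l, close (phi (al l)) (place c P (u0 l)) (P * Num.min r delz).
  move=> c4 l; have [_ ->] := hal l; last exact: c4.
  have c3 := ext_cfg e4 c4; have c2 := ext_cfg e3 c3.
  have -> : place c P (u0 l) =
      fun e => (1 - t) * c e + t * place c P (@foot R n j j' l) e.
    by apply/funext => e; rewrite /place /u0; ring.
  apply: comb => //; first by apply: clX; rewrite // ge_min lexx orbT.
  by have [_ /(_ _ c3)[cb _ _]] := hbe l.
have [||S5 [g5 e5 s5 h5]] := hz S4 al c P g4 _ P0.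
- by move=> l; case: (hal l).
- by move=> phi cphi l; apply: close_le (alc _ cphi l); apply: lez.
exists S5; split=> //.
  by apply: ext_trans (ext_trans e1 (ext_trans e2 e3)) (ext_trans e4 e5).
exists (size S4) => [|phi c5].
  by rewrite s5 andbT; apply: ext_size (ext_trans e1 (ext_trans e2 (ext_trans e3 e4))).
have [cz dz5] := h5 _ c5.
have c4 := ext_cfg e5 c5; have c3 := ext_cfg e4 c4.
have c2 := ext_cfg e3 c3; have c1 := ext_cfg e2 c2.
have [pX pY] := h1 _ c1; rewrite -pX -pY.
apply: (trilateration_unique (u := fun l => phi (al l))).
  apply: (hr c P) => //.
    by move=> l; apply: close_le (alc _ c4 l); apply: ler.
  have pe : place c P v0 = fun e => (1 - t) * c e + t * place c P (ax j) e.
    by apply/funext => e; rewrite /place /v0; ring.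
  suff : close (fun e => (1 - t) * phi X e + t * phi Y e) (place c P v0) (P * r) by [].
  rewrite pe; apply: close_le (ler P P0) _; apply: comb => //.
    by apply: clX; rewrite // ge_min lexx orbT.
  by apply: clY; rewrite // ge_min lexx orbT.
move=> l; rewrite dz5 dv; have [_ /(_ _ c4) ->] := hal l.
have [_ /(_ _ c3)[_ _ dY]] := hbe l.
transitivity (t ^+ 2 * d2 (phi (be l)) (phi Y)); first by rewrite dY; ring.
by rewrite /d2 mulr_sumr; apply: eq_bigr => e _; ring.
Qed.

End Axis.
End Realizable.

(** * Arithmetic of realizable maps *)

Section Arithmetic.
Context {R : realType} {n : nat}.
Notation vec := ('I_n -> R).
Variables (k : nat) (rho : R) (a0 a1 : 'I_n).
Hypothesis (rho_ge0 : 0 <= rho) (a10 : a1 != a0).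
Notation ins := ('I_k * 'I_n -> R).
Notation realizable := (@realizable R n k rho a0).
Notation realizable_new := (@realizable_new R n k rho a0).
Notation pl := (place (fun=> 0)).
Implicit Types (F G : ins -> vec) (s t : ins -> R).

Lemma scale_exists (M del : R) : 0 < M -> 0 < del -> exists2 P, 0 < P & M = P * del.
Proof. by move=> M0 d0; exists (M / del); rewrite ?divr_gt0 // divfK ?gt_eqF. Qed.

Let cst (p : vec) : realizable (fun=> p).
Proof. exact: realizable_const. Qed.

(** An affine combination needs arguments that are about P e_a0 apart. Two point reflections meet
    this: F goes to 2 P e_a0 - F, and reflecting in P e_a0 + c / 2 gives F + c. Afterwards displaced
    copies of any map are available. *)
Lemma realizable_translate F (c : vec) : realizable F -> realizable_new (fun x i => F x i + c i).
Proof.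
move=> hF; have t2 : (2 : R) != 0 by rewrite pnatr_eq0.
have t21 : (2 : R) != 1 by rewrite -subr_eq0 [_ - _](_ : _ = 1) ?oner_eq0 //; ring.
have m1 : (-1 : R) != 0 by rewrite oppr_eq0 oner_eq0.
have m11 : (-1 : R) != 1 by rewrite eq_sym -subr_eq0 opprK -[1 + 1]/(2%:R) pnatr_eq0.
have [d1 d10 h1] := @realizable_affine R n k rho a0 rho_ge0 a0 a1 a10 _ t2 t21.
have [d2 d20 h2] := @realizable_affine R n k rho a0 rho_ge0 a0 a1 a10 _ m1 m11.
have [M M0 bF] := realizable_bounded hF.
pose M' := M + \sum_i `|c i|; have sc0 : 0 <= \sum_i `|c i| by rewrite sumr_ge0.
have M'0 : 0 < M' by rewrite ltr_pwDl.
have cM i : `|c i| < M'.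
  by rewrite /M' (bigD1 i) //= addrCA ltrDl ltr_pwDl // sumr_ge0.
have m0 : 0 < Num.min d1 d2 by rewrite lt_min d10.
have [P P0 MP] := scale_exists M'0 m0.
have le1 : M' <= P * d1 by rewrite MP ler_pM2l // ge_min lexx.
have le2 : M' <= P * d2 by rewrite MP ler_pM2l // ge_min lexx orbT.
have MM' : M <= M' by rewrite lerDl.
have hA : realizable (fun x i => (1 - 2) * F x i + 2 * pl P (ax a0) i).
  apply/realizable_new_realizable/(h1 _ _ (fun=> 0) P P0 hF (cst _)) => x Kx i.
    by rewrite subr0; apply: lt_le_trans (bF x Kx i) (le_trans MM' le1).
  by rewrite subrr normr0 mulr_gt0.
have hB : realizable_new (fun x i => (1 - -1) * (pl P (ax a0) i + c i / 2) +
    -1 * ((1 - 2) * F x i + 2 * pl P (ax a0) i)).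
  apply: (h2 _ _ (pl P (ax a0)) P P0 (cst _) hA) => x Kx i.
    have -> : pl P (ax a0) i + c i / 2 - pl P (ax a0) i = c i / 2 by ring.
    apply: lt_le_trans le2; apply: le_lt_trans (cM i).
    by rewrite normrM [X in _ * X]ger0_norm ?invr_ge0 // ler_piMr // invf_le1 // ler1n.
  rewrite [X in `|X|](_ : _ = - F x i); last by rewrite /place; ring.
  by rewrite normrN; apply: lt_le_trans (bF x Kx i) (le_trans MM' le2).
suff -> : (fun x i => F x i + c i) = (fun x i => (1 - -1) * (pl P (ax a0) i + c i / 2) +
    -1 * ((1 - 2) * F x i + 2 * pl P (ax a0) i)) by [].
by apply/funext => x; apply/funext => i; field.
Qed.

Lemma realizable_scale F b : realizable F -> realizable (fun x i => b * F x i).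
Proof.
move=> hF; have [->|b0] := eqVneq b 0.
  by apply: realizable_eq (cst (fun=> 0)) => x; apply/funext => i; rewrite mul0r.
have [->|b1] := eqVneq b 1.
  by apply: realizable_eq hF => x; apply/funext => i; rewrite mul1r.
have [del d0 h] := @realizable_affine R n k rho a0 rho_ge0 a0 a1 a10 _ b0 b1.
have [M M0 bF] := realizable_bounded hF; have [P P0 MP] := scale_exists M0 d0.
have hF' := realizable_new_realizable (realizable_translate (pl P (ax a0)) hF).
have hA : realizable (fun x i => (1 - b) * 0 + b * (F x i + pl P (ax a0) i)).
  apply/realizable_new_realizable/(h (fun=> fun=> 0) _ (fun=> 0) P P0 (cst _) hF') => x Kx i.
    by rewrite subrr normr0 mulr_gt0.
  by rewrite addrK -MP; apply: bF.
have := realizable_new_realizable (realizable_translate (fun i => - b * pl P (ax a0) i) hA).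
by apply: realizable_eq => x; apply/funext => i; ring.
Qed.

(** Twice the midpoint of F and of G displaced by P e_a0, minus the displacement. *)
Lemma realizable_add F G : realizable F -> realizable G -> realizable (fun x i => F x i + G x i).
Proof.
move=> hF hG; have t0 : (2^-1 : R) != 0 by rewrite invr_eq0 pnatr_eq0.
have t1 : (2^-1 : R) != 1 by rewrite lt_eqF // invf_lt1 // ltr1n.
have [del d0 h] := @realizable_affine R n k rho a0 rho_ge0 a0 a1 a10 _ t0 t1.
have [M M0 bF] := realizable_bounded hF; have [N N0 bG] := realizable_bounded hG.
have [P P0 MP] := scale_exists (addr_gt0 M0 N0) d0.
have hG' := realizable_new_realizable (realizable_translate (pl P (ax a0)) hG).
have hA : realizable (fun x i => (1 - 2^-1) * F x i + 2^-1 * (G x i + pl P (ax a0) i)).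
  apply/realizable_new_realizable/(h F _ (fun=> 0) P P0 hF hG') => x Kx i; rewrite -MP.
    by rewrite subr0; apply: lt_trans (bF x Kx i) _; rewrite ltrDl.
  by rewrite addrK; apply: lt_trans (bG x Kx i) _; rewrite ltrDr.
have := realizable_new_realizable (realizable_translate (fun i => - pl P (ax a0) i) (realizable_scale 2 hA)).
by apply: realizable_eq => x; apply/funext => i; field.
Qed.

Lemma realizable_sum (J : finType) (F : J -> ins -> vec) :
  (forall l, realizable (F l)) -> realizable (fun x i => \sum_l F l x i).
Proof.
move=> hF; elim: (index_enum J) => [|l s IH].
  by apply: realizable_eq (cst (fun=> 0)) => x; apply/funext => i; rewrite big_nil.
by apply: realizable_eq (realizable_add (hF l) IH) => x; apply/funext => i; rewrite big_cons.
Qed.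

Lemma sqnorm_comb a b w (j : 'I_n) :
  sqnorm (fun c => a * w c + b * ax j c) = a ^+ 2 * sqnorm w + 2 * a * b * w j + b ^+ 2 :> R.
Proof.
have -> : b ^+ 2 = b ^+ 2 * sqnorm (ax j : vec) by rewrite sqnorm_ax mulr1.
rewrite -[w j](sum_ax w) /sqnorm !mulr_sumr -!big_split.
by apply: eq_bigr => c _ /=; ring.
Qed.

Lemma other_axis (j : 'I_n) : exists j' : 'I_n, j' != j.
Proof. by have [->|j0] := eqVneq j a0; [exists a1|exists a0; rewrite eq_sym]. Qed.

(* Three inversions compose to a reflection of the displacement f. *)
Lemma reflection_identity (P : R) (f : vec) (j : 'I_n) c : 0 < P ->
  let w i := f i + P * ax j i in
  sqnorm w != 0 -> sqnorm (fun i => (-2 * P) * f i + P ^+ 2 * ax j i) != 0 ->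
  inversion (9 / 2 * P) (fun i => inversion P (fun i => inversion P w i - 2 * P * ax j i) i
     + 3 / 2 * P * ax j i) c = 27 * f c - 54 * (ax j c * f j) + 27 / 2 * P * ax j c.
Proof.
move=> P0 w Nn0 W0; have Pn0 : P != 0 by rewrite gt_eqF.
have fw i : f i = 1 * w i + (- P) * ax j i by rewrite /w; ring.
have axj : ax j j = 1 :> R by rewrite /ax eqxx.
set N := sqnorm w in Nn0 *; set A := w j.
(* Up to the factor P^2 / N this is the squared norm of the displaced first inverse; the second
   hypothesis says that it does not vanish. *)
pose D := 9 * P ^+ 2 - 12 * P * A + 4 * N.
have D0 : D != 0.
  move: W0; apply: contra_neq => D0.
  have -> : (fun i => (-2 * P) * f i + P ^+ 2 * ax j i) =
      fun i => (-2 * P) * w i + 3 * P ^+ 2 * ax j i.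
    by apply/funext => i; rewrite /w; ring.
  by rewrite sqnorm_comb -/N -/A; transitivity (P ^+ 2 * D); [rewrite /D; ring|rewrite D0 mulr0].
have e2 : (fun i => inversion P w i - 2 * P * ax j i) =
    fun i => (3 * P ^+ 2 / N) * w i + (- (2 * P)) * ax j i.
  by apply/funext => i; rewrite /inversion -/N; field.
have n2 : sqnorm (fun i => inversion P w i - 2 * P * ax j i) = P ^+ 2 * D / N.
  by rewrite e2 sqnorm_comb -/N -/A /D; field.
have e3 : (fun i => inversion P (fun i => inversion P w i - 2 * P * ax j i) i + 3 / 2 * P * ax j i) =
    fun i => (9 * P ^+ 2 / D) * w i + (3 / 2 * P - 6 * P * N / D) * ax j i.
  apply/funext => i; rewrite {1}/inversion n2 /inversion -/N; field.
  by rewrite D0 Nn0 Pn0.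
(* For given P this norm is a constant over D, so the third inversion clears the denominator; the
   shift 3/2 P is the one for which the remaining quadratic term N cancels. *)
have n3 : sqnorm (fun i => inversion P (fun i => inversion P w i - 2 * P * ax j i) i + 3 / 2 * P * ax j i)
    = 81 * P ^+ 4 / (4 * D).
  by rewrite e3 sqnorm_comb -/N -/A; move: D0; rewrite /D => D0; field.
have e3c := congr1 (fun h : vec => h c) e3; cbv beta in e3c.
rewrite {1}/inversion n3 e3c (fw c) (fw j) axj -/A; move: D0; rewrite /D => D0; field.
by rewrite D0 Pn0.
Qed.

Lemma realizable_proj j F : realizable F -> realizable (fun x i => ax j i * F x j).
Proof.
move=> hF; have [j' jj'] := other_axis j.
have [d3 d30 hinv] := @realizable_inv R n k rho a0 rho_ge0 j j' jj'.
have e20 : 0 < 9 / 2 * d3 by rewrite mulr_gt0 // divr_gt0.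
have [d2 d20 c2] := @inversion_continuous R n j _ e20.
have e10 : 0 < Num.min d3 d2 by rewrite lt_min d30.
have [d1 d10 c1] := @inversion_continuous R n j _ e10.
have q0 : (0 : R) < 4^-1 by rewrite invr_gt0.
have [dq dq0 hq] := @enforceable_near R n k rho a0 _ q0.
have [M M0 bF] := realizable_bounded hF.
have m0 : 0 < Num.min (Num.min d3 d1) dq by rewrite !lt_min d30 d10.
have [P P0 MP] := scale_exists M0 m0.
have l3 : M <= P * d3 by rewrite MP ler_pM2l // !ge_min lexx.
have l1 : M <= P * d1 by rewrite MP ler_pM2l // !ge_min lexx orbT.
have lq : M <= P * dq by rewrite MP ler_pM2l // !ge_min lexx orbT.
pose w x i := F x i + P * ax j i.
have hw : realizable w := realizable_new_realizable (realizable_translate _ hF).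
have wP x : inbox rho x -> forall e, M <= P * e -> close (w x) (pl P (ax j)) (P * e).
  by move=> Kx e le i; rewrite /place add0r /w addrK; apply: lt_le_trans (bF x Kx i) le.
have h1 : realizable (fun x => inversion P (w x)) by apply: hinv hw _ => // x Kx; apply: wP.
pose H2 x i := inversion P (w x) i - 2 * P * ax j i.
have hH2 : realizable H2 := realizable_new_realizable (realizable_translate (fun i => - (2 * P * ax j i)) h1).
have H2P x : inbox rho x -> forall e, Num.min d3 d2 <= e -> close (H2 x) (pl P (ax j)) (P * e).
  move=> Kx e le i; have [_ /(_ i) h] := c1 P (w x) P0 (wP x Kx d1 l1).
  apply: lt_le_trans (_ : _ < P * Num.min d3 d2) _; last by rewrite ler_pM2l.
  by apply: le_lt_trans h; rewrite le_eqVlt; apply/orP; left; apply/eqP; congr `|_|;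
    rewrite /H2 /place; ring.
have h2 : realizable (fun x => inversion P (H2 x)).
  by apply: hinv hH2 _ => // x Kx; apply: H2P; rewrite // ge_min lexx.
pose H3 x i := inversion P (H2 x) i + 3 / 2 * P * ax j i.
have hH3 : realizable H3 := realizable_new_realizable (realizable_translate (fun i => 3 / 2 * P * ax j i) h2).
have P90 : 0 < 9 / 2 * P by rewrite mulr_gt0 // divr_gt0.
have h3 : realizable (fun x => inversion (9 / 2 * P) (H3 x)).
  apply: hinv hH3 _ => // x Kx i.
  have d22 : Num.min d3 d2 <= d2 by rewrite ge_min lexx orbT.
  have [_ /(_ i) h] := c2 P (H2 x) P0 (H2P x Kx d2 d22).
  have -> : 9 / 2 * P * d3 = P * (9 / 2 * d3) by ring.
  apply: le_lt_trans h; rewrite le_eqVlt; apply/orP; left; apply/eqP; congr `|_|.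
  by rewrite /H3 /place; field.
(* The reflection identity divides by two norms. The bound |F_j| < P / 4 keeps both positive and has
   to be imposed on all configurations, not only over the box. *)
have hD : enforceable rho a0 (fun x => close (F x) (fun=> 0) (P * 4^-1)).
  apply: hq => // x Kx i; rewrite subr0; exact: lt_le_trans (bF x Kx i) lq.
have hR : realizable (fun x i => 27 * F x i - 54 * (ax j i * F x j) + 27 / 2 * P * ax j i).
  apply: (realizable_congr hD h3) => x Dx; apply/funext => i.
  have := Dx j; rewrite subr0 ltr_norml => /andP[Fj1 Fj2].
  apply: reflection_identity => //; apply: lt0r_neq0.
    apply: (@lt_le_trans _ _ ((F x j + P * ax j j) ^+ 2)).
      rewrite /ax eqxx /= mulr1 exprn_gt0 //; lra.
    by rewrite /sqnorm (bigD1 j) //= lerDl sumr_ge0 // => c _; apply: sqr_ge0.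
  apply: (@lt_le_trans _ _ ((-2 * P * F x j + P ^+ 2 * ax j j) ^+ 2)).
    rewrite /ax eqxx /= mulr1 exprn_gt0 //; nra.
  by rewrite /sqnorm (bigD1 j) //= lerDl sumr_ge0 // => c _; apply: sqr_ge0.
have := realizable_new_realizable (realizable_translate (fun i => 4^-1 * P * ax j i)
  (realizable_add (realizable_scale (- 54^-1) hR) (realizable_scale 2^-1 hF))).
by apply: realizable_eq => x; apply/funext => i; field.
Qed.

Definition axis_realizable j s := realizable (fun x i => s x * ax j i).

Lemma axis_realizable_eq j s t : (forall x, s x = t x) -> axis_realizable j s -> axis_realizable j t.
Proof. by move=> e; have -> : t = s by apply/funext => x; rewrite e. Qed.

Lemma axis_realizable_add j s t : axis_realizable j s -> axis_realizable j t -> axis_realizable j (fun x => s x + t x).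
Proof.
move=> hs ht; apply: realizable_eq (realizable_add hs ht) => x; apply/funext => i; by rewrite mulrDl.
Qed.

Lemma axis_realizable_scale j s b : axis_realizable j s -> axis_realizable j (fun x => b * s x).
Proof. by move/(realizable_scale b); apply: realizable_eq => x; apply/funext => i; rewrite mulrA. Qed.

Lemma axis_realizable_const j b : axis_realizable j (fun=> b).
Proof. exact: cst. Qed.

Lemma axis_realizable_sub j s t : axis_realizable j s -> axis_realizable j t -> axis_realizable j (fun x => s x - t x).
Proof.
move=> hs /(axis_realizable_scale (-1)) ht; apply: axis_realizable_eq (axis_realizable_add hs ht) => x.
by rewrite mulN1r.
Qed.

Lemma axis_realizable_sqr i j s : i != j -> axis_realizable i s -> axis_realizable j (fun x => s x ^+ 2).
Proof.
move=> ij hs; have [d3 d30 hinv] := @realizable_inv R n k rho a0 rho_ge0 j i ij.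
have d330 : 0 < 3 * d3 by rewrite mulr_gt0.
have [d1 d10 c1] := @inversion_continuous R n j _ d330.
have [M M0 bs] := realizable_bounded hs.
have m0 : 0 < Num.min d3 d1 by rewrite lt_min d30.
have [P P0 MP] := scale_exists M0 m0.
have l3 : M <= P * d3 by rewrite MP ler_pM2l // ge_min lexx.
have l1 : M <= P * d1 by rewrite MP ler_pM2l // ge_min lexx orbT.
pose w x c := s x * ax i c + P * ax j c.
have hw : realizable w := realizable_new_realizable (realizable_translate _ hs).
have wP x : inbox rho x -> forall e, M <= P * e -> close (w x) (pl P (ax j)) (P * e).
  by move=> Kx e le c; rewrite /place add0r /w addrK; apply: lt_le_trans (bs x Kx c) le.
have h1 : realizable (fun x => inversion P (w x)) by apply: hinv hw _ => // x Kx; apply: wP.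
have nw x : sqnorm (w x) = s x ^+ 2 + P ^+ 2 by rewrite /sqnorm sum_ax2_sqr.
have nw0 x : 0 < s x ^+ 2 + P ^+ 2 by rewrite ltr_wpDl ?sqr_ge0 // exprn_gt0.
have h2 := realizable_proj j h1.
(* As s e_i + P e_j has squared norm s^2 + P^2, this is the j-th coordinate of its inverse;
   inverting [v] e_j at scale 3 P gives 9 (s^2 + P^2) / P. *)
pose v x := 3 * P ^+ 3 / (s x ^+ 2 + P ^+ 2).
have wj x : inversion P (w x) j = v x.
  by rewrite /inversion nw /w /ax eqxx eq_sym (negbTE ij) /v /=; field; rewrite gt_eqF.
have P30 : 0 < 3 * P by rewrite mulr_gt0.
have hv : realizable (fun x c => v x * ax j c).
  by apply: realizable_eq h2 => x; apply/funext => c; rewrite wj mulrC.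
have h3 : realizable (fun x => inversion (3 * P) (fun c => v x * ax j c)).
  apply: hinv hv _ => // x Kx c; have [_ /(_ j) h] := c1 P (w x) P0 (wP x Kx d1 l1).
  rewrite /place add0r -mulrBl normrM.
  have -> : 3 * P * d3 = P * (3 * d3) by ring.
  apply: le_lt_trans h; rewrite wj /place add0r [ax j j]/ax eqxx /= mulr1 [P * 3]mulrC.
  by rewrite ler_piMr // /ax; case: (c == j); rewrite ?normr1 ?normr0.
have := realizable_new_realizable (realizable_translate (fun c => - P ^+ 2 * ax j c) (realizable_scale (P / 9) h3)).
apply: realizable_eq => x; apply/funext => c; rewrite /inversion sqnorm_scale sqnorm_ax /v; field.
by rewrite !gt_eqF.
Qed.

(** Squaring moves a scalar to another axis, and 4 s = (s + 1)^2 - (s - 1)^2 undoes the squaring. *)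
Lemma axis_realizable_transfer i j s : axis_realizable i s -> axis_realizable j s.
Proof.
have [->//|ij] := eqVneq i j => hs.
have h1 := axis_realizable_sqr ij (axis_realizable_add hs (axis_realizable_const i 1)).
have h2 := axis_realizable_sqr ij (axis_realizable_sub hs (axis_realizable_const i 1)).
by apply: axis_realizable_eq (axis_realizable_scale 4^-1 (axis_realizable_sub h1 h2)) => x; field.
Qed.

(** Squaring changes the axis, so the sum and the difference are first moved to another axis. *)
Lemma axis_realizable_mul j s t : axis_realizable j s -> axis_realizable j t -> axis_realizable j (fun x => s x * t x).
Proof.
move=> hs ht; have [i ij] := other_axis j.
have h1 := axis_realizable_sqr ij (axis_realizable_transfer i (axis_realizable_add hs ht)).
have h2 := axis_realizable_sqr ij (axis_realizable_transfer i (axis_realizable_sub hs ht)).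
by apply: axis_realizable_eq (axis_realizable_scale 4^-1 (axis_realizable_sub h1 h2)) => x; field.
Qed.

Lemma axis_realizable_poly j (p : ins -> R) : is_poly p -> axis_realizable j p.
Proof.
elim=> [c|[l i]|p1 p2 _ h1 _ h2|p1 p2 _ h1 _ h2].
- exact: axis_realizable_const.
- have hl := realizable_proj i (@realizable_input R n k rho a0 l).
  apply: (@axis_realizable_transfer i); apply: realizable_eq hl => x.
  by apply/funext => c; rewrite mulrC.
- exact: axis_realizable_add.
exact: axis_realizable_mul.
Qed.

Lemma realizable_poly (F : ins -> vec) : (forall c, is_poly (fun x => F x c)) -> realizable_new F.
Proof.
move=> pF; have h : realizable F.
  have hs := @realizable_sum 'I_n (fun l x c => F x l * ax l c) (fun c => axis_realizable_poly c (pF c)).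
  apply: realizable_eq hs => x; apply/funext => i.
  rewrite (bigD1 i) //= /ax eqxx mulr1 big1 ?addr0 // => c /negbTE.
  by rewrite eq_sym => ->; rewrite mulr0.
(* Translation by zero copies the result to a fresh vertex, as needed for outputs distinct from the
   inputs and from each other. *)
have := realizable_translate (fun=> 0) h; congr realizable_new.
by apply/funext => x; apply/funext => i; rewrite addr0.
Qed.

End Arithmetic.

(** * Topology and boundedness in coordinates *)

Section Topology.
Context {R : realType}.

Lemma near_box_nbhs (I : finType) (x : I -> R) (P : (I -> R) -> Prop) :
  near_box x P -> \forall y \near (x : {ptws I -> R}), P y.
Proof.
move=> [r r0 hP].
have box : nbhs (x : {ptws I -> R}) [set y : {ptws I -> R} | forall i, `|y i - x i| < r].
  apply: (@filter_forall _ I (fun i (y : {ptws I -> R}) => `|y i - x i| < r) _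
    (nbhs_filter (x : {ptws I -> R}))) => i.
  have /cvgrPdist_lt/(_ r r0) : (fun y : {ptws I -> R} => y i) @ (x : {ptws I -> R}) --> x i.
    exact: (@proj_continuous I (fun=> R) i x).
  by apply: filterS => y; rewrite distrC.
exact: (@filterS _ _ (nbhs_filter (x : {ptws I -> R}))
  [set y : {ptws I -> R} | forall i, `|y i - x i| < r] [set y : {ptws I -> R} | P y] hP box).
Qed.

Lemma near_box_open (I : finType) (U : set (I -> R)) :
  (forall x, U x -> near_box x U) -> open (U : set {ptws I -> R}).
Proof. by move=> h; rewrite openE => x /h /near_box_nbhs. Qed.

Lemma within_continuous (I J : finType) (A : set (I -> R)) (g : (I -> R) -> (J -> R)) :
  (forall x, A x -> forall j e, 0 < e -> near_box x (fun y => A y -> `|g y j - g x j| < e)) ->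
  {within (A : set {ptws I -> R}), continuous (g : {ptws I -> R} -> {ptws J -> R})}.
Proof.
move=> h; apply/subspace_continuousP => x Ax.
apply/cvg_sup => j B /= [_ [[C oC <-] Cx sCB]].
have nC : nbhs (g x j) C by apply: open_nbhs_nbhs.
have FF : Filter (within A (nbhs (x : {ptws I -> R}))).
  exact: within_filter (nbhs_filter (x : {ptws I -> R})).
have cv : (fun y : {ptws I -> R} => g y j) @ within A (nbhs (x : {ptws I -> R})) --> g x j.
  apply/cvgrPdist_lt => e e0; have /near_box_nbhs := h x Ax j e e0.
  rewrite ?near_map near_withinE.
  apply: (@filterS _ _ (nbhs_filter (x : {ptws I -> R}))) => y hy /hy.
  by rewrite distrC.
have := cv _ nC; apply: (@filterS _ _ FF) => y Cy; exact: sCB.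
Qed.

(** Compactness of K enters through the box that it provides; all constructions are made for the
    box. *)
Lemma compact_coord_bounded (I : finType) (K : set (I -> R)) :
  compact (K : set {ptws I -> R}) ->
  exists2 rho, 0 <= rho & forall x, K x -> forall i, `|x i| <= rho.
Proof.
move=> cK; have bd i : exists2 M, 0 <= M & forall x, K x -> `|x i| <= M.
  have ci : {within (K : set {ptws I -> R}), continuous (fun x : {ptws I -> R} => x i)}.
    by apply: continuous_subspaceT => x; exact: (@proj_continuous I (fun=> R) i x).
  have [M [_ hM]] := compact_bounded (continuous_compact ci cK).
  exists (`|M| + 1) => [|x Kx]; first by rewrite addr_ge0.
  by apply: (hM (`|M| + 1)); [rewrite ltr_pwDr // ler_norm|exists x].
have [M hM] := choice (fun i => let: ex_intro2 M M0 h := bd i in ex_intro _ M (conj M0 h)).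
exists (\sum_i M i); first by apply: sumr_ge0 => i _; case: (hM i).
move=> x Kx i; apply: le_trans ((hM i).2 x Kx) _.
by rewrite (bigD1 i) //= lerDl sumr_ge0 // => j _; case: (hM j).
Qed.

Lemma restr_analytic_intro (I J : finType) (A U : set (I -> R)) (G g : (I -> R) -> (J -> R)) :
  (forall x, U x -> near_box x U) -> (forall x, U x -> forall j, ana (fun y => G y j) x) ->
  A `<=` U -> (forall x, A x -> G x = g x) ->
  restr_analytic A g /\
  {within (A : set {ptws I -> R}), continuous (g : {ptws I -> R} -> {ptws J -> R})}.
Proof.
move=> oU aG AU Gg; split.
  exists U, G; split=> //; split; first exact: near_box_open.
  by move=> x Ux j; apply: ana_analytic_at; apply: aG.
apply: within_continuous => x Ax j e e0.
apply: near_boxW (ana_cont (aG x (AU x Ax) j) e0) => y h Ay.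
by rewrite -!Gg.
Qed.

Lemma edist_d2 n (x y : 'I_n -> R) (l : R) : 0 < l ->
  (Defs.edist x y <= l) = (d2 x y <= l ^+ 2) /\ (Defs.edist x y = l <-> d2 x y = l ^+ 2).
Proof.
move=> l0; have d0 := d2_ge0 x y; have -> : Defs.edist x y = Num.sqrt (d2 x y) by [].
have ll : l = Num.sqrt (l ^+ 2) by rewrite sqrtr_sqr gtr0_norm.
split; first by rewrite {1}ll ler_sqrt // sqr_ge0.
by split=> [<-|->]; rewrite ?sqr_sqrtr // -ll.
Qed.

End Topology.

(** * Linkages from labelled vertices and pairs *)

Section Builder.
Context {R : realType} {n : nat} {V : finType}.
Variables (fx : V -> option ('I_n -> R)) (lk : V -> V -> option (R * bool)).
Hypothesis lk_asym : forall v w, lk v w -> lk w v = None.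
Hypothesis lk_pos : forall v w p, lk v w = Some p -> 0 < p.1.

(** [lk] labels ordered pairs while edges are unordered; [lk_asym] excludes loops and doubly
    labelled pairs, which makes the label found by [info] independent of the pick. *)
Let joined (e : {set V}) (vw : V * V) := lk vw.1 vw.2 && (e == [set vw.1; vw.2]%SET).
Let info e : R * bool :=
  if [pick vw | joined e vw] is Some vw then odflt (1, false) (lk vw.1 vw.2) else (1, false).
Let mkedges := [set e | [exists vw, joined e vw]]%SET.
Let mkflex := [set e in mkedges | (info e).2]%SET.

Lemma mk_edges2 e : e \in mkedges -> #|e| = 2%N.
Proof.
rewrite inE => /existsP[[v w] /andP[/= l /eqP ->]]; rewrite cards2.
by case: eqP l => // -> l; move: (l); rewrite (lk_asym l).
Qed.

Let info_lk v w p : lk v w = Some p -> info [set v; w]%SET = p.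
Proof.
move=> e; rewrite /info; case: pickP => [[v' w']|/(_ (v, w))]; last by rewrite /joined /= e eqxx.
rewrite /joined /= => /andP[l /eqP E].
have l1 : lk v w by rewrite e.
have vw : v != w by apply/eqP => vw; move: l1; rewrite -vw => l1; move: (l1); rewrite (lk_asym l1).
have vw' : v' != w' by apply/eqP => vw0; move: l; rewrite -vw0 => l; move: (l); rewrite (lk_asym l).
have : v' \in [set v; w]%SET by rewrite E !inE eqxx.
have : w' \in [set v; w]%SET by rewrite E !inE eqxx orbT.
rewrite !inE => /orP[]/eqP w'E /orP[]/eqP v'E; subst v' w'; rewrite ?eqxx // in vw'.
  by move: l; rewrite (lk_asym l1).
by rewrite e.
Qed.

Lemma mk_len_pos e : e \in mkedges -> 0 < (info e).1.
Proof.
rewrite inE => /existsP[[v w] /andP[/= l /eqP ->]].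
by case E: (lk v w) l => [p|//] _; rewrite (info_lk E); apply: lk_pos E.
Qed.

Lemma mk_flex_sub : mkflex \subset mkedges.
Proof. by apply/fintype.subsetP => e; rewrite inE => /andP[]. Qed.

Definition mk_linkage : @linkage R n :=
  @Linkage R n V mkedges mk_edges2 (fun e => (info e).1) mk_len_pos
    [set v | isSome (fx v)]%SET (fun v => odflt (fun=> 0) (fx v)) mkflex mk_flex_sub.

Lemma mk_configP (phi : V * 'I_n -> R) : config mk_linkage phi <->
  (forall v p, fx v = Some p -> vpos phi v = p) /\
  (forall v w l b, lk v w = Some (l, b) ->
     if b return Prop then d2 (vpos phi v) (vpos phi w) <= l ^+ 2
     else d2 (vpos phi v) (vpos phi w) = l ^+ 2).
Proof.
have mem v w p : lk v w = Some p -> [set v; w]%SET \in mkedges.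
  by move=> e; rewrite inE; apply/existsP; exists (v, w); rewrite /joined /= e eqxx.
have both v w e : e \in mkedges -> e = [set v; w]%SET -> exists v' w' p,
    [/\ lk v' w' = Some p, e = [set v'; w']%SET &
      d2 (vpos phi v') (vpos phi w') = d2 (vpos phi v) (vpos phi w)].
  rewrite inE => /existsP[[v' w'] /andP[/= l /eqP ->]] E.
  case E' : (lk v' w') l => [p|//] _; exists v', w', p; split=> //.
  have vw' : v' != w'.
    apply/eqP => vw0; have l : lk v' w' by rewrite E'.
    by move: l; rewrite -vw0 => l; move: (l); rewrite (lk_asym l).
  have : v' \in [set v; w]%SET by rewrite -E !inE eqxx.
  have : w' \in [set v; w]%SET by rewrite -E !inE eqxx orbT.
  rewrite !inE => /orP[]/eqP w'E /orP[]/eqP v'E; subst v' w'; rewrite ?eqxx // in vw' *.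
  by rewrite d2C.
split=> [[h1 [h2 h3]]|[h1 h2]].
  split=> [v p e|v w l b e].
    by rewrite h1 /= ?e // inE e.
  have lp := lk_pos e; have ie := info_lk e; have me := mem _ _ _ e.
  case: b e lp ie => e /= lp ie.
    have fe : [set v; w]%SET \in mkflex by rewrite inE me ie.
    by have := h2 _ fe v w erefl; rewrite /= ie (edist_d2 _ _ lp).1.
  have fe : [set v; w]%SET \notin mkflex by rewrite inE me ie.
  by have := h3 _ me fe v w erefl; rewrite /= ie => /(edist_d2 _ _ lp).2.
split; first by move=> v; rewrite inE /=; case E: (fx v) => [p|//] _; apply: h1.
split=> [e|e].
  rewrite inE => /andP[me ie] v w E; have [v' [w' [[l b] [El Ee Ed]]]] := both v w e me E.
  move: ie; rewrite Ee (info_lk El) /= => b1.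
  by rewrite /= (info_lk El) (edist_d2 _ _ (lk_pos El)).1 -Ed; have := h2 _ _ _ _ El; rewrite b1.
move=> me; rewrite inE me /= => ie v w E; have [v' [w' [[l b] [El Ee Ed]]]] := both v w e me E.
move: ie; rewrite Ee (info_lk El) /= => b0.
apply/(edist_d2 _ _ (lk_pos El)).2; rewrite -Ed.
by have := h2 _ _ _ _ El; rewrite (negbTE b0).
Qed.

Lemma mk_classical : (forall v w p, lk v w = Some p -> p.2 = false) -> classical mk_linkage.
Proof.
move=> h; apply/setP => e; rewrite inE finset.in_set0; apply/negP => /andP[].
rewrite inE => /existsP[[v w] /andP[/= l /eqP ->]].
by case E: (lk v w) l => [p|//] _; rewrite (info_lk E) (h _ _ _ E).
Qed.

End Builder.

(** * The cabled linkage of a system *)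

Section SystemLinkage.
Context {R : realType} {n : nat}.
Notation vec := ('I_n -> R).
Variables (k : nat) (rho : R) (a0 : 'I_n).
Hypothesis rho_ge0 : 0 <= rho.
Notation ins := ('I_k * 'I_n -> R).

Lemma realizable_family (m : nat) (F : 'I_m -> ins -> vec) S :
  (forall l, realizable_new rho a0 (F l)) -> good k rho a0 S ->
  exists S', [/\ good k rho a0 S', ext S S' & exists io : 'I_m -> nat,
    [/\ injective io, forall l, (size S <= io l < size S')%N &
      forall l phi, cfg S' phi -> phi (io l) = F l (inp phi)]].
Proof.
move=> hF gS.
suff [S' [gS' eS' [io [i1 i2 i3]]]] : exists S', [/\ good k rho a0 S', ext S S' &
   exists io : 'I_m -> nat, [/\ {in enum 'I_m &, injective io},
    forall l, l \in enum 'I_m -> (size S <= io l < size S')%N &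
    forall l, l \in enum 'I_m -> forall phi, cfg S' phi -> phi (io l) = F l (inp phi)]].
  exists S'; split=> //; exists io; split=> [l l'|l|l].
  - by apply: i1; rewrite mem_enum.
  - by apply: i2; rewrite mem_enum.
  - by apply: i3; rewrite mem_enum.
elim: (enum 'I_m) => [|j s [S' [gS' eS' [io [i1 i2 i3]]]]].
  by exists S; split=> //; [exact: ext_refl|exists (fun=> 0%N)].
have [S'' [gS'' eS'' [i /andP[i4 i5] i6]]] := hF j S' gS'.
have sS := ext_size eS'; have sS' := ext_size eS''.
exists S''; split=> //; first exact: ext_trans eS''.
exists (fun l => if l == j then i else io l); split=> [l l'|l|l]; rewrite !inE.
- have lt l0 : l0 \in s -> (io l0 < i)%N.
    by move=> /i2 /andP[_ h]; apply: leq_trans i4.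
  case: (eqVneq l j) => [->|_] /= hl; case: (eqVneq l' j) => [->|_] //= hl'.
  + by move=> e; have := lt _ hl'; rewrite -e ltnn.
  + by move=> e; have := lt _ hl; rewrite e ltnn.
  exact: i1.
- case: eqP => [_ _|_ /= /i2 /andP[-> h]]; first by rewrite (leq_trans sS i4).
  exact: leq_trans sS'.
case: eqP => [-> _|_ /= ls] phi cphi; first exact: i6.
by apply: i3 => //; apply: ext_cfg cphi.
Qed.

Definition step_fixed (s : @step R n) : option vec :=
  match s with Fixed p => Some p | Cable p _ _ => Some p | _ => None end.
Definition step_cable (s : @step R n) : option (vec * nat * R) :=
  if s is Cable p x l then Some (p, x, l) else None.
Definition step_bar (s : @step R n) (w : nat) : option R :=
  if s is Bars nb then omap snd (ohead [seq y <- nb | y.1 == w]) else None.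

Lemma step_barP nb w l : uniq (map fst nb) ->
  step_bar (Bars nb) w = Some l <-> (w, l) \in nb.
Proof.
rewrite /step_bar; elim: nb => [|[v r] nb IH] //= /andP[vnb unb].
rewrite inE; have [vw|vw] := eqVneq v w.
  split=> [[<-]|/orP[/eqP[_ ->] //|wl]]; first by rewrite vw eqxx.
  by move: vnb; rewrite vw (map_f fst wl).
split=> [/(IH unb).1 ->|]; first by rewrite orbT.
by case/orP => [/eqP[e _]|/(IH unb).2 //]; rewrite e eqxx in vw.
Qed.

Lemma step_bar_lt i s w l : wf_step i s -> step_bar s w = Some l -> (w < i)%N /\ 0 < l.
Proof.
case: s => // nb [unb h] /(step_barP _ _ unb) /h; by [].
Qed.

(** Links point from a later vertex to an earlier one, which gives the asymmetry needed for
    unordered edges. *)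
Definition link_S (S : seq (@step R n)) (v w : nat) : option (R * bool) :=
  if step_cable (nth Free S v) is Some (_, x, l) then
    if x == w then Some (l, true) else None
  else omap (fun l => (l, false)) (step_bar (nth Free S v) w).

Lemma link_S_lt S (v w : nat) p : wf S -> (v < size S)%N ->
  link_S S v w = Some p -> (w < v)%N /\ 0 < p.1.
Proof.
move=> wS vS; have := wS v vS; rewrite /link_S.
case: (nth Free S v) => [|p0|p0 x l|nb] //=.
  by case=> xv l0; case: eqP => // <- [<-].
move=> wnb; rewrite -/(step_bar (Bars nb) w).
by case E: (step_bar (Bars nb) w) => [l|//] [<-]; exact: (step_bar_lt (s := Bars nb) wnb E).
Qed.

Variable S : seq (@step R n).
Hypothesis gS : good k rho a0 S.
Let N := size S.

Lemma good_wf : wf S. Proof. by case: gS. Qed.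
Lemma good_size : (k <= N)%N. Proof. by case: gS. Qed.

Definition posn (phi : 'I_N * 'I_n -> R) (i : nat) : vec :=
  fun c => if insub i is Some v then phi (v : 'I_N, c) else 0.

Lemma posnE phi (v : 'I_N) : posn phi v = vpos phi v.
Proof. by apply/funext => c; rewrite /posn valK. Qed.

Let fxS (v : 'I_N) := step_fixed (nth Free S v).
Let lkS (v w : 'I_N) := link_S S v w.

Lemma lkS_asym (v w : 'I_N) : lkS v w -> lkS w v = None.
Proof.
rewrite /lkS; case E: (link_S S v w) => [p|//] _; have [wv _] := link_S_lt good_wf (ltn_ord v) E.
case E': (link_S S w v) => [p'|//]; have [vw _] := link_S_lt good_wf (ltn_ord w) E'.
by have := ltn_trans wv vw; rewrite ltnn.
Qed.

Lemma lkS_pos (v w : 'I_N) p : lkS v w = Some p -> 0 < p.1.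
Proof. by move=> /(link_S_lt good_wf (ltn_ord v))[]. Qed.

Definition cabled_linkage := mk_linkage fxS lkS_asym lkS_pos.

Lemma cabled_configP phi : config cabled_linkage phi <-> cfg S (posn phi).
Proof.
split=> [/mk_configP[h1 h2]|h].
  suff hv (v : 'I_N) : sat (posn phi) v (nth Free S v) by move=> i iN; exact: (hv (Ordinal iN)).
  have := good_wf (ltn_ord v); have := h1 v; have := h2 v; rewrite /fxS /lkS /link_S.
  case: (nth Free S v) => [|p|p x l|nb] //=; rewrite ?posnE.
  - by move=> _ /(_ _ erefl) ->.
  - move=> h3 /(_ _ erefl) h4 [xv l0]; split=> //.
    have xN : (x < N)%N := ltn_trans xv (ltn_ord v).
    have := h3 (Ordinal xN) l true; rewrite /= eqxx => /(_ erefl).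
    by rewrite h4 -(posnE phi (Ordinal xN)).
  move=> h3 _ [unb hnb] [w r] wnb /=; have [wv r0] := hnb _ wnb.
  have wN : (w < N)%N := ltn_trans wv (ltn_ord v).
  have := h3 (Ordinal wN) r false; rewrite -(posnE phi (Ordinal wN)); apply => /=.
  by have /= -> := (step_barP w r unb).2 wnb.
apply/mk_configP; split=> [v p|v w l b].
  have := h v (ltn_ord v); rewrite /fxS -posnE.
  by case: (nth Free S v) => [|p0|p0 x l|nb] //= => [-> [] //|[-> _] []].
have := h v (ltn_ord v); have := good_wf (ltn_ord v); rewrite /lkS /link_S -!posnE.
case: (nth Free S v) => [|p0|p0 x r|nb] //=.
  by move=> _ [-> h2]; case: eqP => // <- [<- <-].
move=> [unb hnb] h2; rewrite -/(step_bar (Bars nb) w).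
case E: (step_bar (Bars nb) w) => [r|//] [<- <-].
exact: (h2 (nat_of_ord w, r) ((step_barP w r unb).1 E)).
Qed.

Definition in_vertex (l : 'I_k) : 'I_N := widen_ord good_size l.

Lemma vmap_inp phi : vmap in_vertex phi = inp (posn phi).
Proof.
by apply/funext => -[l c]; rewrite /vmap /inp -[nat_of_ord _]/(nat_of_ord (in_vertex l)) posnE.
Qed.

(** The inverse of the input map is [g] read on the vertices: it is analytic on the open set U,
    which contains the inputs of all configurations and not only the box. *)
Lemma cabled_strongly_functional (m : nat) (f : ins -> ('I_m * 'I_n -> R)) (K : set ins)
    (out : 'I_m -> 'I_N) :
  (forall x, K x -> inbox rho x) ->
  (forall l phi, cfg S phi -> phi (out l) = fun c => f (inp phi) (l, c)) ->
  @strongly_functional R n k m cabled_linkage f in_vertex out K.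
Proof.
move=> KI hout; have [_ _ [U [g [M [[oU aU] hU KU _ _]]]]] := gS.
pose h (x : ins) (vc : 'I_N * 'I_n) := g x vc.1 vc.2.
have hK phi : config cabled_linkage phi -> U (inp (posn phi)) /\ h (inp (posn phi)) = phi.
  move=> /cabled_configP /hU[Up e]; split=> //; apply/funext => -[v c].
  by rewrite /h -e //= posnE.
have hpos x : inbox rho x -> config cabled_linkage (h x) /\ inp (posn (h x)) = x.
  move=> /KU[cx ix].
  have e i : (i < N)%N -> g x i = posn (h x) i.
    by move=> iN; rewrite -[i]/(nat_of_ord (Ordinal iN)) posnE.
  split; first by apply/cabled_configP; apply: (cfg_eq good_wf e).
  rewrite -[RHS]ix; apply/funext => -[l c]; rewrite /inp /= -e //.
  exact: leq_trans good_size.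
split.
- move=> phi cphi; apply/funext => -[l c]; rewrite vmap_inp /vmap /=.
  by have /cabled_configP/(hout l) := cphi; rewrite posnE => /(congr1 (fun u => u c)).
- have img y : [set vmap in_vertex phi | phi in config cabled_linkage] y ->
      U y /\ (config cabled_linkage (h y) /\ vmap in_vertex (h y) = y).
    move=> [phi cphi <-]; have [Up hp] := hK _ cphi.
    by rewrite !vmap_inp hp.
  exists h; split; last split; last split; last split.
  + split=> [phi cphi|y /img[_ []] //|phi /hK[_]|y /img[_ []] //]; first by exists phi.
    by rewrite vmap_inp.
  + apply: (restr_analytic_intro (U := setT) (G := vmap in_vertex) _ _ _ _).2 => //.
      by move=> x _; exists 1.
    by move=> x _ j; apply: ana_coord.
  + apply: (restr_analytic_intro (U := U) (G := h) _ _ _ _).2 => //.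
      by move=> x Ux [v c]; apply: aU.
    by move=> y /img[].
  + apply: (restr_analytic_intro (U := setT) (G := vmap in_vertex) _ _ _ _).1 => //.
      by move=> x _; exists 1.
    by move=> x _ j; apply: ana_coord.
  apply: (restr_analytic_intro (U := U) (G := h) _ _ _ _).1 => //.
    by move=> x Ux [v c]; apply: aU.
  by move=> y /img[].
by move=> x /KI /hpos[c e]; exists (h x) => //; rewrite vmap_inp.
Qed.

End SystemLinkage.

(** * Functions independent of an extra coordinate *)

Section Pullback.
Context {R : realType} {I : finType}.

(** Words using the extra letter [None] get coefficient zero. In this way functions analytic in the
    inputs stay analytic on the product with a finite set, whose labels are carried by the extra
    coordinate. *)
Lemma wsum_Some d (F : seq I -> R) :
  wsum d (fun w : seq (option I) => if all isSome w then F (pmap id w) else 0) = wsum d F.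
Proof.
elim: d F => [|d IH] F //=.
rewrite (bigD1 None) //= wsum0 add0r (reindex_omap Some id) => [|[i|]] //=.
rewrite (eq_bigl xpredT) => [|i]; last by rewrite eqxx.
by apply: eq_bigr => i _; rewrite -[RHS](IH (fun w => F (i :: w))).
Qed.

Lemma hform_Some d (H : (I -> R) -> R) nu : hform d H nu ->
  hform d (fun z : option I -> R => H (fun i => z (Some i))) nu.
Proof.
case=> ga hH bg; exists (fun w => if all isSome w then ga (pmap id w) else 0) => [z|].
  rewrite hH -[LHS]wsum_Some; apply: eq_wsum => w _; case: ifP => [aw|]; last by rewrite mul0r.
  congr (_ * _); elim: w aw => [|[i|] w IH] //=; first by rewrite /wmon !big_nil.
  by move=> aw; rewrite /wmon !big_cons -!/(wmon _ _) IH.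
apply: le_trans bg; rewrite -[leRHS]wsum_Some le_eqVlt; apply/orP; left; apply/eqP.
by apply: eq_wsum => w _; case: ifP => // _; rewrite normr0.
Qed.

Lemma ana_Some (f : (I -> R) -> R) (z : option I -> R) :
  ana f (fun i => z (Some i)) -> ana (fun y : option I -> R => f (fun i => y (Some i))) z.
Proof.
move=> [H [A [rho [A0 r0 Hd Hr]]]].
exists (fun d z => H d (fun i => z (Some i))), A, rho; split=> // [d|N y t t0 tr yt].
  exact: hform_Some.
exact: (Hr N (fun i => y (Some i)) t t0 tr (fun i => yt (Some i))).
Qed.

Lemma near_box_Some (P : (I -> R) -> Prop) (z : option I -> R) :
  near_box (fun i => z (Some i)) P ->
  near_box z (fun y => P (fun i => y (Some i))).
Proof. by move=> [r r0 h]; exists r => // y yz; apply: h => i; apply: yz. Qed.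

End Pullback.

(** * Elbows in place of cables *)

Section Elbow.
Context {R : realType} {n : nat}.
Notation vec := ('I_n -> R).
Variables (a0 a1 : 'I_n).
Hypothesis a10 : a1 != a0.

(* Replaces a cable of length l = 4 eta anchored at p: e runs on the circle of radius eta
   around p in the (a0, a1)-plane and is joined to x by a bar of length 3 eta. *)
Definition elbow (p : vec) (eta : R) (x e : vec) :=
  [/\ d2 e p = eta ^+ 2, d2 e x = (3 * eta) ^+ 2 &
    forall r, r != a0 -> r != a1 -> d2 e (fun c => p c + eta * ax r c) = 2 * eta ^+ 2].

(** The signed area spanned by e - p and x - p in the (a0, a1)-plane; its sign tells the two
    positions of an elbow apart. *)
Definition cross (p x e : vec) : R :=
  (e a0 - p a0) * (x a1 - p a1) - (e a1 - p a1) * (x a0 - p a0).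

Lemma d2_ax (e p : vec) eta r :
  d2 e (fun c => p c + eta * ax r c) = d2 e p - 2 * eta * (e r - p r) + eta ^+ 2.
Proof.
have -> : eta ^+ 2 = eta ^+ 2 * sqnorm (ax r : vec) by rewrite sqnorm_ax mulr1.
rewrite -(sum_ax (fun c => e c - p c) r) /sqnorm /d2 !mulr_sumr -sumrB -big_split.
by apply: eq_bigr => c _ /=; ring.
Qed.

Lemma sum_plane (f : 'I_n -> R) : (forall r, r != a0 -> r != a1 -> f r = 0) ->
  \sum_c f c = f a0 + f a1.
Proof.
move=> h; rewrite (bigD1 a0) //= (bigD1 a1) //= big1 ?addr0 // => c /andP[c0 c1].
exact: h.
Qed.

Lemma elbow_plane p eta x e : 0 < eta -> elbow p eta x e ->
  forall r, r != a0 -> r != a1 -> e r = p r.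
Proof.
move=> e0 [h1 _ h] r r0 r1; have := h r r0 r1; rewrite d2_ax h1 => h2.
have : eta * (e r - p r) = 0 by lra.
by move/eqP; rewrite mulf_eq0 (gt_eqF e0) /= subr_eq0 => /eqP.
Qed.

Lemma elbow_equations p eta x e : 0 < eta -> elbow p eta x e ->
  (e a0 - p a0) ^+ 2 + (e a1 - p a1) ^+ 2 = eta ^+ 2 /\
  (e a0 - p a0) * (x a0 - p a0) + (e a1 - p a1) * (x a1 - p a1) = (d2 x p - 8 * eta ^+ 2) / 2.
Proof.
move=> e0 he; have pl := elbow_plane e0 he; case: he => h1 h2 _; split.
  rewrite -h1 /d2 sum_plane // => r r0 r1; by rewrite pl // subrr expr0n.
have h3 : d2 e x = d2 x p - 2 * (\sum_c (e c - p c) * (x c - p c)) + d2 e p.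
  rewrite mulr_sumr /d2 -sumrB -big_split; apply: eq_bigr => c _ /=; ring.
rewrite sum_plane in h3; last by move=> r r0 r1; rewrite pl // subrr mul0r.
move: h3; rewrite h1 h2 => h3; lra.
Qed.

(** By Lagrange's identity the square is determined by |e - p|, by the projection of x - p to the
    plane and by their scalar product, all of which are the same for both elbows. *)
Lemma elbow_cross_sqr p eta x e e' : 0 < eta -> elbow p eta x e -> elbow p eta x e' ->
  cross p x e ^+ 2 = cross p x e' ^+ 2.
Proof.
move=> e0 he he'; have [q1 q2] := elbow_equations e0 he; have [q1' q2'] := elbow_equations e0 he'.
have i1 d : cross p x d ^+ 2 = ((d a0 - p a0) ^+ 2 + (d a1 - p a1) ^+ 2) *
    ((x a0 - p a0) ^+ 2 + (x a1 - p a1) ^+ 2) -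
    ((d a0 - p a0) * (x a0 - p a0) + (d a1 - p a1) * (x a1 - p a1)) ^+ 2.
  by rewrite /cross; ring.
by rewrite !i1 q1 q2 q1' q2'.
Qed.

(** Scalar product and signed area with a nonzero vector of the plane determine e - p; the square of
    the area is known, hence so is the area once its sign is. *)
Lemma elbow_unique p eta x e e' : 0 < eta -> elbow p eta x e -> elbow p eta x e' ->
  0 < cross p x e * cross p x e' -> e = e'.
Proof.
move=> e0 he he'; have [q1 q2] := elbow_equations e0 he; have [q1' q2'] := elbow_equations e0 he'.
have pl := elbow_plane e0 he; have pl' := elbow_plane e0 he'.
have sq := elbow_cross_sqr e0 he he'.
rewrite /cross in sq *; set a := e a0 - p a0 in q2 sq *; set b := e a1 - p a1 in q2 sq *.
set a' := e' a0 - p a0 in q2' sq *; set b' := e' a1 - p a1 in q2' sq *.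
set u := x a0 - p a0 in q2 q2' sq *; set v := x a1 - p a1 in q2 q2' sq *.
rewrite -q2' in q2 => pos.
have eqc : a * v - b * u = a' * v - b' * u.
  move/eqP: sq; rewrite eqf_sqr => /orP[/eqP //|/eqP h].
  move: pos; rewrite h mulNr -expr2 oppr_gt0 => h'.
  by have := sqr_ge0 (a' * v - b' * u); rewrite leNgt h'.
have uv : u ^+ 2 + v ^+ 2 != 0.
  rewrite paddr_eq0 ?sqr_ge0 // !sqrf_eq0; apply/negP => /andP[/eqP u0 /eqP v0].
  by move: pos; rewrite u0 v0 !mulr0 subrr mul0r ltxx.
have aa : a = a'.
  apply: (mulIf uv); transitivity ((a * u + b * v) * u + (a * v - b * u) * v); first by ring.
  by rewrite q2 eqc; ring.
have bb : b = b'.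
  apply: (mulIf uv); transitivity ((a * u + b * v) * v - (a * v - b * u) * u); first by ring.
  by rewrite q2 eqc; ring.
apply/funext => c; have [->|c0] := eqVneq c a0; first exact: (addIr _ aa).
have [->|c1] := eqVneq c a1; first exact: (addIr _ bb).
by rewrite pl // pl'.
Qed.

Definition bit_sign (b : bool) : R := if b then -1 else 1.

Lemma elbow_exists p eta x (b : bool) : 0 < eta ->
  d2 x (fun c => p c - 3 * eta * ax a0 c) <= (eta / 8) ^+ 2 ->
  exists2 e, elbow p eta x e & 0 < bit_sign b * cross p x e.
Proof.
move=> e0 hx; set u := x a0 - p a0; set v := x a1 - p a1.
have e8 : 0 <= eta / 8 by rewrite divr_ge0 // ltW.
have := d2_coord_le a0 e8 hx; rewrite /ax eqxx /= mulr1 ler_norml => /andP[k1 k2].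
have hu : x a0 - (p a0 - 3 * eta) = u + 3 * eta by rewrite /u; ring.
rewrite hu in k1 k2.
have dE : d2 x p = d2 x (fun c => p c - 3 * eta * ax a0 c) - 6 * eta * (u + 3 * eta) + 9 * eta ^+ 2.
  have -> : (fun c => p c - 3 * eta * ax a0 c) = (fun c => p c + (- (3 * eta)) * ax a0 c).
    by apply/funext => c; ring.
  by rewrite d2_ax -/u; ring.
have d0 := d2_ge0 x (fun c => p c - 3 * eta * ax a0 c).
set D := d2 x _ in hx dE d0.
(* C is the scalar product that the bar lengths force on e - p and x - p, and T is the squared
   length of x - p projected to the plane; C^2 < eta^2 T says that the circle has two distinct
   admissible points. *)
pose C := (d2 x p - 8 * eta ^+ 2) / 2; pose T := u ^+ 2 + v ^+ 2.
have C1 : C ^+ 2 < eta ^+ 2 * T.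
  have C2 : `|C| <= eta ^+ 2.
    rewrite ler_norml /C dE; apply/andP; split; nra.
  have C3 : C ^+ 2 <= eta ^+ 2 * eta ^+ 2.
    by rewrite -expr2 -[C ^+ 2]real_normK ?num_real // lerXn2r // ?nnegrE // sqr_ge0.
  apply: le_lt_trans C3 _; rewrite ltr_pM2l ?exprn_gt0 // /T.
  have := sqr_ge0 v; nra.
pose Del := bit_sign b * Num.sqrt (eta ^+ 2 * T - C ^+ 2).
have S0 : 0 < Num.sqrt (eta ^+ 2 * T - C ^+ 2) by rewrite sqrtr_gt0 subr_gt0.
have sb2 : bit_sign b ^+ 2 = 1 by rewrite /bit_sign; case: (b); rewrite ?sqrrN expr1n.
have Del2 : Del ^+ 2 = eta ^+ 2 * T - C ^+ 2.
  by rewrite exprMn sb2 mul1r sqr_sqrtr // subr_ge0 ltW.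
have T0 : 0 < T by rewrite -(pmulr_rgt0 _ (exprn_gt0 2 e0)); apply: le_lt_trans C1; apply: sqr_ge0.
have Tn : T != 0 by rewrite gt_eqF.
(* The vector of the plane whose scalar product with (u, v) is C and whose signed area with it is
   [Del]. *)
pose al := (C * u + Del * v) / T; pose be := (C * v - Del * u) / T.
pose e : vec := fun c => p c + (al * ax a0 c + be * ax a1 c).
have ax0 : ax a0 a0 = 1 :> R by rewrite /ax eqxx.
have ax1 : ax a1 a1 = 1 :> R by rewrite /ax eqxx.
have ax01 : ax a0 a1 = 0 :> R by rewrite /ax (negbTE a10).
have ax10 : ax a1 a0 = 0 :> R by rewrite /ax eq_sym (negbTE a10).
have ea0 : e a0 - p a0 = al by rewrite /e ax0 ax10; ring.
have ea1 : e a1 - p a1 = be by rewrite /e ax1 ax01; ring.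
have er r : r != a0 -> r != a1 -> e r - p r = 0.
  by move=> r0 r1; rewrite /e /ax (negbTE r0) (negbTE r1) /=; ring.
have dep : d2 e p = eta ^+ 2.
  rewrite /d2 sum_plane; last by move=> r r0 r1; rewrite er // expr0n.
  rewrite ea0 ea1; transitivity ((C ^+ 2 + Del ^+ 2) / T).
    by rewrite /al /be; move: Tn; rewrite /T => Tn; field.
  by rewrite Del2; field.
exists e; last first.
  rewrite /cross ea0 ea1 -/u -/v; have -> : al * v - be * u = Del.
    by rewrite /al /be; move: Tn; rewrite /T => Tn; field.
  by rewrite /Del mulrA -expr2 sb2 mul1r.
split=> //.
  have h3 : d2 e x = d2 x p - 2 * (\sum_c (e c - p c) * (x c - p c)) + d2 e p.
    rewrite mulr_sumr /d2 -sumrB -big_split; apply: eq_bigr => c _ /=; ring.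
  rewrite h3 sum_plane; last by move=> r r0 r1; rewrite er // mul0r.
  rewrite ea0 ea1 -/u -/v dep; have -> : al * u + be * v = C.
    by rewrite /al /be; move: Tn; rewrite /T => Tn; field.
  by rewrite /C; field.
by move=> r r0 r1; rewrite d2_ax dep er //; ring.
Qed.

Lemma elbow_local (I : finType) p eta (X : (I -> R) -> vec) y1 e1 : 0 < eta ->
  (forall c, ana (fun y => X y c) y1) -> elbow p eta (X y1) e1 -> cross p (X y1) e1 != 0 ->
  exists v : (I -> R) -> vec, [/\ (forall c, ana (fun y => v y c) y1), v y1 = e1 &
    near_box y1 (fun y => elbow p eta (X y) (v y) /\ 0 < cross p (X y1) e1 * cross p (X y) (v y))].
Proof.
move=> e0 aX he cr; have pl := elbow_plane e0 he.
(* The elbow is a trilateration from p, from x and from the points p + eta e_r; it is nondegenerate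
   because the signed area does not vanish. *)
pose u (i : 'I_n) (y : I -> R) : vec :=
  if i == a0 then p else if i == a1 then X y else fun c => p c + eta * ax i c.
have au i c : ana (fun y => u i y c) y1.
  rewrite /u; case: (i == a0); first exact: ana_const.
  by case: (i == a1); [exact: aX|exact: ana_const].
have nd : nondeg (fun i c => e1 c - u i y1 c).
  move=> w hw; have h0 := hw a0; have h1 := hw a1; rewrite /u eqxx in h0.
  rewrite /u (negbTE a10) eqxx in h1.
  have wr r : r != a0 -> r != a1 -> w r = 0.
    move=> r0 r1; have := hw r; rewrite /u (negbTE r0) (negbTE r1) => hr.
    have : eta * w r = 0.
      rewrite -(sum_ax w r) mulr_sumr; transitivity (\sum_c (e1 c - p c) * w c -
        \sum_c (e1 c - (p c + eta * ax r c)) * w c); last by rewrite h0 hr subrr.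
      rewrite -sumrB; apply: eq_bigr => c _; ring.
    by move/eqP; rewrite mulf_eq0 (gt_eqF e0) /= => /eqP.
  rewrite sum_plane in h0; last by move=> r r0 r1; rewrite wr // mulr0.
  rewrite sum_plane in h1; last by move=> r r0 r1; rewrite wr // mulr0.
  have w0 : cross p (X y1) e1 * w a0 = 0.
    rewrite /cross; transitivity ((X y1 a1 - p a1) * ((e1 a0 - p a0) * w a0 + (e1 a1 - p a1) * w a1)
      - (e1 a1 - p a1) * (((e1 a0 - p a0) * w a0 + (e1 a1 - p a1) * w a1) -
         ((e1 a0 - X y1 a0) * w a0 + (e1 a1 - X y1 a1) * w a1))); first by ring.
    by rewrite h0 h1; ring.
  have w1 : cross p (X y1) e1 * w a1 = 0.
    rewrite /cross; transitivity ((e1 a0 - p a0) * (((e1 a0 - p a0) * w a0 + (e1 a1 - p a1) * w a1) -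
         ((e1 a0 - X y1 a0) * w a0 + (e1 a1 - X y1 a1) * w a1)) -
        (X y1 a0 - p a0) * ((e1 a0 - p a0) * w a0 + (e1 a1 - p a1) * w a1)); first by ring.
    by rewrite h0 h1; ring.
  move=> r; have [->|r0] := eqVneq r a0.
    by move/eqP: w0; rewrite mulf_eq0 (negbTE cr) => /eqP.
  have [->|r1] := eqVneq r a1; last exact: wr.
  by move/eqP: w1; rewrite mulf_eq0 (negbTE cr) => /eqP.
have [v [av v1 ev]] := trilateration_local au nd.
exists v; split=> //.
have ac : ana (fun y => cross p (X y1) e1 * cross p (X y) (v y)) y1.
  apply: anaM; first exact: ana_const.
  by apply: anaB; apply: anaM; apply: anaB => //; exact: ana_const.
have c2 : 0 < cross p (X y1) e1 * cross p (X y1) e1 by rewrite -expr2 exprn_even_gt0.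
have cn := ana_cont ac c2; rewrite v1 in cn.
apply: near_boxW (near_boxI ev cn) => y [hy cy]; split; last first.
  by move: cy; rewrite ltr_norml => /andP[h _]; lra.
case: he => q1 q2 q3; split=> [||r r0 r1].
- by have := hy a0; rewrite /u eqxx q1.
- by have := hy a1; rewrite /u (negbTE a10) eqxx q2.
by have := hy r; rewrite /u (negbTE r0) (negbTE r1) q3.
Qed.

(** A squared triangle inequality whose weights 4 and 4/3 are adapted to the ratio 1 : 3 of the
    arms, so that it is sharp for a straight elbow. *)
Lemma elbow_cable p eta x e : elbow p eta x e -> d2 p x <= (4 * eta) ^+ 2.
Proof.
case=> h1 h2 _.
have : d2 p x <= 4 * d2 e p + 4 / 3 * d2 e x.
  rewrite /d2 !mulr_sumr -big_split; apply: ler_sum => c _ /=.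
  have := sqr_ge0 (3 * (e c - p c) + (e c - x c)); nra.
by rewrite h1 h2 => h; apply: le_trans h _; rewrite le_eqVlt; apply/orP; left; apply/eqP; field.
Qed.

End Elbow.

(** * The classical linkage and its sheets *)

Section ClassicalLinkage.
Context {R : realType} {n : nat}.
Notation vec := ('I_n -> R).
Variables (k : nat) (rho : R) (a0 a1 : 'I_n).
Hypothesis (rho_ge0 : 0 <= rho) (a10 : a1 != a0).
Notation ins := ('I_k * 'I_n -> R).
Notation inp := (@inp R n k).
Variable S : seq (@step R n).
Hypothesis gS : good k rho a0 S.
Let N := size S.
Let V : finType := ('I_N + 'I_N * 'I_n)%type.
Let cab (v : nat) := step_cable (nth Free S v).
Let wS : wf S := good_wf gS.

Let cabP v p x l : cab v = Some (p, x, l) -> nth Free S v = Cable p x l.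
Proof. by rewrite /cab; case: (nth Free S v) => // ? ? ? [-> -> ->]. Qed.

Let cab_lt (v : 'I_N) p x l : cab v = Some (p, x, l) -> (x < v)%N /\ 0 < l.
Proof. by move=> /cabP e; have := wS (ltn_ord v); rewrite e. Qed.

(* Vertex inr (v, a0) is the elbow replacing the cable of vertex v, and inr (v, r) with
   r <> a0, a1 is a fixed point confining it to a plane; the others are idle and pinned. *)
Definition elbow_fixed (u : V) : option vec :=
  match u with
  | inl v => step_fixed (nth Free S v)
  | inr (v, r) =>
    if cab v is Some (p, _, l) then
      if r == a0 then None else Some (fun c => p c + l / 4 * ax r c)
    else Some (fun=> 0)
  end.

(** For a cable of length l the arms are eta = l / 4 and 3 eta; the distance sqrt 2 eta to p + eta
    e_r forces the component of the elbow along e_r to vanish. *)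
Definition elbow_link (u u' : V) : option (R * bool) :=
  match u, u' with
  | inl v, inl w => omap (fun l => (l, false)) (step_bar (nth Free S v) w)
  | inr (v, r), inl w =>
    if cab v is Some (_, x, l) then
      if r != a0 then None
      else if w == v then Some (l / 4, false)
      else if w == x :> nat then Some (3 * (l / 4), false) else None
    else None
  | inr (v, r), inr (v', r') =>
    if cab v is Some (_, _, l) then
      if [&& r == a0, v == v', r' != a0 & r' != a1] then Some (Num.sqrt 2 * (l / 4), false)
      else None
    else None
  | inl _, inr _ => None
  end.

Lemma elbow_link_asym u u' : elbow_link u u' -> elbow_link u' u = None.
Proof.
case: u u' => [v|[v r]] [w|[v' r']] //=.
  case E: (step_bar _ _) => [l|//] _; have [wv _] := step_bar_lt (wS (ltn_ord v)) E.
  case E': (step_bar _ _) => [l'|//]; have [vw _] := step_bar_lt (wS (ltn_ord w)) E'.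
  by have := ltn_trans wv vw; rewrite ltnn.
case: (cab v) => [[[p x] l]|//]; case: ifP => // /and4P[_ _ r0 _] _.
by case: (cab v') => [[[p' x'] l']|//]; rewrite (negbTE r0).
Qed.

Lemma elbow_link_pos u u' q : elbow_link u u' = Some q -> 0 < q.1.
Proof.
case: u u' => [v|[v r]] [w|[v' r']] //=.
- case E: (step_bar _ _) => [l|//] [<-] /=.
  by have [] := step_bar_lt (wS (ltn_ord v)) E.
- case E: (cab v) => [[[p x] l]|//]; have [_ l0] := cab_lt E.
  case: ifP => // _; case: ifP => [_ [<-]|_]; first by rewrite divr_gt0.
  by case: ifP => // _ [<-]; rewrite mulr_gt0 // divr_gt0.
case E: (cab v) => [[[p x] l]|//]; have [_ l0] := cab_lt E.
by case: ifP => // _ [<-]; rewrite mulr_gt0 ?sqrtr_gt0 // divr_gt0.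
Qed.

Lemma elbow_link_rigid u u' q : elbow_link u u' = Some q -> q.2 = false.
Proof.
case: u u' => [v|[v r]] [w|[v' r']] //=.
- by case: (step_bar _ _) => [l|//] [<-].
- case: (cab v) => [[[p x] l]|//]; case: ifP => // _; case: ifP => [_ [<-] //|_].
  by case: ifP => // _ [<-].
by case: (cab v) => [[[p x] l]|//]; case: ifP => // _ [<-].
Qed.

Definition classical_linkage := mk_linkage elbow_fixed elbow_link_asym elbow_link_pos.

Lemma classical_linkage_classical : classical classical_linkage.
Proof. exact: mk_classical elbow_link_rigid. Qed.

Definition core (phi : V * 'I_n -> R) : nat -> vec :=
  @posn R n S (fun vc => phi (inl vc.1, vc.2)).
Definition elb (phi : V * 'I_n -> R) (v : 'I_N) : vec := vpos phi (inr (v, a0)).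

Lemma coreE phi (v : 'I_N) : core phi v = vpos phi (inl v).
Proof. by rewrite /core posnE. Qed.

Lemma classical_configP phi : config classical_linkage phi <->
  [/\ cfg S (core phi),
      forall (v : 'I_N) r p, elbow_fixed (inr (v, r)) = Some p -> vpos phi (inr (v, r)) = p &
      forall (v : 'I_N) p x l, cab v = Some (p, x, l) ->
        elbow a0 a1 p (l / 4) (core phi x) (elb phi v)].
Proof.
split=> [/mk_configP[h1 h2]|[h1 h2 h3]].
  have hfix (v : 'I_N) p : step_fixed (nth Free S v) = Some p -> core phi v = p.
    by move=> e; rewrite coreE; exact: h1 (inl v) p e.
  have helb (v : 'I_N) p x l : cab v = Some (p, x, l) ->
      elbow a0 a1 p (l / 4) (core phi x) (elb phi v).
    move=> E; have [xv l0] := cab_lt E.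
    have xN : (x < N)%N := ltn_trans xv (ltn_ord v).
    have pv : core phi v = p by apply: hfix; rewrite (cabP E).
    have q1 := h2 (inr (v, a0)) (inl v) (l / 4) false.
    have q2 := h2 (inr (v, a0)) (inl (Ordinal xN)) (3 * (l / 4)) false.
    rewrite /= E eqxx /= eqxx in q1; rewrite /= E eqxx /= eqxx in q2.
    split.
    - by rewrite /elb -pv coreE q1.
    - have -> : core phi x = core phi (Ordinal xN) by [].
      rewrite /elb coreE q2 //; case: eqP => // e; move: xv; rewrite -e /=.
      by rewrite ltnn.
    move=> r r0 r1; have q3 := h2 (inr (v, a0)) (inr (v, r)) (Num.sqrt 2 * (l / 4)) false.
    have q4 := h1 (inr (v, r)).
    rewrite /= E !eqxx r0 r1 /= in q3; rewrite /= E (negbTE r0) in q4.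
    by rewrite /elb -(q4 _ erefl) q3 // exprMn sqr_sqrtr.
  split=> // [|v r p e]; last exact: h1 (inr (v, r)) p e.
  suff hv (v : 'I_N) : sat (core phi) v (nth Free S v) by move=> i iN; exact: (hv (Ordinal iN)).
  have := hfix v; have := helb v; have := wS (ltn_ord v); rewrite /cab.
  have := fun w l => h2 (inl v) (inl w) l false; rewrite /= -coreE.
  case: (nth Free S v) => [|p|p x l|nb] //=.
  - by move=> _ _ _ /(_ _ erefl).
  - move=> _ [xv l0] /(_ _ _ _ erefl) /elbow_cable h /(_ _ erefl) ->; split=> //.
    by have -> : l = 4 * (l / 4) by field.
  move=> hb [unb hnb] _ _ [w r] wnb /=; have [wv r0] := hnb _ wnb.
  have wN : (w < N)%N := ltn_trans wv (ltn_ord v).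
  have := hb (Ordinal wN) r; rewrite -coreE; apply => /=.
  by have /= -> := (step_barP w r unb).2 wnb.
apply/mk_configP; split=> [[v|[v r]] p e|].
- rewrite -coreE; have := h1 v (ltn_ord v); move: e => /=.
  case: (nth Free S v) => [|p0|p0 x l|nb] //=; first by case=> <-.
  by case=> <- [].
- exact: h2.
move=> [v|[v r]] [w|[v' r']] l b //=.
- have := h1 v (ltn_ord v); have := wS (ltn_ord v); rewrite -!coreE.
  case: (nth Free S v) => [|p0|p0 x r|nb] //= [unb hnb] h.
  case E: (@step_bar R n (Bars nb) w) => [r|]; rewrite /step_bar in E; rewrite E // => -[<- <-].
  exact: (h (nat_of_ord w, r) ((step_barP w r unb).1 E)).
- case E: (cab v) => [[[p x] l']|//]; case: eqP => // ->.
  have [q1 q2 _] := h3 _ _ _ _ E; have [xv l0] := cab_lt E.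
  have pv : core phi v = p by have := h1 v (ltn_ord v); rewrite (cabP E) => -[].
  case: eqP => [->|_] /=; first by case=> <- <-; rewrite -coreE pv.
  by case: eqP => // wx [<- <-]; rewrite -coreE wx.
case E: (cab v) => [[[p x] l']|//]; case: ifP => // /and4P[/eqP -> /eqP <- r0 r1] [<- <-].
have [_ _ q3] := h3 _ _ _ _ E; have q4 := h2 v r'.
rewrite /= E (negbTE r0) in q4.
by rewrite (q4 _ erefl) -/(elb phi v) q3 // [RHS]exprMn sqr_sqrtr.
Qed.

Definition elbow_in_vertex (l : 'I_k) : V := inl (in_vertex gS l).

Lemma vmap_core phi : vmap elbow_in_vertex phi = inp (core phi).
Proof. by rewrite /core -(vmap_inp gS); apply/funext => -[]. Qed.

Section Sheets.
Variables (U : ins -> Prop) (g : ins -> nat -> vec) (M : R).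
Hypothesis sol : solves rho a0 S U g M.

Let is_elbow x (v : 'I_N) (b : bool) (e : vec) :=
  if cab v is Some (p, y, l) then
    elbow a0 a1 p (l / 4) (g x y) e /\ 0 < bit_sign b * cross a0 a1 p (g x y) e
  else e = fun=> 0.

(** On this open set every elbow has both of its positions; the sheets are analytic there, and it
    contains the box. *)
Let sheet_dom x := U x /\ forall v b, exists e, is_elbow x v b e.

Let el x v b : vec := xget (fun=> 0) (is_elbow x v b).

Let elP x v b : sheet_dom x -> is_elbow x v b (el x v b).
Proof. by move=> [_ h]; apply: xgetPex. Qed.

Let is_elbow_uniq x v b e e' : is_elbow x v b e -> is_elbow x v b e' -> e = e'.
Proof.
rewrite /is_elbow; case E: (cab v) => [[[p y] l]|] => [[h1 h2] [h3 h4]|-> ->] //.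
have [_ l0] := cab_lt E; have l40 : 0 < l / 4 by rewrite divr_gt0.
apply: elbow_unique l40 h1 h3 _ => //.
have := mulr_gt0 h2 h4; rewrite mulrACA [bit_sign b * bit_sign b](_ : _ = 1) ?mul1r //.
by rewrite /bit_sign; case: (b); rewrite ?mulrNN mulr1.
Qed.

Let g_ana x (i : nat) c : U x -> (i < N)%N -> ana (fun y => g y i c) x.
Proof. by case: sol => [[_ h] _ _ _ _] Ux iN; apply: h. Qed.

Let el_local x v b : sheet_dom x -> exists e : ins -> vec, (forall c, ana (fun y => e y c) x) /\
  near_box x (fun y => is_elbow y v b (e y)).
Proof.
move=> dx; have := elP v b dx; rewrite /is_elbow; case E: (cab v) => [[[p y] l]|] => [[h1 h2]|_].
  have [xv l0] := cab_lt E; have l40 : 0 < l / 4 by rewrite divr_gt0.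
  have yN : (y < N)%N := ltn_trans xv (ltn_ord v).
  have cn : cross a0 a1 p (g x y) (el x v b) != 0.
    by apply: contraTneq h2 => ->; rewrite mulr0 ltxx.
  have [e [ae _ ne]] := elbow_local a10 l40 (fun c => g_ana c dx.1 yN) h1 cn.
  exists e; split=> //; apply: near_boxW ne => z [q1 q2]; split=> //.
  have h := mulr_gt0 h2 q2.
  have c0 : 0 < cross a0 a1 p (g x y) (el x v b) ^+ 2 by rewrite exprn_even_gt0.
  rewrite -(pmulr_rgt0 _ c0); move: h; congr (0 < _); ring.
exists (fun _ _ => 0); split; first by move=> c; apply: ana_const.
by exists 1.
Qed.

Let sheet_dom_open x : sheet_dom x -> near_box x sheet_dom.
Proof.
move=> dx; case: (sol) => [[oU _] _ _ _ _].
have h : near_box x (fun y => forall v, forall b, exists e, is_elbow y v b e).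
  apply: near_box_all => v; apply: (near_box_all (J := bool)) => b.
  by have [e [_ ne]] := el_local v b dx; apply: near_boxW ne => y; exists (e y).
by apply: near_boxW (near_boxI (oU _ dx.1) h) => y [].
Qed.

Let el_ana x v b c : sheet_dom x -> ana (fun y => el y v b c) x.
Proof.
move=> dx; have [e [ae ne]] := el_local v b dx; apply: ana_eq_near (ae c).
apply: near_boxW (near_boxI ne (sheet_dom_open dx)) => y [ey dy].
by rewrite (is_elbow_uniq ey (elP v b dy)).
Qed.

Let sheet_dom_box x : inbox rho x -> sheet_dom x.
Proof.
move=> Kx; case: (sol) => [_ hU KU sl _]; have [cx ix] := KU x Kx.
have [Ux _] := hU _ cx; rewrite ix in Ux; split=> // v b; rewrite /is_elbow.
case E: (cab v) => [[[p y] l]|]; last by exists (fun=> 0).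
have [_ l0] := cab_lt E; have l40 : 0 < l / 4 by rewrite divr_gt0.
have := sl v p y l (ltn_ord v) (cabP E) x Kx.
have -> : slack_center a0 p l = fun c => p c - 3 * (l / 4) * ax a0 c.
  by apply/funext => c; rewrite /slack_center; field.
have -> : l / 32 = l / 4 / 8 by field.
by move=> /(elbow_exists a10 b l40)[e]; exists e.
Qed.

(* A sheet is a choice of side for each elbow, so only cables may carry a bit. *)
Let B : {set {ffun 'I_N -> bool}} :=
  [set eps : {ffun 'I_N -> bool} | [forall v : 'I_N, eps v ==> isSome (cab v)]]%SET.

Let B0 : [ffun=> false] \in B.
Proof. by rewrite inE; apply/forallP => v; rewrite ffunE. Qed.

(** Rounding the label coordinate within 1/4 keeps the sheet constant near each label, so that
    [sigma] is analytic on a neighbourhood of its domain in the ambient coordinate space. *)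
Let sheet_bits (t : R) : {ffun 'I_N -> bool} :=
  if [pick c : 'I_#|B| | `|t - (c : nat)%:R| < 4^-1] is Some c then enum_val c
  else [ffun=> false].

Let sheet_bitsE (t : R) (c : 'I_#|B|) : `|t - (c : nat)%:R| < 4^-1 -> sheet_bits t = enum_val c.
Proof.
move=> h; rewrite /sheet_bits; case: pickP => [c' h'|/(_ c)]; last by rewrite h.
congr enum_val; apply: val_inj; apply/eqP; apply/negP => /negP ne.
have : `|(c : nat)%:R - (c' : nat)%:R : R| < 2^-1.
  have -> : (c : nat)%:R - (c' : nat)%:R = - (t - c%:R) + (t - c'%:R) :> R by ring.
  by apply: (le_lt_trans (ler_normD _ _)); rewrite normrN; lra.
move: ne; rewrite neq_ltn => /orP[] lt; last rewrite -normrN opprB;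
  rewrite -natrB ?(ltnW lt) // normr_nat => h2.
  have : (1 <= c - c')%N by rewrite subn_gt0.
  by rewrite -(ler_nat R); lra.
have : (1 <= c' - c)%N by rewrite subn_gt0.
by rewrite -(ler_nat R); lra.
Qed.

Let sigma (z : option ('I_k * 'I_n) -> R) (uc : V * 'I_n) : R :=
  let x := fun j => z (Some j) in
  match uc.1 with
  | inl v => g x v uc.2
  | inr (v, r) => if r == a0 then el x v (sheet_bits (z None) v) uc.2
                  else odflt (fun=> 0) (elbow_fixed (inr (v, r))) uc.2
  end.

Let cross_bits (phi : V * 'I_n -> R) : {ffun 'I_N -> bool} :=
  [ffun v : 'I_N => if cab v is Some (p, y, l) then cross a0 a1 p (core phi y) (elb phi v) < 0 else false].

Let cross_bitsB phi : cross_bits phi \in B.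
Proof. by rewrite inE; apply/forallP => v; rewrite ffunE; case: (cab v) => [[[p y] l]|] //=; rewrite implybT. Qed.

Let unsigma (phi : V * 'I_n -> R) (o : option ('I_k * 'I_n)) : R :=
  if o is Some (l, c) then phi (elbow_in_vertex l, c)
  else (enum_rank_in B0 (cross_bits phi) : nat)%:R.

Let sigma_config z : sheet_dom (fun j => z (Some j)) -> cfg S (g (fun j => z (Some j))) ->
  inp (g (fun j => z (Some j))) = (fun j => z (Some j)) ->
  config classical_linkage (sigma z) /\ forall i, (i < N)%N -> core (sigma z) i = g (fun j => z (Some j)) i.
Proof.
set x := fun j => z (Some j) => dx cx ix.
have ce i : (i < N)%N -> core (sigma z) i = g x i.
  by move=> iN; rewrite -[i]/(nat_of_ord (Ordinal iN)) coreE.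
split=> //; apply/classical_configP; split.
- by apply: (cfg_eq wS) cx => i iN; rewrite ce.
- move=> v r p e; apply/funext => c; rewrite /vpos /sigma /=.
  move: e => /=; case E: (cab v) => [[[q y] l]|] /=.
    by case: ifP => // _ [<-].
  move=> [<-]; case: ifP => // _; have := elP v (sheet_bits (z None) v) dx.
  by rewrite /is_elbow E => ->.
move=> v p y l E; have := elP v (sheet_bits (z None) v) dx; rewrite /is_elbow E => -[h _].
have [yv _] := cab_lt E; rewrite ce; last exact: ltn_trans yv (ltn_ord v).
suff -> : elb (sigma z) v = el x v (sheet_bits (z None) v) by [].
by apply/funext => c; rewrite /elb /vpos /sigma /= eqxx.
Qed.

Lemma classical_functional (m : nat) (f : ins -> ('I_m * 'I_n -> R)) (K : set ins)
    (out : 'I_m -> 'I_N) :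
  (forall x, K x -> inbox rho x) ->
  (forall l phi, cfg S phi -> phi (out l) = fun c => f (inp phi) (l, c)) ->
  @functional R n k m classical_linkage f elbow_in_vertex (fun l => inl (out l)) K.
Proof.
move=> KI hout; case: (sol) => [[oU aU] hU KU sl bU].
have sig z : K (fun j => z (Some j)) -> [/\ config classical_linkage (sigma z),
    vmap elbow_in_vertex (sigma z) = (fun j => z (Some j)) &
    forall i, (i < N)%N -> core (sigma z) i = g (fun j => z (Some j)) i].
  move=> /KI Kx; have [cx ix] := KU _ Kx.
  by have [cs ce] := @sigma_config z (sheet_dom_box Kx) cx ix; split.
split.
- move=> phi /classical_configP[cphi _ _]; apply/funext => -[l c].
  rewrite vmap_core /vmap /=; have /(congr1 (fun u => u c)) := hout l _ cphi.
  by rewrite coreE.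
- move=> x Kx; pose z o := if o is Some j then x j else 0 : R.
  by have [cs vs _] := sig z Kx; exists (sigma z).
exists #|B|, sigma.
(* Over the box some position of the elbow is bent, hence every position is, since the square of the
   signed area depends only on the cable's end. *)
have crossE phi : config classical_linkage phi -> inbox rho (inp (core phi)) ->
    forall (v : 'I_N) p y l, cab v = Some (p, y, l) -> cross a0 a1 p (core phi y) (elb phi v) != 0.
  move=> /classical_configP[cphi _ h3] Kphi v p y l E.
  have := elP v false (sheet_dom_box Kphi); rewrite /is_elbow E => -[q1 q2].
  have [yv l0] := cab_lt E; have l40 : 0 < l / 4 by rewrite divr_gt0.
  have [_ ec] := hU _ cphi; have yN : (y < N)%N := ltn_trans yv (ltn_ord v).
  have q3 := h3 _ _ _ _ E; rewrite ec // in q3 *.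
  rewrite -sqrf_eq0 (elbow_cross_sqr a10 l40 q3 q1) sqrf_eq0.
  by apply: contraTneq q2 => ->; rewrite mulr0 ltxx.
have part1 z : prodE K #|B| z ->
    (config classical_linkage `&` vmap elbow_in_vertex @^-1` K) (sigma z).
  by move=> [Kz _]; have [cs vs _] := sig z Kz; split=> //=; rewrite vs.
have part2 phi : (config classical_linkage `&` vmap elbow_in_vertex @^-1` K) phi ->
    prodE K #|B| (unsigma phi).
  move=> [cphi Kphi]; split; last by exists (enum_rank_in B0 (cross_bits phi)).
  suff -> : (fun j => unsigma phi (Some j)) = vmap elbow_in_vertex phi by [].
  by apply/funext => -[l c].
have part3 z : prodE K #|B| z -> unsigma (sigma z) = z.
  move=> [Kz [c zc]]; have [cs vs ce] := sig z Kz; apply/funext => -[[l d]|] /=.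
    by have /(congr1 (fun u => u (l, d))) := vs.
  rewrite zc; congr (_%:R); have hb : sheet_bits (z None) = enum_val c.
    by apply: sheet_bitsE; rewrite zc subrr normr0 invr_gt0.
  suff -> : cross_bits (sigma z) = enum_val c by rewrite enum_valK_in.
  apply/ffunP => v; rewrite ffunE -hb.
  case E: (cab v) => [[[p y] l]|]; last first.
    have := enum_valP c; rewrite -hb inE => /forallP /(_ v); rewrite E.
    by case: (sheet_bits _ _).
  have := elP v (sheet_bits (z None) v) (sheet_dom_box (KI _ Kz)); rewrite /is_elbow E => -[_].
  have [yv l0] := cab_lt E; rewrite ce; last exact: ltn_trans yv (ltn_ord v).
  have -> : elb (sigma z) v = el (fun j => z (Some j)) v (sheet_bits (z None) v).
    by apply/funext => d; rewrite /elb /vpos /sigma /= eqxx.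
  rewrite /bit_sign; case: (sheet_bits (z None) v); first by rewrite mulN1r oppr_gt0.
  by rewrite mul1r => h; apply/negbTE; rewrite -leNgt ltW.
have part4 phi : (config classical_linkage `&` vmap elbow_in_vertex @^-1` K) phi ->
    sigma (unsigma phi) = phi.
  move=> [cphi Kphi]; have ux : (fun j => unsigma phi (Some j)) = vmap elbow_in_vertex phi.
    by apply/funext => -[l c].
  have Kp : inbox rho (inp (core phi)) by apply: KI; rewrite -vmap_core.
  have hb : sheet_bits (unsigma phi None) = cross_bits phi.
    rewrite (@sheet_bitsE _ (enum_rank_in B0 (cross_bits phi))); last first.
      by rewrite /unsigma subrr normr0 invr_gt0.
    by rewrite enum_rankK_in ?cross_bitsB.
  have /classical_configP[cS h2 h3] := cphi; have [_ ec] := hU _ cS.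
  apply/funext => -[[v|[v r]] c]; rewrite /sigma /= ux vmap_core.
    by rewrite -ec // coreE.
  have [->|r0] := eqVneq r a0; last first.
    have := h2 v r; rewrite /=; case: (cab v) => [[[p y] l]|]; rewrite ?(negbTE r0) => h.
      exact: esym (congr1 (fun u : vec => u c) (h _ erefl)).
    exact: esym (congr1 (fun u : vec => u c) (h _ erefl)).
  rewrite hb; suff -> : el (inp (core phi)) v (cross_bits phi v) = elb phi v by [].
  apply: is_elbow_uniq (elP v _ (sheet_dom_box Kp)) _; rewrite /is_elbow ffunE.
  case E: (cab v) => [[[p y] l]|]; last by apply: h2; rewrite /= E.
  have cn := crossE _ cphi Kp _ _ _ _ E; have q3 := h3 _ _ _ _ E.
  have [yv l0] := cab_lt E; rewrite -ec; last exact: ltn_trans yv (ltn_ord v).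
  split=> //; rewrite /bit_sign; case: (ltP (cross a0 a1 p (core phi y) (elb phi v)) 0) => h; first by rewrite mulN1r oppr_gt0.
  by rewrite mul1r lt_neqAle eq_sym cn.
split; last by move=> z [Kz _]; have [] := sig z Kz.
pose Us (z : option ('I_k * 'I_n) -> R) := sheet_dom (fun j => z (Some j)) /\ exists c : 'I_#|B|, `|z None - (c : nat)%:R| < 4^-1.
have ok1 := restr_analytic_intro (A := prodE K #|B|) (U := Us) (G := sigma) (g := sigma).
(* Where no signed area vanishes the sign pattern, hence the label, is locally constant, so
   [unsigma] is analytic there. *)
pose Uh (phi : V * 'I_n -> R) := forall (v : 'I_N), if cab v is Some (p, y, l) return Prop then
  cross a0 a1 p (core phi y) (elb phi v) != 0 else True.
have ok2 := restr_analytic_intro (A := config classical_linkage `&` vmap elbow_in_vertex @^-1` K)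
  (U := Uh) (G := unsigma) (g := unsigma).
have near_bits (z : option ('I_k * 'I_n) -> R) (c : 'I_#|B|) : `|z None - (c : nat)%:R| < 4^-1 -> near_box z (fun y =>
    `|y None - (c : nat)%:R| < 4^-1 :> R).
  exact: ana_near_lt (ana_coord None z).
have [] := ok1.
- move=> z [dz [c hc]]; have h1 := near_box_Some (sheet_dom_open dz).
  by apply: near_boxW (near_boxI h1 (near_bits z c hc)) => y [? ?]; split=> //; exists c.
- move=> z [dz [c hc]] [[v|[v r]] d]; rewrite /sigma /=.
    exact: (ana_Some (g_ana d dz.1 (ltn_ord v))).
  case: (r == a0); last exact: ana_const.
  apply: ana_eq_near (ana_Some (el_ana v (enum_val c v) d dz)).
  by apply: near_boxW (near_bits z c hc) => y hy; rewrite (sheet_bitsE hy).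
- move=> z [Kz [c zc]]; split; first exact: sheet_dom_box (KI _ Kz).
  by exists c; rewrite zc subrr normr0 invr_gt0.
- by [].
move=> ra1 ct1.
have ana_core i c phi : ana (fun psi => core psi i c) phi.
  by rewrite /core /posn; case: (insub i) => [v|]; [exact: ana_coord|exact: ana_const].
have near_cross phi (v : 'I_N) : Uh phi -> near_box phi (fun psi =>
    if cab v is Some (p, y, l) return Prop then
      0 < cross a0 a1 p (core phi y) (elb phi v) * cross a0 a1 p (core psi y) (elb psi v) else True).
  move=> /(_ v); case E: (cab v) => [[[p y] l]|] h; last by exists 1.
  have ac : ana (fun psi => cross a0 a1 p (core phi y) (elb phi v) *
      cross a0 a1 p (core psi y) (elb psi v)) phi.
    apply: anaM; first exact: ana_const.
    by apply: anaB; apply: anaM; apply: anaB; try exact: ana_core; try exact: ana_coord;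
      exact: ana_const.
  have c2 : 0 < cross a0 a1 p (core phi y) (elb phi v) * cross a0 a1 p (core phi y) (elb phi v).
    by rewrite -expr2 exprn_even_gt0.
  apply: near_boxW (ana_cont ac c2) => psi; rewrite ltr_norml => /andP[q _]; lra.
have [] := ok2.
- move=> phi hphi; apply: near_boxW (near_box_all (fun v => near_cross phi v hphi)) => psi h v.
  have := h v; case: (cab v) => [[[p y] l]|] // q.
  by apply: contraTneq q => ->; rewrite mulr0 ltxx.
- move=> phi hphi [[l c]|] /=; first exact: ana_coord.
  apply: ana_eq_near (ana_const (enum_rank_in B0 (cross_bits phi) : nat)%:R phi).
  apply: near_boxW (near_box_all (fun v => near_cross phi v hphi)) => psi h.
  suff -> : cross_bits psi = cross_bits phi by [].
  apply/ffunP => v; rewrite !ffunE; have := h v; case: (cab v) => [[[p y] l]|] //.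
  move: (cross _ _ _ _ _) (cross _ _ _ _ _) => s t st.
  have [s0|s0] := ltP s 0; have [t0|t0] := ltP t 0 => //.
    by exfalso; nra.
  by exfalso; nra.
- move=> phi [cphi Kphi] v; case E: (cab v) => [[[p y] l]|] //.
  by apply: crossE E => //; apply: KI; rewrite -vmap_core.
- by [].
move=> ra2 ct2.
by exists unsigma; split; first split.
Qed.

End Sheets.
End ClassicalLinkage.

Unset Implicit Arguments.

Theorem theorem2p1 (R : realType) (n k m : nat) (hn : (2 <= n)%N)
    (f : ('I_k * 'I_n -> R) -> ('I_m * 'I_n -> R)) (hf : poly_map f)
    (K : set ('I_k * 'I_n -> R)) (hK : compact (K : set {ptws 'I_k * 'I_n -> R})) :
  (exists L : @linkage R n, classical L /\
     exists (w : 'I_k -> vert L) (v : 'I_m -> vert L),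
       functional L f w v K /\ io_distinct w v) /\
  (exists L' : @linkage R n,
     exists (w : 'I_k -> vert L') (v : 'I_m -> vert L'),
       strongly_functional L' f w v K /\ io_distinct w v).
Proof.
have [rho rho0 hrho] := compact_coord_bounded hK.
pose a0 : 'I_n := Ordinal (ltnW hn); pose a1 : 'I_n := Ordinal hn.
have a10 : a1 != a0 by [].
have hF l : realizable_new rho a0 (fun x c => f x (l, c)).
  by apply: (realizable_poly rho0 a10) => c; apply: hf (l, c).
have [S [gS _ [io [io_inj io_lt ioF]]]] := realizable_family hF (@good_free R n k rho a0).
pose out l : 'I_(size S) := Ordinal (proj2 (andP (io_lt l))).
have outF l phi : cfg S phi -> phi (out l) = fun c => f (inp phi) (l, c) by exact: ioF.
have out_inj : injective out by move=> l l' /(congr1 val) /io_inj.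
(* The initial system consists of the k free inputs, and the outputs have index at least k. *)
have in_out j j' : in_vertex gS j <> out j'.
  move=> /(congr1 val) /= e; have /andP[] := io_lt j'.
  by rewrite size_nseq -e leqNgt ltn_ord.
have in_inj : injective (in_vertex gS) by move=> j j' /(congr1 val) /= /val_inj.
have [_ _ [U [g [M sol]]]] := gS; split.
  exists (classical_linkage a1 gS); split; first exact: classical_linkage_classical.
  exists (elbow_in_vertex gS), (fun l => inl (out l)); split.
    exact: (classical_functional a10 gS sol hrho outF).
  have inl_inj : injective (@inl 'I_(size S) ('I_(size S) * 'I_n)) by move=> x y [].
  by split=> [j j' /inl_inj /in_inj|l l' /inl_inj /out_inj|j j' /inl_inj /in_out].
exists (cabled_linkage gS), (in_vertex gS), out; split; last by split.
exact: cabled_strongly_functional hrho outF.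
Qed.
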